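(* Let $T\in\mathcal{B}^{0,1}_n(V_n)$ and $f\in\mathcal{M}_{\sigma_S(T)}$. Let $U\subset\mathbb{R}^{n+1}$ be an open set such that (i) $\partial(U\cap L_I)$ is the union of a finite number of rectifiable Jordan curves for every $I\in\mathbb{S}$, (ii) $U$ contains the circularization $\mathrm{circ}(\sigma_S(T))$, and such that $f$ is s-monogenic on $U\cup\partial U$; let $U_I=U\cap L_I$ for $I\in\mathbb{S}$. Then the integral $$\frac{1}{2\pi}\int_{\partial U_I}S^{-1}(s,T)\,ds_I\,f(s)$$ does not depend on the choice of the imaginary unit $I\in\mathbb{S}$ nor on the choice of the open set $U$ with these properties.
   Context: $\mathbb{R}_n$ is the real Clifford algebra generated by units $e_1,\dots,e_n$ with $e_ie_j+e_je_i=-2\delta_{ij}$, with basis $e_A=e_{i_1}\cdots e_{i_r}$, $i_1<\dots<i_r$. An element $(s_0,\dots,s_n)\in\mathbb{R}^{n+1}$ is identified with $s=s_0+\underline{s}\in\mathbb{R}_n$, $\underline{s}=\sum_{j=1}^n s_je_j$; $\mathrm{Re}[s]=s_0$, $\overline{s}=s_0-\underline{s}$, $|s|$ is the Euclidean norm. $V$ is a real Banach space. $V_n=V\otimes\mathbb{R}_n$ is the two-sided Banach module over $\mathbb{R}_n$ of elements $v=\sum_A v_Ae_A$ ($v_A\in V$), with $va=\sum_A v_A(e_Aa)$, $av=\sum_A v_A(ae_A)$ and $\|v\|^2_{V_n}=\sum_A\|v_A\|_V^2$. $\mathcal{B}(V)$ is the space of bounded $\mathbb{R}$-linear maps $V\to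 V$. $\mathcal{B}_n(V_n)$ is the set of operators $T=\sum_A T_Ae_A$, $T_A\in\mathcal{B}(V)$, acting by $T(v)=\sum_{A,B}T_A(v_B)e_Ae_B$, with $\|T\|^2=\sum_A\|T_A\|^2_{\mathcal{B}(V)}$. $\mathcal{B}^{0,1}_n(V_n)$ is the set of those of the form $T=T_0+\sum_{j=1}^n e_jT_j$, $T_\mu\in\mathcal{B}(V)$. $\mathcal{I}$ is the identity; $a\in\mathbb{R}_n$ is regarded as the operator $v\mapsto av$, and $Ta$ denotes $T\circ(a\mathcal{I})$. $\sigma_S(T)=\{s\in\mathbb{R}^{n+1}: T^2-2\,\mathrm{Re}[s]\,T+|s|^2\mathcal{I}\text{ is not invertible}\}$, and for $s\notin\sigma_S(T)$, $S^{-1}(s,T)=-(T^2-2\,\mathrm{Re}[s]\,T+|s|^2\mathcal{I})^{-1}(T-\overline{s}\,\mathcal{I})$. $\mathbb{S}=\{\underline{x}=\sum_{j=1}^n x_je_j: \sum_j x_j^2=1\}$; for $I\in\mathbb{S}$, $L_I=\mathbb{R}+I\mathbb{R}$ (isomorphic to $\mathbb{C}$, elements written $u+Iv$). A real differentiable function $f:U\to\mathbb{R}_n$ is (left) s-monogenic (slice-monogenic) if $\frac12\left(\frac{\partial}{\partial u}+I\frac{\partial}{\partial v}\right)f_I(u+Iv)=0$ for every $I\in\mathbb{S}$, where $f_I=f|_{L_I}$. For $A\subseteq\mathbb{R}^{n+1}$, $\mathrm{circ}(A)=\bigcup_{u+vI\in A}(u+vS^n)$, where $S^n=\{x\in\mathbb{R}^{n+1}:|x|=1\}$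 (and $u,v\in\mathbb{R}$, $I\in\mathbb{S}$). $\mathcal{M}_{\sigma_S(T)}$ is the set of functions $f$ for which there is an open set $U$ satisfying (i) and (ii) of the claim on which $f$ is s-monogenic. The curves in $\partial U_I$ are positively oriented with respect to $U_I$, and $ds_I=-ds\,I$ where $ds$ is the usual line element in $L_I\cong\mathbb{C}$.
   Formalization: ''Positively oriented'' is taken as: the boundary curves have total winding number 1 about points of U_I and 0 about points outside its closure, which forces U_I to be bounded; for unbounded U the claim fails (T = 0, f = 1, U the whole space gives 0, a ball gives the identity). *)

(* Defs.v *)
From HB Require Import structures.
From mathcomp Require Import all_boot all_order all_algebra.
From mathcomp Require Import all_classical all_reals all_analysis.

Set Implicit Arguments.
Unset Strict Implicit.
Unset Printing Implicit Defensive.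

Import Order.TTheory GRing.Theory Num.Theory.
Import numFieldTopology.Exports numFieldNormedType.Exports.

Local Open Scope classical_set_scope.
Local Open Scope ring_scope.

(** [cliff n X] is X ⊗ R_n : families (x_A) standing for Σ_A x_A e_A, where
    e_A = e_{i_1} ⋯ e_{i_r} for A = {i_1 < ⋯ < i_r}. It is used with X = R
    (the Clifford algebra R_n), X = V (the module V_n) and X = B(V) (the
    algebra B_n(V_n)). *)

Definition cliff (n : nat) (X : Type) := {ffun {set 'I_n} -> X}.

HB.instance Definition _ n (X : zmodType) :=
  GRing.Zmodule.copy (cliff n X) {ffun {set 'I_n} -> X}.
HB.instance Definition _ n (K : pzRingType) (X : lmodType K) :=
  GRing.Lmodule.copy (cliff n X) {ffun {set 'I_n} -> X}.

Section CliffordProduct.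
Variable n : nat.
Implicit Types A B C : {set 'I_n}.

Definition symdiff A B : {set 'I_n} := [set i | (i \in A) (+) (i \in B)]%SET.

(** e_A e_B = (-1)^(cross A B) e_(A symdiff B): sorting the factors of e_A e_B
    costs one sign for each pair i in A, j in B with j < i, and each i in both A
    and B contributes e_i ^ 2 = -1. *)
Definition cross A B : nat := (\sum_(i in A) \sum_(j in B) (j <= i))%N.

Definition cmono (X : zmodType) (x : X) A : cliff n X :=
  [ffun B => if B == A then x else 0].

(** (Σ_A a_A e_A) (Σ_B b_B e_B) = Σ_{A,B} m(a_A, b_B) e_A e_B *)
Definition cprod (X Y Z : zmodType) (m : X -> Y -> Z)
    (a : cliff n X) (b : cliff n Y) : cliff n Z :=
  [ffun C => \sum_A \sum_(B | symdiff A B == C)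
               m (a A) (b B) *~ ((-1) ^+ cross A B)].

Lemma symdiffA : associative symdiff.
Proof. by move=> A B C; apply/setP => i; rewrite !inE addbA. Qed.

Lemma symdiffC : commutative symdiff.
Proof. by move=> A B; apply/setP => i; rewrite !inE addbC. Qed.

Lemma symdiff0 A : symdiff A finset.set0 = A.
Proof. by apply/setP => i; rewrite !inE addbF. Qed.

Lemma symdiffK A : involutive (symdiff A).
Proof. by move=> B; apply/setP => i; rewrite !inE addbA addbb. Qed.

Lemma symdiff_eq A B C : (symdiff A B == C) = (B == symdiff A C).
Proof. by rewrite -(inj_eq (inv_inj (symdiffK A))) symdiffK. Qed.

Lemma crossE A B :
  cross A B = (\sum_i \sum_j ((i \in A) && (j \in B) && (j <= i)))%N.
Proof.
rewrite /cross big_mkcond /=; apply: eq_bigr => i _.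
case: (i \in A) => /=; last by rewrite big1.
by rewrite big_mkcond /=; apply: eq_bigr => j _; case: (j \in B).
Qed.

Lemma odd_crossDl A B C :
  odd (cross (symdiff A B) C) = odd (cross A C) (+) odd (cross B C).
Proof.
rewrite -oddD !crossE -big_split /=.
rewrite !(big_morph odd oddD (erefl : odd 0 = false)).
apply: eq_bigr => i _; rewrite -big_split /=.
rewrite !(big_morph odd oddD (erefl : odd 0 = false)).
apply: eq_bigr => j _; rewrite inE oddD !oddb.
by case: (i \in A); case: (i \in B); case: (j \in C); case: (j <= i)%N.
Qed.

Lemma odd_crossDr A B C :
  odd (cross A (symdiff B C)) = odd (cross A B) (+) odd (cross A C).
Proof.
rewrite -oddD !crossE -big_split /=.
rewrite !(big_morph odd oddD (erefl : odd 0 = false)).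
apply: eq_bigr => i _; rewrite -big_split /=.
rewrite !(big_morph odd oddD (erefl : odd 0 = false)).
apply: eq_bigr => j _; rewrite inE oddD !oddb.
by case: (i \in A); case: (j \in B); case: (j \in C); case: (j <= i)%N.
Qed.

Lemma sign_cross A B C :
  ((-1) ^+ cross A B * (-1) ^+ cross (symdiff A B) C =
   (-1) ^+ cross A (symdiff B C) * (-1) ^+ cross B C :> int).
Proof.
rewrite -!exprD -signr_odd -[RHS]signr_odd !oddD odd_crossDl odd_crossDr.
by congr (_ ^+ nat_of_bool _); rewrite !addbA.
Qed.

Lemma cprodE (X Y Z : zmodType) (m : X -> Y -> Z)
    (a : cliff n X) (b : cliff n Y) C :
  cprod m a b C = \sum_A m (a A) (b (symdiff A C)) *~ ((-1) ^+ cross A (symdiff A C)).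
Proof.
rewrite ffunE; apply: eq_bigr => A _.
rewrite (eq_bigl (fun B => B == symdiff A C)); last by move=> B; exact: symdiff_eq.
by rewrite big_pred1_eq.
Qed.

Lemma cprodA (X Y Z XY YZ W : zmodType) (m1 : X -> Y -> XY) (m2 : XY -> Z -> W)
    (m3 : Y -> Z -> YZ) (m4 : X -> YZ -> W) :
  (forall x y z, m2 (m1 x y) z = m4 x (m3 y z)) ->
  (forall z, {morph m2^~ z : x y / x + y}) ->
  (forall x, {morph m4 x : y z / y + z}) ->
  forall (a : cliff n X) (b : cliff n Y) (c : cliff n Z),
    cprod m2 (cprod m1 a b) c = cprod m4 a (cprod m3 b c).
Proof.
move=> mA m2D m4D a b c; apply/ffunP => D; rewrite !cprodE.
have m2z z : m2 0 z = 0 by apply: (addrI (m2 0 z)); rewrite -m2D !addr0.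
have m4z x : m4 x 0 = 0 by apply: (addrI (m4 x 0)); rewrite -m4D !addr0.
have m2N z x : m2 (- x) z = - m2 x z.
  by apply: (addrI (m2 x z)); rewrite -m2D !subrr m2z.
have m4N x y : m4 x (- y) = - m4 x y.
  by apply: (addrI (m4 x y)); rewrite -m4D !subrr m4z.
have sgE (U : zmodType) (x : U) k : x *~ ((-1) ^+ k) = if odd k then - x else x.
  by rewrite -signr_odd; case: odd; rewrite /= ?expr1 ?expr0 ?mulrN1z ?mulr1z.
have m2S z x k : m2 (x *~ ((-1) ^+ k)) z = m2 x z *~ ((-1) ^+ k).
  by rewrite !sgE; case: odd.
have m4S x y k : m4 x (y *~ ((-1) ^+ k)) = m4 x y *~ ((-1) ^+ k).
  by rewrite !sgE; case: odd.
transitivity (\sum_E \sum_A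
   m4 (a A) (m3 (b (symdiff A E)) (c (symdiff E D)))
     *~ ((-1) ^+ cross A (symdiff A E) * (-1) ^+ cross E (symdiff E D))).
  apply: eq_bigr => E _; rewrite cprodE.
  rewrite (big_morph (m2^~ _) (m2D _) (m2z _)) mulrz_suml /=.
  by apply: eq_bigr => A _; rewrite m2S mA -mulrzA.
rewrite exchange_big /=; apply: eq_bigr => A _.
rewrite (reindex_inj (inv_inj (symdiffK A))) /= cprodE.
rewrite (big_morph (m4 _) (m4D _) (m4z _)) mulrz_suml.
apply: eq_bigr => B _; rewrite m4S symdiffK -mulrzA.
rewrite [symdiff (symdiff A B) D](_ : _ = symdiff B (symdiff A D)); last first.
  by rewrite (symdiffC A) symdiffA.
congr (_ *~ _); rewrite sign_cross.
by rewrite [symdiff B (symdiff B _)]symdiffK mulrC.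
Qed.

End CliffordProduct.

Section CliffordRing.
Variables (n : nat) (X : pzRingType).
Implicit Types a b c : cliff n X.

Definition cmul : cliff n X -> cliff n X -> cliff n X := cprod *%R.
Definition cone : cliff n X := cmono 1 finset.set0.

Fact cmulA : associative cmul.
Proof.
move=> a b c; rewrite /cmul; symmetry; apply: cprodA.
- by move=> *; rewrite mulrA.
- by move=> z x y; rewrite mulrDl.
- by move=> x y z; rewrite mulrDr.
Qed.

Fact cmul1 : left_id cone cmul.
Proof.
move=> a; apply/ffunP => C; rewrite cprodE (bigD1 finset.set0)//= big1 ?addr0.
  rewrite ffunE eqxx mul1r symdiffC symdiff0.
  by rewrite /cross big_set0 expr0 mulr1z.
by move=> A /negPf A0; rewrite ffunE A0 mul0r mul0rz.
Qed.

Fact cmulr1 : right_id cone cmul.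
Proof.
move=> a; apply/ffunP => C; rewrite cprodE (bigD1 C)//= big1 ?addr0.
  have -> : symdiff C C = finset.set0 by rewrite -[X in symdiff C X]symdiff0 symdiffK.
  rewrite ffunE eqxx mulr1 /cross big1 ?expr0 ?mulr1z// => i _.
  by rewrite big_set0.
move=> A neqAC; rewrite ffunE symdiff_eq symdiff0 eq_sym (negPf neqAC).
by rewrite mulr0 mul0rz.
Qed.

Fact cmulDl : left_distributive cmul +%R.
Proof.
move=> a b c; apply/ffunP => C; rewrite [RHS]ffunE /cmul !cprodE -big_split /=.
by apply: eq_bigr => A _; rewrite ffunE mulrDl mulrzDl.
Qed.

Fact cmulDr : right_distributive cmul +%R.
Proof.
move=> a b c; apply/ffunP => C; rewrite [RHS]ffunE /cmul !cprodE -big_split /=.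
by apply: eq_bigr => A _; rewrite ffunE mulrDr mulrzDl.
Qed.

HB.instance Definition _ := GRing.Zmodule_isPzRing.Build (cliff n X)
  cmulA cmul1 cmulr1 cmulDl cmulDr.

End CliffordRing.


Lemma cmonoM n (X : pzRingType) (x y : X) (A B : {set 'I_n}) :
  cmono x A * cmono y B =
  cmono (x * y *~ ((-1) ^+ cross A B)) (symdiff A B) :> cliff n X.
Proof.
apply/ffunP => C; rewrite [LHS]cprodE (bigD1 A)//= big1 ?addr0; last first.
  by move=> D /negPf DA; rewrite ffunE DA mul0r mul0rz.
rewrite !ffunE eqxx symdiff_eq.
by case: eqP => [->|_]; rewrite ?symdiffK// mulr0 mul0rz.
Qed.

Lemma cgenC n (X : pzRingType) (i j : 'I_n) :
  cmono 1 [set i]%SET * cmono 1 [set j]%SET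
  + cmono 1 [set j]%SET * cmono 1 [set i]%SET
  = - (2 * (i == j)%:R) :> cliff n X.
Proof.
rewrite !cmonoM !mul1r (symdiffC [set j]%SET).
have crossS (k l : 'I_n) : cross [set k]%SET [set l]%SET = (l <= k)%N.
  by rewrite /cross !big_set1.
rewrite !crossS.
have [<-|neqij] := eqVneq i j.
  have -> : symdiff [set i]%SET [set i]%SET = finset.set0.
    by rewrite -[X in symdiff _ X]symdiff0 symdiffK.
  rewrite leqnn expr1 mulr1 mulrN1z mulr2n.
  by apply/ffunP => A; rewrite !ffunE; case: eqP; rewrite ?addr0 ?oppr0 ?opprD.
rewrite mulr0n mulr0 oppr0; apply/ffunP => A; rewrite !ffunE.
case: eqP => _; last by rewrite addr0.
case: ltngtP (neqij) => //= [_ _|_ _|/val_inj->]; last by rewrite eqxx.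
- by rewrite expr0 expr1 mulr1z mulrN1z addNr.
- by rewrite expr0 expr1 mulr1z mulrN1z addrN.
Qed.

Record bop (R : realType) (V : normedModType R) := BOp {
  bop_fun :> {linear V -> V};
  bop_bounded : exists M, forall x, `|bop_fun x| <= M * `|x| }.

HB.instance Definition _ R V := gen_eqMixin (@bop R V).
HB.instance Definition _ R V := gen_choiceMixin (@bop R V).

Section BoundedOperators.
Variables (R : realType) (V : normedModType R).
Implicit Types S T : bop V.

Lemma bopP S T : (forall x, S x = T x) -> S = T.
Proof.
case: S T => [f bf] [g bg] /= fg.
have {}fg : f = g.
  case: f g fg {bf bg} => [f [[af] [zf]]] [g [[ag] [zg]]] /= /funext fg.
  move: af zf ag zg; rewrite fg => af zf ag zg.
  by rewrite (Prop_irrelevance af ag) (Prop_irrelevance zf zg).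
move: bf bg; rewrite fg => bf bg.
by rewrite (Prop_irrelevance bf bg).
Qed.

Fact bop0_bounded : exists M, forall x, `|(\0 : {linear V -> V}) x| <= M * `|x|.
Proof. by exists 0 => x; rewrite normr0 mul0r. Qed.
Fact bop1_bounded : exists M, forall x, `|(idfun : {linear V -> V}) x| <= M * `|x|.
Proof. by exists 1 => x; rewrite mul1r. Qed.
Fact bopD_bounded S T :
  exists M, forall x, `|(S \+ T : {linear V -> V}) x| <= M * `|x|.
Proof.
have [M SM] := bop_bounded S; have [N TN] := bop_bounded T.
by exists (M + N) => x; rewrite mulrDl (le_trans (ler_normD _ _))// lerD.
Qed.
Fact bopM_bounded S T :
  exists M, forall x, `|(S \o T : {linear V -> V}) x| <= M * `|x|.
Proof.
have [M SM] := bop_bounded S; have [N TN] := bop_bounded T.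
exists (`|M| * N) => x; rewrite -mulrA (le_trans (SM _))//.
by rewrite (le_trans (ler_wpM2r _ (ler_norm M)))// ler_wpM2l.
Qed.
Fact bopZ_bounded (a : R) S :
  exists M, forall x, `|(a \*: S : {linear V -> V}) x| <= M * `|x|.
Proof.
have [M SM] := bop_bounded S.
by exists (`|a| * M) => x /=; rewrite normrZ -mulrA ler_wpM2l.
Qed.

Definition bop0 := BOp bop0_bounded.
Definition bop1 := BOp bop1_bounded.
Definition bopD S T := BOp (bopD_bounded S T).
Definition bopM S T := BOp (bopM_bounded S T).
Definition bopZ (a : R) S := BOp (bopZ_bounded a S).

Definition bopN S := bopZ (-1) S.

Fact bopDA : associative bopD.
Proof. by move=> S T U; apply: bopP => x /=; rewrite addrA. Qed.
Fact bopDC : commutative bopD.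
Proof. by move=> S T; apply: bopP => x /=; rewrite addrC. Qed.
Fact bopD0 : left_id bop0 bopD.
Proof. by move=> S; apply: bopP => x /=; rewrite add0r. Qed.
Fact bopDN : left_inverse bop0 bopN bopD.
Proof. by move=> S; apply: bopP => x /=; rewrite scaleN1r addNr. Qed.
HB.instance Definition _ :=
  GRing.isZmodule.Build (bop V) bopDA bopDC bopD0 bopDN.

Fact bopMA : associative bopM.
Proof. by move=> S T U; apply: bopP. Qed.
Fact bop1M : left_id bop1 bopM.
Proof. by move=> S; apply: bopP. Qed.
Fact bopM1 : right_id bop1 bopM.
Proof. by move=> S; apply: bopP. Qed.
Fact bopMDl : left_distributive bopM +%R.
Proof. by move=> S T U; apply: bopP. Qed.
Fact bopMDr : right_distributive bopM +%R.
Proof. by move=> S T U; apply: bopP => x /=; rewrite linearD. Qed.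
HB.instance Definition _ := GRing.Zmodule_isPzRing.Build (bop V)
  bopMA bop1M bopM1 bopMDl bopMDr.

Fact bopZA a b S : bopZ a (bopZ b S) = bopZ (a * b) S.
Proof. by apply: bopP => x /=; rewrite scalerA. Qed.
Fact bopZ1 : left_id 1 bopZ.
Proof. by move=> S; apply: bopP => x /=; rewrite scale1r. Qed.
Fact bopZDr : right_distributive bopZ +%R.
Proof. by move=> a S T; apply: bopP => x /=; rewrite scalerDr. Qed.
Fact bopZDl S : {morph bopZ^~ S : a b / a + b}.
Proof. by move=> a b; apply: bopP => x /=; rewrite scalerDl. Qed.
HB.instance Definition _ := GRing.Zmodule_isLmodule.Build R (bop V)
  bopZA bopZ1 bopZDr bopZDl.

Definition opnorm S : R := sup [set `|S x| | x in [set x : V | `|x| <= 1]].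

End BoundedOperators.

(** The coordinates of a paravector are (s_0, s_1, ..., s_n); those of an
    imaginary vector are (x_1, ..., x_n). *)

Section Paravectors.
Variables (R : realType) (n : nat).

Notation Rn := (cliff n R).
Implicit Types s : 'rV[R]_n.+1.

Definition Re_part s : R := s 0 ord0.
Definition vec_part s : 'rV[R]_n := \row_j s 0 (lift ord0 j).

Definition real_embed (a : R) : Rn := cmono a finset.set0.
Definition vec_embed (x : 'rV[R]_n) : Rn := \sum_j cmono (x 0 j) [set j]%SET.

Definition embed s : Rn := real_embed (Re_part s) + vec_embed (vec_part s).
Definition conj_embed s : Rn := real_embed (Re_part s) - vec_embed (vec_part s).

Definition euclid_sqr m (x : 'rV[R]_m) : R := \sum_i x 0 i ^+ 2.

Definition unit_sphere m : set 'rV[R]_m := [set x | euclid_sqr x = 1].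

(** u + I v, for z = (u, v); the plane L_I is represented by R * R. *)
Definition slice_pt (I : 'rV[R]_n) (z : R * R) : 'rV[R]_n.+1 :=
  \row_i (if unlift ord0 i is Some j then z.2 * I 0 j else z.1).

Definition slice (U : set 'rV[R]_n.+1) I : set (R * R) :=
  [set z | U (slice_pt I z)].

(** The sphere u + v S^n is taken in R^(n+1): it is n-dimensional and contains
    the real points u + v and u - v. *)
Definition circ (A : set 'rV[R]_n.+1) : set 'rV[R]_n.+1 :=
  [set x | exists u v I (w : 'rV[R]_n.+1),
    [/\ unit_sphere I, A (slice_pt I (u, v)), unit_sphere w
      & x = u *: delta_mx 0 ord0 + v *: w]].

Definition partial_u (f : 'rV[R]_n.+1 -> Rn) I (z : R * R) : Rn :=
  [ffun A => (fun t => f (slice_pt I (t, z.2)) A)^`()%classic z.1].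
Definition partial_v (f : 'rV[R]_n.+1 -> Rn) I (z : R * R) : Rn :=
  [ffun A => (fun t => f (slice_pt I (z.1, t)) A)^`()%classic z.2].

Definition s_monogenic (U : set 'rV[R]_n.+1) (f : 'rV[R]_n.+1 -> Rn) : Prop :=
  [/\ open U,
      forall x A, U x -> differentiable (fun y => f y A : R) x
    & forall I z, unit_sphere I -> slice U I z ->
        2^-1 *: (partial_u f I z + vec_embed I * partial_v f I z) = 0].

(** On a set that need not be open: on some open neighbourhood of it. *)
Definition s_monogenic_on (D : set 'rV[R]_n.+1) (f : 'rV[R]_n.+1 -> Rn) : Prop :=
  exists2 W, D `<=` W & s_monogenic W f.

End Paravectors.

Definition boundary (X : topologicalType) (A : set X) : set X :=
  closure A `\` A°.

Section Curves.
Variable R : realType.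
Implicit Types (g : R -> R * R) (D : set (R * R)).

Definition plane_norm (p : R * R) : R := Num.sqrt (p.1 ^+ 2 + p.2 ^+ 2).

(** The k-th point of the subdivision [0 :: s] of [0, 1]. *)
Definition node (s : seq R) (k : nat) : R := nth 1 (0 :: s) k.

Definition rectifiable g : Prop :=
  exists L, forall s, itv_partition 0 1 s ->
    \sum_(k < size s) plane_norm (g (node s k.+1) - g (node s k)) <= L.

Definition jordan_curve g : Prop :=
  [/\ {within `[0, 1], continuous g}, g 0 = g 1 & {in `[0, 1[ &, injective g}].

(** [w p h] is a 1-form, evaluated at the point p on the vector h. Its integral
    along g is the limit of the Riemann-Stieltjes sums as the mesh tends to 0,
    in the sense of the norm N. *)
Definition is_line_integral (W : zmodType) (N : W -> R)
    (w : R * R -> R * R -> W) g (J : W) : Prop :=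
  forall e, 0 < e -> exists2 d, 0 < d & forall s (tau : nat -> R),
    itv_partition 0 1 s ->
    (forall k, (k < size s)%N ->
       node s k.+1 - node s k < d /\ node s k <= tau k <= node s k.+1) ->
    N (\sum_(k < size s) w (g (tau k)) (g (node s k.+1) - g (node s k)) - J) < e.

Definition is_cycle_integral (W : zmodType) (N : W -> R)
    (w : R * R -> R * R -> W) m (G : 'I_m -> R -> R * R) (J : W) : Prop :=
  exists2 K : 'I_m -> W,
    forall k, is_line_integral N w (G k) (K k) & J = \sum_k K k.

Definition jordan_boundary D m (G : 'I_m -> R -> R * R) : Prop :=
  (forall k, jordan_curve (G k) /\ rectifiable (G k)) /\
  boundary D = \bigcup_k (G k @` `[0, 1]).

(** The differential of the argument of p - p0. *)
Definition darg (p0 p h : R * R) : R :=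
  let q := p - p0 in (q.1 * h.2 - q.2 * h.1) / (q.1 ^+ 2 + q.2 ^+ 2).

(** The cycle G winds once around each point of D and does not wind around the
    points outside the closure of D. This forces D to be bounded. *)
Definition positively_oriented D m (G : 'I_m -> R -> R * R) : Prop :=
  (forall p, D p -> is_cycle_integral Num.norm (darg p) G (2 * pi)) /\
  (forall p, ~ closure D p -> is_cycle_integral Num.norm (darg p) G 0).

End Curves.

Section OperatorAlgebra.
Variables (R : realType) (V : completeNormedModType R) (n : nat).

Notation paravector := 'rV[R]_n.+1.
Notation Rn := (cliff n R).
Notation Vn := (cliff n V).
Notation Bn := (cliff n (bop V)).
Implicit Types (S T : Bn) (s : paravector) (v : Vn).

(** T(v) = Σ_{A,B} T_A(v_B) e_A e_B *)
Definition act T v : Vn := cprod (fun (S : bop V) x => S x) T v.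

Lemma actM S T v : act (S * T) v = act S (act T v).
Proof.
by apply: cprodA => // S' x y; rewrite linearD.
Qed.

Lemma act1 v : act 1 v = v.
Proof.
apply/ffunP => C; rewrite cprodE (bigD1 finset.set0)//= big1 ?addr0.
  rewrite ffunE eqxx symdiffC symdiff0.
  by rewrite /cross big_set0 expr0 mulr1z.
by move=> A /negPf A0; rewrite ffunE A0 mul0rz.
Qed.

Lemma act_inj S T : (forall v, act S v = act T v) -> S = T.
Proof.
move=> ST; apply/ffunP => A; apply: bopP => x.
have actE U : act U (cmono x finset.set0) A = U A x.
  rewrite [LHS]cprodE (bigD1 A)//= big1 ?addr0.
    have -> : symdiff A A = finset.set0.
      by rewrite -[X in symdiff A X]symdiff0 symdiffK.
    rewrite ffunE eqxx /cross big1 ?expr0 ?mulr1z// => i _.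
    by rewrite big_set0.
  move=> B neqBA; rewrite ffunE symdiff_eq symdiff0 eq_sym (negPf neqBA).
  by rewrite linear0 mul0rz.
by rewrite -!actE ST.
Qed.

Definition bnorm T : R := Num.sqrt (\sum_A opnorm (T A) ^+ 2).

(** a in R_n as the operator v |-> a v *)
Definition scalar_op (a : Rn) : Bn := [ffun A => a A *: (1 : bop V)].

Lemma act_scalar a v :
  act (scalar_op a) v = cprod (fun (c : R) (x : V) => c *: x) a v.
Proof.
apply/ffunP => C; rewrite [LHS]cprodE cprodE.
by under eq_bigr do rewrite ffunE.
Qed.

Definition paravector_op T : Prop :=
  exists (T0 : bop V) (Tj : 'I_n -> bop V),
    T = cmono T0 finset.set0 + \sum_j cmono (Tj j) [set j]%SET.

Definition inverse_of (Q P : Bn) : Prop := P * Q = 1 /\ Q * P = 1.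

Definition pencil T s : Bn :=
  T ^+ 2 - (2 * Re_part s) *: T + euclid_sqr s *: (1 : Bn).

Definition S_spectrum T : set paravector :=
  [set s | ~ exists P, inverse_of (pencil T s) P].

Definition S_resolvent T s : Bn :=
  - (xget 0 (inverse_of (pencil T s)) * (T - scalar_op (conj_embed s))).

(** S^-1(s, T) ds_I f(s) with ds_I = - ds I, at s = u + I v for z = (u, v) and
    ds = h.1 + I h.2 *)
Definition integrand T (f : paravector -> Rn) I (z h : R * R) : Bn :=
  S_resolvent T (slice_pt I z)
  * scalar_op (- (embed (slice_pt I h) * vec_embed I))
  * scalar_op (f (slice_pt I z)).

Definition is_functional_integral T (f : paravector -> Rn) I
    m (G : 'I_m -> R -> R * R) (J : Bn) : Prop :=
  exists2 K, is_cycle_integral bnorm (integrand T f I) G K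
           & J = (2 * pi)^-1 *: K.

End OperatorAlgebra.

Section FunctionalCalculus.
Variables (R : realType) (n : nat).
Implicit Types U sigma : set 'rV[R]_n.+1.

Definition admissible sigma U : Prop :=
  [/\ open U,
      forall I : 'rV[R]_n, unit_sphere I ->
        exists m (G : 'I_m -> R -> R * R), jordan_boundary (slice U I) G
    & circ sigma `<=` U].

(** f is a total function of which only the values on U matter. *)
Definition functional_class sigma (f : 'rV[R]_n.+1 -> cliff n R) : Prop :=
  exists2 U, admissible sigma U & s_monogenic U f.

End FunctionalCalculus.

(* Main.v *)
From HB Require Import structures.
Require Import Defs.
From mathcomp Require Import all_boot all_order all_algebra.
From mathcomp Require Import all_classical all_reals all_analysis.
From mathcomp Require Import ring lra.

Set Implicit Arguments.
Unset Strict Implicit.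
Unset Printing Implicit Defensive.

Import Order.TTheory GRing.Theory Num.Theory.
Import numFieldTopology.Exports numFieldNormedType.Exports.

Local Open Scope classical_set_scope.
Local Open Scope ring_scope.

(** Fix a unit I and write s = u + I v. Let i be the operator of left
    multiplication by I, so that i^2 = -1, and F (u, v) the operator of f (s). The
    integrand S^-1(s, T) ds_I f(s) is - S i F du + S F dv, where S = S^-1(s, T)
    satisfies the right and F the left Cauchy-Riemann equation with respect to i;
    hence it is a closed form off the spectrum ([closedat_product],
    [rholo_slice_resolvent], [s_monogenic_lholo]). The pencil of T depends on
    (u, v) only, so all slices of the spectrum are the same compact subset K of
    the plane, which is symmetric under v |-> - v.

    The integral of such a form over the boundary of U_I is moved to a contour
    that knows neither U nor I: the sum of the boundaries of the faces of a fine
    square lattice that meet K ([cycle_integral_lattice]). The boundary consists of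
    rectifiable curves known only through the winding numbers of points, so the
    deformation is homological. Subtracting from the form suitable multiples of
    the angular forms around the centres of the lattice faces kills its periods
    around all faces; the remainder has a primitive near each curve, and the
    angular forms integrate to winding numbers ([line_integral_grid]). As f is only
    differentiable, closedness is turned into vanishing integrals by Goursat's
    theorem ([goursat]).

    The contour is symmetric under v |-> - v, so only the part of the form that is
    even under this reflection counts ([lattice_residue_even]). Near K one has the
    representation formula f (u + I v) = a (u, v) + I b (u, v), with a even and b
    odd in v and both independent of I: the two sides agree on the real axis and
    satisfy the same Cauchy-Riemann equation, and unique continuation
    ([holo_zero_path]) is applied along the arc from a real point of the sphere
    through a spectral point s to s itself. These arcs lie in the domain of f
    because it contains the circularization of the spectrum. Likewise
    S = al + be i with al even, be odd and both independent of I. In the even part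
    of the form every remaining i is squared ([form_even]), so the contour sums for
    two units are equal ([residue_unit]). Unique continuation is proved from
    Cauchy's formula on squares: g vanishes on a real segment, hence all its
    Taylor coefficients at a point of the segment are 0.

    Two contours of different sizes give the same value because each is the
    integral over one and the same boundary and line integrals are unique. *)

(** * Operator norms and completeness *)

Section BopNorm.
Variables (R : realType) (V : normedModType R).
Implicit Types S T : bop V.

Lemma has_sup_opnorm S : has_sup [set `|S x| | x in [set x : V | `|x| <= 1]].
Proof.
split; first by exists `|S 0|; exists 0 => //=; rewrite normr0.
have [M SM] := bop_bounded S; exists `|M| => _ [x /= x1 <-].
apply: le_trans (SM x) _; apply: (@le_trans _ _ (`|M| * `|x|)).
  by rewrite ler_wpM2r// ler_norm.
by rewrite -[leRHS]mulr1 ler_wpM2l.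
Qed.

Lemma opnorm_ge0 S : 0 <= opnorm S.
Proof.
have [_ Sub] := has_sup_opnorm S.
apply: le_trans (normr_ge0 (S 0)) _.
by apply: ub_le_sup => //; exists 0 => //=; rewrite normr0.
Qed.

Lemma le_opnorm S x : `|S x| <= opnorm S * `|x|.
Proof.
have [->|x0] := eqVneq x 0; first by rewrite linear0 !normr0 mulr0.
have nx : 0 < `|x| by rewrite normr_gt0.
rewrite -ler_pdivrMr// mulrC.
have -> : `|x|^-1 * `|S x| = `|S (`|x|^-1 *: x)|.
  by rewrite linearZ normrZ normfV normr_id.
have [_ Sub] := has_sup_opnorm S.
apply: ub_le_sup => //; exists (`|x|^-1 *: x) => //=.
by rewrite normrZ ger0_norm ?invr_ge0// mulVf// gt_eqF.
Qed.

Lemma opnorm_le S M : 0 <= M -> (forall x, `|S x| <= M * `|x|) -> opnorm S <= M.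
Proof.
move=> M0 SM; apply: ge_sup; first by case: (has_sup_opnorm S).
move=> _ [x /= x1 <-]; apply: le_trans (SM x) _.
by rewrite -[leRHS]mulr1 ler_wpM2l.
Qed.

Fact opnormD S T : opnorm (S + T) <= opnorm S + opnorm T.
Proof.
apply: opnorm_le => [|x]; first by rewrite addr_ge0// opnorm_ge0.
by rewrite mulrDl (le_trans (ler_normD _ _))// lerD// le_opnorm.
Qed.

Fact opnormZ (a : R) S : opnorm (a *: S) = `|a| * opnorm S.
Proof.
have le (b : R) (U : bop V) : opnorm (b *: U) <= `|b| * opnorm U.
  apply: opnorm_le => [|x]; first by rewrite mulr_ge0// opnorm_ge0.
  by rewrite normrZ -mulrA ler_wpM2l// le_opnorm.
apply/eqP; rewrite eq_le le /=.
have [->|a0] := eqVneq a 0; first by rewrite normr0 mul0r opnorm_ge0.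
have := le a^-1 (a *: S); rewrite scalerA mulVf// scale1r normfV => h.
by rewrite -ler_pdivlMl ?normr_gt0.
Qed.

Fact opnorm0_eq0 S : opnorm S = 0 -> S = 0.
Proof.
move=> S0; apply: bopP => x; apply/eqP; rewrite -normr_le0.
by have := le_opnorm S x; rewrite S0 mul0r.
Qed.

HB.instance Definition _ :=
  Lmodule_isNormed.Build R (bop V) opnormD opnormZ opnorm0_eq0.

Lemma bopBE S T x : (S - T) x = S x - T x.
Proof. by rewrite -[- T x]scaleN1r. Qed.

Lemma bop_normM S T : `|S * T| <= `|S| * `|T|.
Proof.
apply: opnorm_le => [|x]; first by rewrite mulr_ge0// normr_ge0.
apply: (le_trans (le_opnorm S (T x))); rewrite -mulrA.
by apply: ler_wpM2l; [exact: opnorm_ge0 | exact: le_opnorm].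
Qed.

Lemma bop_norm1 : `|1 : bop V| <= 1.
Proof. by apply: opnorm_le => // x; rewrite mul1r. Qed.

End BopNorm.

(** Testing a Cauchy filter against single points turns completeness into
    estimates of differences with a fixed element. *)
Lemma cauchy_near_point (R : realType) (E : pseudoMetricNormedZmodType R)
    (F : set_system E) : ProperFilter F -> cauchy F ->
  forall e, 0 < e -> exists S0, \forall S \near F, `|S0 - S| < e.
Proof.
move=> FF /cauchy_ballP Fc e e0; have [[A B] /= [FA FB] AB] := Fc _ e0.
have [S0 AS0] := @filter_ex _ _ FF _ FA; exists S0.
apply: filterS FB => S BS; have := AB (S0, S) (conj AS0 BS).
by rewrite /= -ball_normE.
Qed.

Section BopComplete.
Variables (R : realType) (V : completeNormedModType R).

(** The pointwise limits of a Cauchy filter form a bounded operator, and the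
    convergence is uniform on the unit ball. *)
Lemma bop_complete (F : set_system (bop V)) : ProperFilter F -> cauchy F -> cvg F.
Proof.
move=> FF Fc.
have near_pt := cauchy_near_point FF Fc.
have ev x : cvg ((fun S : bop V => S x) @ F).
  apply: cauchy_cvg; apply: cauchy_exP => e e0 /=.
  have d0 : 0 < e / (1 + `|x|) by rewrite divr_gt0// ltr_pwDl.
  have [S0 S0F] := near_pt _ d0; exists (S0 x).
  apply: filterS S0F => S S0S; rewrite /= -ball_normE /=.
  rewrite -bopBE; apply: (le_lt_trans (le_opnorm (S0 - S) x)).
  have x1 : 0 < 1 + `|x| by rewrite ltr_pwDl.
  rewrite ltr_pdivlMr// in S0S; apply: le_lt_trans S0S.
  by apply: ler_wpM2l; [exact: opnorm_ge0 | rewrite lerDr].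
pose L x := lim ((fun S : bop V => S x) @ F).
have LP x : (fun S : bop V => S x) @ F --> L x by exact: ev.
have Llin : linear L.
  move=> a x y; apply: (@cvg_unique _ _ ((fun S : bop V => S (a *: x + y)) @ F)).
  - exact: norm_hausdorff.
  - exact: LP.
  - rewrite (_ : (fun S : bop V => S (a *: x + y))
                 = (fun S : bop V => a *: S x + S y)); last first.
      by apply/funext => S; rewrite linearP.
    by apply: cvgD; [apply: cvgZr|]; exact: LP.
have close e : 0 < e -> \forall S \near F, forall x, `|L x - (S : bop V) x| <= e * `|x|.
  move=> e0; have e2 : 0 < e / 2 by rewrite divr_gt0.
  have [S0 S0F] := near_pt _ e2.
  have S0L x : `|L x - S0 x| <= e / 2 * `|x|.
    apply/ler_addgt0Pr => d d0.
    have LPd : \forall S \near F, `|L x - (S : bop V) x| < d.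
      by have /cvgrPdist_lt := LP x; apply.
    have [S [S0S LS]] := filter_ex (filterI S0F LPd).
    rewrite (le_trans (ler_distD (S x) _ _))// addrC.
    apply: lerD; last exact: ltW.
    rewrite distrC -bopBE (le_trans (le_opnorm _ _))// ler_wpM2r//.
    exact: ltW.
  apply: filterS S0F => S S0S x.
  rewrite (le_trans (ler_distD (S0 x) _ _))//.
  rewrite [e in leRHS]splitr mulrDl lerD// -bopBE.
  rewrite (le_trans (le_opnorm _ _))// ler_wpM2r//; exact: ltW.
have Lbnd : exists M, forall x, `|L x| <= M * `|x|.
  have [S SP] := filter_ex (close _ (@ltr01 R)).
  exists (1 + opnorm S) => x; rewrite -(subrK (S x) (L x)) mulrDl.
  by rewrite (le_trans (ler_normD _ _))// lerD ?SP// le_opnorm.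
pose Lm := GRing.isLinear.Build R V V *:%R L Llin.
pose L' : {linear V -> V} := HB.pack L Lm.
pose LL := @BOp R V L' Lbnd.
apply/cvg_ex; exists LL; apply/cvgrPdist_le => e e0.
apply: filterS (close _ e0) => S SL; apply: opnorm_le => [|x]; first exact: ltW.
by rewrite bopBE; exact: SL.
Qed.

HB.instance Definition _ := Uniform_isComplete.Build (bop V) bop_complete.

End BopComplete.

Section CliffNorm.
Variables (R : realType) (n : nat) (X : normedModType R).
Implicit Types a b : cliff n X.

(** Unlike the Euclidean norm of the coefficients, which is equivalent to it, the
    sum norm is submultiplicative. *)
Definition cnorm a : R := \sum_A `|a A|.

Fact cnormD a b : cnorm (a + b) <= cnorm a + cnorm b.
Proof.
rewrite /cnorm -big_split /=; apply: ler_sum => A _.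
by rewrite ffunE ler_normD.
Qed.

Fact cnormZ (k : R) a : cnorm (k *: a) = `|k| * cnorm a.
Proof.
by rewrite /cnorm mulr_sumr; apply: eq_bigr => A _; rewrite ffunE normrZ.
Qed.

Lemma le_cnorm a A : `|a A| <= cnorm a.
Proof. by rewrite /cnorm (bigD1 A)//= lerDl sumr_ge0. Qed.

Fact cnorm0_eq0 a : cnorm a = 0 -> a = 0.
Proof.
move=> a0; apply/ffunP => A; apply/eqP; rewrite ffunE -normr_le0 -a0.
exact: le_cnorm.
Qed.

HB.instance Definition _ :=
  Lmodule_isNormed.Build R (cliff n X) cnormD cnormZ cnorm0_eq0.

Lemma cnormE a : `|a| = \sum_A `|a A|. Proof. by []. Qed.

End CliffNorm.

Section CliffComplete.
Variables (R : realType) (n : nat) (X : completeNormedModType R).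

Lemma cliff_complete (F : set_system (cliff n X)) :
  ProperFilter F -> cauchy F -> cvg F.
Proof.
move=> FF Fc; have near_pt := cauchy_near_point FF Fc.
have ev A : cvg ((fun a : cliff n X => a A) @ F).
  apply: cauchy_cvg; apply: cauchy_exP => e e0 /=.
  have [a0 a0F] := near_pt _ e0; exists (a0 A).
  apply: filterS a0F => a a0a; rewrite /= -ball_normE /=.
  have -> : a0 A - a A = (a0 - a) A by rewrite !ffunE.
  exact: le_lt_trans (le_cnorm _ _) a0a.
apply/cvg_ex; exists [ffun A => lim ((fun a : cliff n X => a A) @ F)].
apply/cvgrPdist_le => e e0.
set m : R := #|{set 'I_n}|%:R.
have m0 : 0 < m by rewrite ltr0n; apply/card_gt0P; exists finset.set0.
have : \forall a \near F, forall A, `|lim ((fun a : cliff n X => a A) @ F) - (a : cliff n X) A| <= e / m.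
  apply: filter_forall => A.
  by have /cvgrPdist_le := ev A; apply; rewrite divr_gt0.
apply: filterS => a aP; rewrite cnormE.
apply: (@le_trans _ _ (\sum_(A : {set 'I_n}) e / m)).
  by apply: ler_sum => A _; rewrite !ffunE.
by rewrite sumr_const -mulr_natr divfK// gt_eqF.
Qed.

HB.instance Definition _ := Uniform_isComplete.Build (cliff n X) cliff_complete.

End CliffComplete.

Lemma cliff_normM (R : realType) (V : normedModType R) n (a b : cliff n (bop V)) :
  `|a * b| <= `|a| * `|b|.
Proof.
rewrite !cnormE mulr_suml.
under [leRHS]eq_bigr do rewrite mulr_sumr.
rewrite [leRHS](eq_bigr (fun A => \sum_C `|a A| * `|b (symdiff A C)|)); last first.
  by move=> A _; rewrite (reindex_inj (inv_inj (symdiffK A))).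
rewrite exchange_big /=; apply: ler_sum => C _.
rewrite [(a * b) C]cprodE (le_trans (ler_norm_sum _ _ _))//.
apply: ler_sum => A _; rewrite -signr_odd.
have -> (x : bop V) (s : bool) : `|x *~ (-1) ^+ s| = `|x|.
  by case: s; rewrite ?expr1 ?expr0 ?mulrN1z ?mulr1z ?normrN.
exact: bop_normM.
Qed.

Lemma cliff_norm1 (R : realType) (V : normedModType R) n :
  `|1 : cliff n (bop V)| <= 1.
Proof.
rewrite cnormE (bigD1 finset.set0)//= big1 ?addr0 ?ffunE ?eqxx ?bop_norm1// => A.
by rewrite ffunE => /negPf ->; rewrite normr0.
Qed.

Section CliffScale.
Variables (R : realType) (V : normedModType R) (n : nat).
Implicit Types (a b : cliff n (bop V)) (k : R).

Lemma bop_scalerAl k (S T : bop V) : k *: (S * T) = k *: S * T.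
Proof. exact: bopP. Qed.

Lemma bop_scalerAr k (S T : bop V) : k *: (S * T) = S * (k *: T).
Proof. by apply: bopP => x /=; rewrite linearZ. Qed.

Lemma cliff_scalerAl k a b : k *: (a * b) = k *: a * b.
Proof.
apply/ffunP => C; rewrite ffunE ![(_ * _ : cliff _ _) C]cprodE scaler_sumr.
by apply: eq_bigr => A _; rewrite -scalerMzr bop_scalerAl ffunE.
Qed.

Lemma cliff_scalerAr k a b : k *: (a * b) = a * (k *: b).
Proof.
apply/ffunP => C; rewrite ffunE ![(_ * _ : cliff _ _) C]cprodE scaler_sumr.
by apply: eq_bigr => A _; rewrite -scalerMzr bop_scalerAr ffunE.
Qed.

End CliffScale.

(** * Identities in abelian groups *)

Section ZmoduleReflection.
Variable M : zmodType.

Inductive zexpr := ZZero | ZAtom of nat | ZAdd of zexpr & zexpr | ZOpp of zexpr.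

Fixpoint zeval (env : seq M) (e : zexpr) : M :=
  match e with
  | ZZero => 0
  | ZAtom k => nth 0 env k
  | ZAdd e1 e2 => zeval env e1 + zeval env e2
  | ZOpp e1 => - zeval env e1
  end.

Fixpoint zcoef (e : zexpr) (k : nat) : int :=
  match e with
  | ZZero => 0
  | ZAtom j => (j == k)%:Z
  | ZAdd e1 e2 => zcoef e1 k + zcoef e2 k
  | ZOpp e1 => - zcoef e1 k
  end.

Fixpoint zsupp (e : zexpr) (n : nat) : bool :=
  match e with
  | ZZero => true
  | ZAtom j => (j < n)%N
  | ZAdd e1 e2 => zsupp e1 n && zsupp e2 n
  | ZOpp e1 => zsupp e1 n
  end.

Lemma zeval_coef env e : zsupp e (size env) ->
  zeval env e = \sum_(0 <= k < size env) nth 0 env k *~ zcoef e k.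
Proof.
elim: e => [_|j /= jn|e1 IH1 e2 IH2 /= /andP[/IH1-> /IH2->]|e1 IH1 /= /IH1->].
- by rewrite big1.
- rewrite (big_nat_widenl _ 0)// (bigD1_seq j)/= ?iota_uniq ?mem_index_iota//.
  rewrite eqxx mulr1z big1 ?addr0// => k /negPf.
  by rewrite eq_sym => ->.
- by rewrite -big_split; apply: eq_bigr => k _; rewrite /= mulrzDr.
- by rewrite -sumrN; apply: eq_bigr => k _; rewrite /= mulrNz.
Qed.

Lemma zexpr_eq env e1 e2 :
  [&& zsupp e1 (size env), zsupp e2 (size env)
    & all (fun k => zcoef e1 k == zcoef e2 k) (iota 0 (size env))] ->
  zeval env e1 = zeval env e2.
Proof.
move=> /and3P[s1 s2 /allP h]; rewrite !zeval_coef//.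
rewrite !big_nat; apply: eq_bigr => k; rewrite andTb => kn.
by rewrite (eqP (h k _))// mem_iota.
Qed.

End ZmoduleReflection.

Ltac zindex x env :=
  lazymatch env with
  | x :: _ => constr:(0%N)
  | _ :: ?env' => let k := zindex x env' in constr:(k.+1)
  end.
Ltac zindexu x env :=
  match env with
  | ?y :: _ => let _ := match goal with _ => unify x y end in constr:(0%N)
  | _ :: ?env' => let k := zindexu x env' in constr:(k.+1)
  end.
Ltac zpos x env := match env with
  | _ => zindex x env
  | _ => zindexu x env
  end.
Ltac zmem x env := match env with
  | _ => let k := zpos x env in constr:(true)
  | _ => constr:(false)
  end.
Ltac zatoms t env :=
  lazymatch t with
  | (?x + ?y)%R => let env := zatoms x env in zatoms y env
  | (- ?x)%R => zatoms x env
  | 0%R => env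
  | _ => let b := zmem t env in
         lazymatch b with true => env | false => constr:(t :: env) end
  end.
Ltac zreify t env :=
  lazymatch t with
  | (?x + ?y)%R => let a := zreify x env in let b := zreify y env in
                   constr:(ZAdd a b)
  | (- ?x)%R => let a := zreify x env in constr:(ZOpp a)
  | 0%R => constr:(ZZero)
  | _ => let k := zpos t env in constr:(ZAtom k)
  end.

(** [zmodule] proves an equality in an abelian group by comparing the integer
    coefficients of the atoms. *)
Ltac zmodule :=
  lazymatch goal with
  | |- @eq ?T ?a ?b =>
    let e0 := constr:(@nil T) in
    let env := zatoms a e0 in
    let env := zatoms b env in
    let ea := zreify a env in
    let eb := zreify b env in
    exact: (@zexpr_eq _ env ea eb (erefl true))
  end.

(** * Integrals of continuous functions with values in a Banach space *)

(** Compactness in the form in which it is used below: radii that exist locally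
    can be chosen uniformly. *)
Lemma compact_uniform (R : realType) (T : pseudoMetricType R) (A : set T)
    (Q : R -> T -> Prop) :
  compact A ->
  (forall d d' x, 0 < d' -> d' <= d -> Q d x -> Q d' x) ->
  (forall x, A x -> exists2 d : R, 0 < d & forall y, A y -> ball x d y -> Q d y) ->
  exists2 d : R, 0 < d & forall x, A x -> Q d x.
Proof.
move=> /compact_near_coveringP cA Qle Qloc.
have near_prop : \forall d \near (0 : R)^'+, A `<=` (fun x => A x -> Q d x).
  apply: (cA R (0^'+) (fun d x => A x -> Q d x)) => x Ax.
  have [d d0 dP] := Qloc x Ax.
  exists (ball x d, [set e | 0 < e <= d]) => /=.
    split; first exact: nbhsx_ballx.
    near=> e; apply/andP; split; first by near: e; exact: nbhs_right_gt.
    by near: e; exact: nbhs_right_le.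
  move=> [y e] /= [xy /andP[e0 ed]] Ay.
  exact: Qle e0 ed (dP y Ay xy).
have : \forall d \near (0 : R)^'+, 0 < d /\ A `<=` (fun x => A x -> Q d x).
  by apply: filterS2 near_prop (nbhs_right_gt 0) => d; split.
by move=> /filter_ex [d [d0 dP]]; exists d => // x Ax; exact: dP.
Unshelve. all: by end_near.
Qed.

Lemma cauchy_seq_lim (R : realType) (E : completeNormedModType R) (u : nat -> E) :
  (forall e : R, 0 < e -> exists N, forall m, (N <= m)%N -> `|u N - u m| < e) ->
  exists l, forall e : R, 0 < e -> exists N, forall m, (N <= m)%N -> `|l - u m| < e.
Proof.
move=> uC; have /cvg_ex[l ul] : cvg (u @ \oo).
  apply: cauchy_cvg; apply: cauchy_exP => e e0.
  have [N NP] := uC e e0; exists (u N); exists N => //= m /= Nm.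
  by rewrite -ball_normE /=; exact: NP.
exists l => e e0; move/cvgrPdist_lt : ul => /(_ e e0)[N _ NP].
by exists N => m Nm; exact: NP.
Qed.

Section Primitive.
Variables (R : realType) (E : completeNormedModType R).
Implicit Types (phi Phi : R -> E) (a b x y z : R).

Definition ucont phi a b := forall e : R, 0 < e -> exists2 d : R, 0 < d &
  forall x y, a <= x <= b -> a <= y <= b -> `|x - y| < d -> `|phi x - phi y| <= e.

(** [Phi] is a primitive of [phi] on [a, b], the derivative being taken
    uniformly and tested at every intermediate point. *)
Definition primitive phi Phi a b := forall e : R, 0 < e -> exists2 d : R, 0 < d &
  forall x y z, a <= x -> x <= z -> z <= y -> y <= b -> y - x < d ->
    `|Phi y - Phi x - (y - x) *: phi z| <= e * (y - x).

(** Subdividing the segment into steps shorter than d adds up the local bounds. *)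
Lemma lipschitz_chain Phi a b C d : 0 < d ->
  (forall x y, a <= x -> x <= y -> y <= b -> y - x < d ->
     `|Phi y - Phi x| <= C * (y - x)) ->
  forall x y, a <= x -> x <= y -> y <= b -> `|Phi y - Phi x| <= C * (y - x).
Proof.
move=> d0 loc x y ax xy yb.
pose N := (Num.truncn ((y - x) / d)).+1.
have N0 : 0 < N%:R :> R by rewrite ltr0n.
have NP : (y - x) / N%:R < d.
  by rewrite ltr_pdivrMr// mulrC -ltr_pdivrMr//; exact: truncnS_gt.
pose t k : R := x + k%:R * ((y - x) / N%:R).
have s0 : 0 <= (y - x) / N%:R by rewrite divr_ge0// subr_ge0.
have tS k : t k.+1 - t k = (y - x) / N%:R by rewrite /t -natr1; ring.
have tN : t N = y by rewrite /t mulrC divfK ?gt_eqF//; ring.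
have tle k m : (k <= m)%N -> t k <= t m.
  by move=> km; rewrite lerD2l ler_wpM2r// ler_nat.
have xt k : x <= t k by rewrite lerDl mulr_ge0.
suff H k : (k <= N)%N -> `|Phi (t k) - Phi x| <= C * (t k - x).
  by have := H N (leqnn N); rewrite tN.
elim: k => [_|k IH kN]; first by rewrite /t mul0r addr0 !subrr normr0 mulr0.
apply: (le_trans (ler_distD (Phi (t k)) _ _)).
have -> : C * (t k.+1 - x) = C * (t k.+1 - t k) + C * (t k - x) by ring.
apply: lerD; last by apply: IH; exact: ltnW.
apply: loc; last by rewrite tS.
- exact: le_trans ax (xt k).
- exact: tle.
- by apply: le_trans yb; rewrite -tN; exact: tle.
Qed.

Lemma primitive_sub phi Phi a b a' b' : a <= a' -> b' <= b ->
  primitive phi Phi a b -> primitive phi Phi a' b'.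
Proof.
move=> aa bb P e e0; have [d d0 dP] := P e e0; exists d => // x y z ax xz zy yb.
by apply: dP => //; [exact: le_trans ax | exact: le_trans bb].
Qed.

Lemma primitive_le phi Phi a b M : a <= b -> primitive phi Phi a b ->
  (forall x, a <= x <= b -> `|phi x| <= M) -> `|Phi b - Phi a| <= M * (b - a).
Proof.
move=> ab P phiM; apply/ler_addgt0Pr => e e0.
have ba1 : 0 < b - a + 1 by rewrite ltr_pwDr// subr_ge0.
have [d d0 dP] := P (e / (b - a + 1)) (divr_gt0 e0 ba1).
have h : `|Phi b - Phi a| <= (M + e / (b - a + 1)) * (b - a).
  apply: (lipschitz_chain d0) (lexx a) ab (lexx b) => x y ax xy yb yx.
  have := dP x y x ax (lexx x) xy yb yx.
  rewrite mulrDl; set D := Phi y - Phi x => Dle.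
  rewrite -(subrK ((y - x) *: phi x) D) (le_trans (ler_normD _ _))// addrC lerD//.
  rewrite normrZ ger0_norm ?subr_ge0// mulrC ler_wpM2r ?subr_ge0//.
  by apply: phiM; rewrite ax (le_trans xy).
apply: (le_trans h); rewrite mulrDl lerD2l mulrAC ler_pdivrMr//.
by apply: ler_wpM2l; [exact: ltW | rewrite lerDl].
Qed.

Lemma primitiveD phi psi Phi Psi a b : primitive phi Phi a b ->
  primitive psi Psi a b ->
  primitive (fun x => phi x + psi x) (fun x => Phi x + Psi x) a b.
Proof.
move=> P Q e e0; have e2 : 0 < e / 2 by rewrite divr_gt0.
have [d d0 dP] := P _ e2; have [c c0 cP] := Q _ e2.
exists (Num.min d c) => [|x y z ax xz zy yb]; first by rewrite lt_min d0.
rewrite lt_min => /andP[yd yc]; rewrite [e in leRHS]splitr mulrDl /=.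
have -> : Phi y + Psi y - (Phi x + Psi x) - (y - x) *: (phi z + psi z) =
  (Phi y - Phi x - (y - x) *: phi z) + (Psi y - Psi x - (y - x) *: psi z).
  by rewrite scalerDr; zmodule.
by rewrite (le_trans (ler_normD _ _))// lerD// ?dP ?cP.
Qed.

Lemma primitive_ext phi psi Phi a b :
  (forall x, a <= x <= b -> phi x = psi x) ->
  primitive phi Phi a b -> primitive psi Phi a b.
Proof.
move=> e P r r0; have [d d0 dP] := P r r0; exists d => // x y z ax xz zy yb xy.
by rewrite -e ?dP// (le_trans ax)//= (le_trans zy).
Qed.

Definition clamp u v x : R := Num.max u (Num.min x v).

Lemma clamp_telescope (t : nat -> R) N x : (forall k, t k <= t k.+1) ->
  t 0%N <= x -> \sum_(k < N) (clamp (t k) (t k.+1) x - t k) = Num.min x (t N) - t 0%N.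
Proof.
move=> tS x0; elim: N => [|N IH]; first by rewrite big_ord0 min_r ?subrr.
rewrite big_ord_recr /= IH /clamp addrC addrA; congr (_ - _).
have := tS N; case: (leP x (t N)) => xN tt.
  by rewrite (min_l (le_trans xN tt)) max_l// subrr add0r.
rewrite subrK max_r// le_min tt andbT; exact: ltW.
Qed.

Lemma clamp_le u v x y : x <= y -> clamp u v x <= clamp u v y.
Proof.
move=> xy; have h : Num.min x v <= Num.min y v by rewrite le_min !ge_min xy lexx orbT.
by rewrite ge_max !le_max lexx/= h orbT.
Qed.

(** Integral from [t 0] of the step function with value [phi (t k)] on
    [t k, t k.+1]. *)
Definition polygon phi (t : nat -> R) N x :=
  \sum_(k < N) (clamp (t k) (t k.+1) x - t k) *: phi (t k).

(** An increment of the polygon over a short interval only meets pieces with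
    nodes close to that interval. *)
Lemma polygon_approx phi (t : nat -> R) N d e x y z : 0 <= e ->
  (forall k, t k <= t k.+1) -> (forall k, (k < N)%N -> t k.+1 - t k < d) ->
  (forall k, (k < N)%N -> `|t k - z| < 2 * d -> `|phi (t k) - phi z| <= e) ->
  t 0%N <= x -> x <= z -> z <= y -> y <= t N -> y - x < d ->
  `|polygon phi t N y - polygon phi t N x - (y - x) *: phi z| <= e * (y - x).
Proof.
move=> e0 tS td phie tx xz zy yt yx; have xy := le_trans xz zy.
have Eyx : y - x = \sum_(k < N) (clamp (t k) (t k.+1) y - clamp (t k) (t k.+1) x).
  have := clamp_telescope N tS (le_trans tx xy); have := clamp_telescope N tS tx.
  rewrite (min_l yt) (min_l (le_trans xy yt)) => Ex Ey.
  have -> : y - x = (y - t 0%N) - (x - t 0%N) by ring.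
  by rewrite -Ex -Ey -sumrB; apply: eq_bigr => k _; ring.
rewrite Eyx /polygon -sumrB scaler_suml -sumrB mulr_sumr.
apply: (le_trans (ler_norm_sum _ _ _)); apply: ler_sum => k _.
set u := clamp _ _ y; set v := clamp _ _ x.
have -> : (u - t k) *: phi (t k) - (v - t k) *: phi (t k) - (u - v) *: phi z =
  (u - v) *: (phi (t k) - phi z).
  by rewrite !(scalerBl, scalerBr); zmodule.
have vu : v <= u by exact: clamp_le.
rewrite normrZ ger0_norm ?subr_ge0// mulrC.
have [->|uv] := eqVneq u v; first by rewrite subrr !mulr0.
apply: ler_wpM2r; rewrite ?subr_ge0//; apply: phie => //.
have tk := td k (ltn_ord k).
have ty : t k < y.
  rewrite ltNge; apply/negP => yk; case/eqP: uv; rewrite /u /v /clamp.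
  by rewrite !max_l// ge_min ?yk ?(le_trans xy yk).
have xt : x < t k.+1.
  rewrite ltNge; apply/negP => yk; case/eqP: uv; rewrite /u /v /clamp.
  by rewrite !min_r// (le_trans yk).
rewrite ltr_norml; apply/andP; split; lra.
Qed.

Lemma approx_primitive phi a b e : a <= b -> ucont phi a b -> 0 < e ->
  exists Phi, Phi a = 0 /\ exists2 d : R, 0 < d &
    forall x y z, a <= x -> x <= z -> z <= y -> y <= b -> y - x < d ->
    `|Phi y - Phi x - (y - x) *: phi z| <= e * (y - x).
Proof.
move=> ab uc e0; have [d d0 dP] := uc e e0.
have d2 : 0 < d / 2 by rewrite divr_gt0.
pose N := (Num.truncn ((b - a) / (d / 2))).+1.
have N0 : 0 < N%:R :> R by rewrite ltr0n.
have NP : (b - a) / N%:R < d / 2.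
  by rewrite ltr_pdivrMr// mulrC -ltr_pdivrMr//; exact: truncnS_gt.
pose t k : R := a + k%:R * ((b - a) / N%:R).
have s0 : 0 <= (b - a) / N%:R by rewrite divr_ge0// subr_ge0.
have tS k : t k.+1 - t k = (b - a) / N%:R by rewrite /t -natr1; ring.
have tN : t N = b by rewrite /t mulrC divfK ?gt_eqF//; ring.
have t0 : t 0%N = a by rewrite /t mul0r addr0.
have tle k m : (k <= m)%N -> t k <= t m.
  by move=> km; rewrite lerD2l ler_wpM2r// ler_nat.
exists (polygon phi t N); split.
  rewrite /polygon big1// => k _.
  by rewrite /clamp max_l ?subrr ?scale0r// ge_min -[X in X <= _]t0 tle.
exists (d / 2) => // x y z ax xz zy yb yx.
apply: (@polygon_approx phi t N (d / 2) e x y z (ltW e0)); rewrite ?t0 ?tN//.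
- by move=> k; apply: tle.
- by move=> k _; rewrite tS.
- move=> k kN tz; apply: dP; last by rewrite mulrC divfK in tz.
  + by rewrite -{1}t0 -tN !tle// ltnW.
  + by rewrite (le_trans ax)//= (le_trans zy).
Qed.

(** Approximate primitives form a Cauchy sequence, whose limit is a primitive. *)
Lemma primitive_exists phi a b : a <= b -> ucont phi a b ->
  exists Phi, primitive phi Phi a b.
Proof.
move=> ab uc.
have inv0 k : 0 < k.+1%:R^-1 :> R by rewrite invr_gt0 ltr0n.
have /choice[F FP] k := approx_primitive ab uc (inv0 k).
have ba1 : 0 < b - a + 1 by rewrite ltr_pwDr// subr_ge0.
have small (e : R) : 0 < e -> exists N, forall m, (N <= m)%N -> m.+1%:R^-1 < e :> R.
  move=> e0; exists (Num.truncn e^-1) => m Nm.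
  rewrite -[ltRHS]invrK ltf_pV2 ?posrE ?invr_gt0 ?ltr0n//.
  by apply: (lt_le_trans (truncnS_gt _)); rewrite ler_nat.
have FF k m x : a <= x <= b ->
    `|F k x - F m x| <= (k.+1%:R^-1 + m.+1%:R^-1) * (x - a).
  case/andP=> ax xb.
  have [Fk0 [d d0 dP]] := FP k; have [Fm0 [c c0 cP]] := FP m.
  have dc : 0 < Num.min d c by rewrite lt_min d0.
  have := @lipschitz_chain (fun x => F k x - F m x) a b _ _ dc _ a x (lexx a) ax xb.
  rewrite Fk0 Fm0 !subr0; apply=> u v au uv vb.
  rewrite lt_min => /andP[vd vc].
  have -> : F k v - F m v - (F k u - F m u) =
    (F k v - F k u - (v - u) *: phi u) - (F m v - F m u - (v - u) *: phi u).
    by zmodule.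
  by rewrite (le_trans (ler_normB _ _))// mulrDl lerD// ?dP ?cP.
have lim x : exists l, a <= x <= b -> forall e : R, 0 < e ->
    exists N, forall m, (N <= m)%N -> `|l - F m x| < e.
  have [xab|] := boolP (a <= x <= b); last by exists 0.
  have [|l lP] := @cauchy_seq_lim R E (fun m => F m x); last by exists l.
  move=> e e0; have [|N NP] := small (e / (b - a + 1) / 2).
    by rewrite !divr_gt0.
  exists N => m Nm; apply: (le_lt_trans (FF N m x xab)).
  set q := e / (b - a + 1) / 2 in NP.
  apply: (@le_lt_trans _ _ ((N.+1%:R^-1 + m.+1%:R^-1) * (b - a + 1))).
    case/andP: xab => ax xb; apply: ler_wpM2l; last lra.
    by rewrite addr_ge0// ltW.
  have -> : e = (q + q) * (b - a + 1) by rewrite /q -splitr divfK// gt_eqF.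
  by rewrite ltr_pM2r// ltrD// NP.
have {lim}/choice[Phi PhiP] := lim.
exists Phi => e e0; have e3 : 0 < e / 5 by rewrite divr_gt0.
have [N NP] := small _ e3.
have [_ [d d0 dP]] := FP N; exists d => // x y z ax xz zy yb yx.
have xy := le_trans xz zy.
have [->|neq] := eqVneq x y.
  by rewrite !subrr scale0r subrr normr0 mulr0.
have xlty : 0 < y - x by rewrite subr_gt0 lt_neqAle neq.
have h4 : 0 < e / 5 * (y - x) by rewrite mulr_gt0.
have [N1 N1P] := PhiP x (introT andP (conj ax (le_trans xy yb))) _ h4.
have [N2 N2P] := PhiP y (introT andP (conj (le_trans ax xy) yb)) _ h4.
pose m := maxn N (maxn N1 N2).
have Lx := N1P m (leq_trans (leq_maxl N1 N2) (leq_maxr N _)).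
have Ly := N2P m (leq_trans (leq_maxr N1 N2) (leq_maxr N _)).
have Nm : (N <= m)%N by exact: leq_maxl.
have Fm : `|(F m y - F m x) - (F N y - F N x)| <= (e / 5 + e / 5) * (y - x).
  have [_ [c c0 cP]] := FP m; have dc : 0 < Num.min d c by rewrite lt_min d0.
  have -> : F m y - F m x - (F N y - F N x) = (F m y - F N y) - (F m x - F N x).
    by zmodule.
  apply: (@lipschitz_chain (fun x => F m x - F N x) a b _ _ dc) => //.
  move=> u v au uv vb; rewrite lt_min => /andP[vd vc].
  have -> : F m v - F N v - (F m u - F N u) =
    (F m v - F m u - (v - u) *: phi u) - (F N v - F N u - (v - u) *: phi u).
    by zmodule.
  have vu : 0 <= v - u by rewrite subr_ge0.
  rewrite (le_trans (ler_normB _ _))//.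
  rewrite (le_trans (lerD (cP _ _ _ au (lexx u) uv vb vc) (dP _ _ _ au (lexx u) uv vb vd)))//.
  rewrite -mulrDl ler_wpM2r//; by apply: lerD; apply: ltW; exact: NP.
have FN := dP x y z ax xz zy yb yx.
have -> : Phi y - Phi x - (y - x) *: phi z =
  (Phi y - F m y) - (Phi x - F m x) + ((F m y - F m x) - (F N y - F N x))
  + (F N y - F N x - (y - x) *: phi z) by zmodule.
have FN' : `|F N y - F N x - (y - x) *: phi z| <= e / 5 * (y - x).
  by apply: (le_trans FN); rewrite ler_wpM2r ?(ltW xlty)// ltW// NP.
move: Lx Ly Fm FN'; set A := Phi y - _; set B := Phi x - _; set C := _ - (F N y - _).
set D := _ - _ *: _ => LB LA LC LD.
rewrite (le_trans (ler_normD _ _))// (le_trans (lerD (ler_normD _ _) (lexx _)))//.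
rewrite (le_trans (lerD (lerD (ler_normB _ _) (lexx _)) (lexx _)))//.
apply: (@le_trans _ _ (e / 5 * (y - x) + e / 5 * (y - x) + (e / 5 + e / 5) * (y - x)
  + e / 5 * (y - x))).
  by apply: lerD => //; apply: lerD => //; apply: lerD; exact: ltW.
by rewrite le_eqVlt; apply/orP; left; apply/eqP; field.
Qed.

End Primitive.

Section SegmentIntegral.
Variables (R : realType) (E : completeNormedModType R).
Implicit Types (phi Phi : R -> E) (a b c d x y z : R).

(** Heine: continuity at every point of a segment is uniform. *)
Lemma ucont_pointwise phi a b :
  (forall x, a <= x <= b -> forall e : R, 0 < e -> exists2 d : R, 0 < d &
     forall y, a <= y <= b -> `|y - x| < d -> `|phi y - phi x| <= e) ->
  ucont phi a b.
Proof.
move=> pc e e0; have e2 : 0 < e / 2 by rewrite divr_gt0.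
pose Q (d : R) x := forall y, a <= y <= b -> `|x - y| < d -> `|phi x - phi y| <= e.
have [||d d0 dP] := @compact_uniform R R _ Q (@segment_compact R a b).
- move=> d d' x _ dd Qd y yab xy; apply: Qd => //; exact: lt_le_trans xy dd.
- move=> x /=; rewrite in_itv /= => xab.
  have [d d0 dP] := pc x xab _ e2; have d2 : 0 < d / 2 by rewrite divr_gt0.
  exists (d / 2) => // y /=; rewrite in_itv /= => yab xy z zab yz.
  rewrite /ball /= in xy; rewrite (le_trans (ler_distD (phi x) _ _))//.
  rewrite [e]splitr lerD//.
    by apply: dP => //; rewrite distrC (lt_trans xy)// gtr_pMr// invf_lt1 ?ltr1n.
  rewrite distrC; apply: dP => //; rewrite distrC (le_lt_trans (ler_distD y _ _))//.
  by rewrite [ltRHS]splitr ltrD.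
exists d => // x y xab yab xy; apply: dP => //=.
Qed.

Lemma ucont_sub phi a b a' b' : a <= a' -> b' <= b -> ucont phi a b ->
  ucont phi a' b'.
Proof.
move=> aa bb uc e e0; have [d d0 dP] := uc e e0; exists d => // x y.
move=> /andP[ax xb] /andP[ay yb]; apply: dP.
  by rewrite (le_trans aa)// (le_trans xb).
by rewrite (le_trans aa)// (le_trans yb).
Qed.

(** The primitive is taken on the hull of the two ends, which gives integrals
    oriented in either direction. *)
Definition segint phi a b : E :=
  let Phi := xget phi [set Phi | primitive phi Phi (Num.min a b) (Num.max a b)] in
  Phi b - Phi a.

Lemma primitive_lin (E' : completeNormedModType R) (L : E -> E') C phi Phi a b :
  linear L -> (forall v, `|L v| <= C * `|v|) ->
  primitive phi Phi a b -> primitive (L \o phi) (L \o Phi) a b.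
Proof.
move=> Llin LC P e e0; have C1 : 0 < `|C| + 1 by rewrite ltr_wpDl.
have [d d0 dP] := P (e / (`|C| + 1)) (divr_gt0 e0 C1).
exists d => // x y z ax xz zy yb yx /=.
have LB u v : L (u - v) = L u - L v.
  by rewrite addrC -scaleN1r Llin scaleN1r addrC.
have LZ k v : L (k *: v) = k *: L v.
  have L0 : L 0 = 0 by rewrite -(subrr 0) LB subrr.
  by rewrite -[k *: v]addr0 Llin L0 addr0.
rewrite -LZ -!LB (le_trans (LC _))//.
apply: (@le_trans _ _ ((`|C| + 1) * (e / (`|C| + 1) * (y - x)))).
  apply: (@le_trans _ _ (`|C| * `|Phi y - Phi x - (y - x) *: phi z|)).
    by rewrite ler_wpM2r// ler_norm.
  by apply: ler_pM => //; [rewrite lerDl | exact: dP].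
by rewrite mulrA mulrCA divff ?mulr1 ?gt_eqF.
Qed.

Lemma primitive_opp phi Phi a b : primitive phi Phi a b ->
  primitive (fun x => - phi x) (fun x => - Phi x) a b.
Proof.
apply: (@primitive_lin E (fun v => - v) 1) => [k u v|v].
  by rewrite opprD scalerN.
by rewrite normrN mul1r.
Qed.

Lemma segintE phi Phi c d a b : c <= a <= d -> c <= b <= d ->
  primitive phi Phi c d -> segint phi a b = Phi b - Phi a.
Proof.
move=> /andP[ca ad] /andP[cb bd] P.
have Pab : primitive phi Phi (Num.min a b) (Num.max a b).
  by apply: primitive_sub P; rewrite ?le_min ?ge_max ?ca ?ad.
rewrite /segint; case: xgetP => [Psi _ /= Q|/(_ Phi)//].
have mM : Num.min a b <= Num.max a b by rewrite ge_min !le_max lexx.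
have := primitiveD Q (primitive_opp Pab).
set D := (fun x => Psi x + - Phi x) => PD.
have Dab : D (Num.max a b) - D (Num.min a b) = 0.
  apply/eqP; rewrite -normr_le0 -(mul0r (Num.max a b - Num.min a b)).
  by apply: primitive_le mM PD _ => x _; rewrite subrr normr0.
have : D b - D a = 0.
  by case: (leP a b) Dab => // _ /eqP; rewrite subr_eq0 => /eqP ->; rewrite subrr.
move/eqP; rewrite subr_eq0 /D => /eqP e.
apply/eqP; rewrite -subr_eq0; apply/eqP.
transitivity ((Psi b - Phi b) - (Psi a - Phi a)); first by zmodule.
by rewrite e subrr.
Qed.

Lemma segint_aa phi a : segint phi a a = 0. Proof. exact: subrr. Qed.

Lemma segint_opp phi a b : segint phi b a = - segint phi a b.
Proof. by rewrite /segint minC maxC opprB. Qed.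

Lemma segint_cat phi c d x y z : ucont phi c d -> c <= x <= d -> c <= y <= d ->
  c <= z <= d -> segint phi x y + segint phi y z = segint phi x z.
Proof.
move=> uc xcd ycd zcd; have cd : c <= d by case/andP: xcd => h1 h2; exact: le_trans h1 h2.
have [Phi P] := primitive_exists cd uc.
by rewrite !(segintE _ _ P)//; zmodule.
Qed.

Lemma min_max_itv a b : (Num.min a b <= a <= Num.max a b)
  /\ (Num.min a b <= b <= Num.max a b).
Proof. by rewrite !ge_min !le_max !lexx !orbT. Qed.

Lemma min_le_max a b : Num.min a b <= Num.max a b.
Proof. by rewrite ge_min !le_max lexx. Qed.

Lemma segintD phi psi a b : ucont phi (Num.min a b) (Num.max a b) ->
  ucont psi (Num.min a b) (Num.max a b) ->
  segint (fun x => phi x + psi x) a b = segint phi a b + segint psi a b.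
Proof.
move=> u v; have [Phi P] := primitive_exists (min_le_max a b) u.
have [Psi Q] := primitive_exists (min_le_max a b) v.
have [ia ib] := min_max_itv a b.
rewrite (segintE ia ib P) (segintE ia ib Q) (segintE ia ib (primitiveD P Q)).
by zmodule.
Qed.

Lemma segint_ext phi psi a b :
  (forall x, Num.min a b <= x <= Num.max a b -> phi x = psi x) ->
  ucont phi (Num.min a b) (Num.max a b) -> segint phi a b = segint psi a b.
Proof.
move=> e u; have [Phi P] := primitive_exists (min_le_max a b) u.
have [ia ib] := min_max_itv a b.
by rewrite (segintE ia ib P) (segintE ia ib (primitive_ext e P)).
Qed.

Lemma primitive_cst (v : E) a b : primitive (fun=> v) (fun x => x *: v) a b.
Proof.
move=> e e0; exists 1 => // x y z ax xz zy yb _.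
rewrite -scalerBl subrr normr0; apply: mulr_ge0; first exact: ltW.
by rewrite subr_ge0; exact: le_trans zy.
Qed.

Lemma segint_near_cst phi a b v M : ucont phi (Num.min a b) (Num.max a b) ->
  (forall x, Num.min a b <= x <= Num.max a b -> `|phi x - v| <= M) ->
  `|segint phi a b - (b - a) *: v| <= M * `|b - a|.
Proof.
move=> u le; have [Phi P] := primitive_exists (min_le_max a b) u.
have [ia ib] := min_max_itv a b.
have PP := primitiveD P (primitive_opp (primitive_cst v _ _)).
have := primitive_le (min_le_max a b) PP le.
rewrite (segintE ia ib P); case: (leP a b) => ab.
  rewrite (ger0_norm (_ : 0 <= b - a)) ?subr_ge0// => h.
  apply: le_trans h; rewrite le_eqVlt; apply/orP; left; apply/eqP; congr `|_|.
  by rewrite /= scalerBl; zmodule.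
have ba : b - a <= 0 by rewrite subr_le0 ltW.
have -> : `|b - a| = a - b by rewrite (ler0_norm ba) opprB.
rewrite distrC => h.
apply: le_trans h; rewrite le_eqVlt; apply/orP; left; apply/eqP; congr `|_|.
by rewrite /= scalerBl; zmodule.
Qed.

Lemma segint_le phi a b M : ucont phi (Num.min a b) (Num.max a b) ->
  (forall x, Num.min a b <= x <= Num.max a b -> `|phi x| <= M) ->
  `|segint phi a b| <= M * `|b - a|.
Proof.
move=> u le; have := @segint_near_cst phi a b 0 M u.
rewrite scaler0 subr0; apply=> x xab; rewrite subr0; exact: le.
Qed.

End SegmentIntegral.

Lemma segint_lin (R : realType) (E E' : completeNormedModType R) (L : E -> E') C
    (phi : R -> E) a b :
  linear L -> (forall v, `|L v| <= C * `|v|) ->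
  ucont phi (Num.min a b) (Num.max a b) ->
  segint (fun x => L (phi x)) a b = L (segint phi a b).
Proof.
move=> Llin LC u; have [Phi P] := primitive_exists (min_le_max a b) u.
have [ia ib] := min_max_itv a b.
rewrite (segintE ia ib P) (segintE ia ib (primitive_lin Llin LC P)) /=.
by rewrite -[in RHS]scaleN1r [in RHS]addrC Llin scaleN1r addrC.
Qed.

Lemma segint_reflect (R : realType) (E : completeNormedModType R) (phi : R -> E) a b :
  ucont phi (Num.min (- a) (- b)) (Num.max (- a) (- b)) ->
  segint (fun x => phi (- x)) a b = segint phi (- b) (- a).
Proof.
move=> u; have [Phi P] := primitive_exists (min_le_max _ _) u.
have [ia ib] := min_max_itv (- a) (- b).
rewrite (segintE ib ia P).
have Q : primitive (fun x => phi (- x)) (fun x => - Phi (- x)) (Num.min a b) (Num.max a b).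
  move=> e e0; have [d d0 dP] := P e e0; exists d => // x y z ax xz zy yb yx.
  have := dP (- y) (- x) (- z); rewrite -oppr_max -oppr_min !lerN2 opprK.
  rewrite (addrC (- x) y) => /(_ yb zy xz ax yx).
  apply: le_trans; rewrite le_eqVlt; apply/orP; left; apply/eqP; congr `|_|.
  by rewrite opprK; zmodule.
have [ja jb] := min_max_itv a b.
by rewrite (segintE ja jb Q); zmodule.
Qed.

(** For real functions differentiability everywhere suffices: the mean value
    theorem makes it uniform. *)
Lemma segint_ftc (R : realType) (phi Phi : R -> R) a b :
  ucont (phi : R -> R^o) (Num.min a b) (Num.max a b) ->
  (forall x : R, is_derive x 1 Phi (phi x)) ->
  segint (phi : R -> R^o) a b = Phi b - Phi a.
Proof.
move=> u dP; have [ia ib] := min_max_itv a b.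
have P : @primitive R R^o phi Phi (Num.min a b) (Num.max a b).
  move=> e e0; have [d d0 uP] := u e e0; exists d => // x y z ax xz zy yb yx.
  have xy := le_trans xz zy.
  have [c /andP[xc cy] ->] : exists2 c, x <= c <= y & Phi y - Phi x = phi c * (y - x).
    have [|c] := @MVT_segment _ Phi phi x y xy (fun x _ => dP x).
      by apply: derivable_within_continuous => t _; have [] := dP t.
    by rewrite in_itv /= => h1 h2; exists c.
  rewrite -[_ *: _]/((y - x) * phi z) mulrC -mulrBr normrM.
  rewrite (ger0_norm (_ : 0 <= y - x)) ?subr_ge0// mulrC ler_wpM2r ?subr_ge0//.
  apply: uP; first by rewrite (le_trans ax)//= (le_trans cy).
    by rewrite (le_trans ax)//= (le_trans zy).
  by rewrite ltr_norml; apply/andP; split; lra.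
by rewrite (segintE ia ib P).
Qed.

(** * Closed forms on rectangles and Goursat's theorem *)

Section PlaneForms.
Variables (R : realType) (E : completeNormedModType R).
Implicit Types (g P Q : R * R -> E) (z w h : R * R).

Lemma prod_norm_le z (r : R) : (`|z| <= r) = (`|z.1| <= r) && (`|z.2| <= r).
Proof. by rewrite prod_normE ge_max. Qed.

Lemma prod_norm_lt z (r : R) : (`|z| < r) = (`|z.1| < r) && (`|z.2| < r).
Proof. by rewrite prod_normE gt_max. Qed.

Lemma prod_norm_fst z : `|z.1| <= `|z|.
Proof. by have := lexx `|z|; rewrite {1}prod_norm_le => /andP[]. Qed.

Lemma prod_norm_snd z : `|z.2| <= `|z|.
Proof. by have := lexx `|z|; rewrite {1}prod_norm_le => /andP[]. Qed.

Lemma itv_dist_le (x y a w D : R) :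
  a <= x <= a + w -> a <= y <= a + w -> w <= D -> `|x - y| <= D.
Proof.
move=> /andP[ax xw] /andP[ay yw] wD; rewrite ler_norml.
by apply/andP; split; lra.
Qed.

(** Fréchet differentiability at z: A and B are the values of the differential
    on the two unit vectors. *)
Definition diffat g z (A B : E) := forall e : R, 0 < e -> exists2 d : R, 0 < d &
  forall h, `|h| < d -> `|g (z + h) - g z - (h.1 *: A + h.2 *: B)| <= e * `|h|.

Definition contat g z := forall e : R, 0 < e -> exists2 d : R, 0 < d &
  forall w, `|w - z| < d -> `|g w - g z| <= e.

Lemma diffat_lip g z A B : diffat g z A B -> exists2 d : R, 0 < d &
  forall w, `|w - z| < d -> `|g w - g z| <= (`|A| + `|B| + 1) * `|w - z|.
Proof.
move=> D; have [d d0 dP] := D _ ltr01; exists d => // w wz.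
have := dP _ wz; rewrite (addrC z) subrK mul1r => h.
have -> : g w - g z = (g w - g z - ((w - z).1 *: A + (w - z).2 *: B))
  + ((w - z).1 *: A + (w - z).2 *: B) by zmodule.
rewrite mulrDl mul1r addrC (le_trans (ler_normD _ _))// lerD//.
rewrite (le_trans (ler_normD _ _))// mulrDl !normrZ !(mulrC _ `|w - z|).
by apply: lerD; apply: ler_wpM2r; rewrite ?prod_norm_fst ?prod_norm_snd.
Qed.

Lemma diffat_cont g z A B : diffat g z A B -> contat g z.
Proof.
move=> /diffat_lip[d d0 dP] e e0; set C := `|A| + `|B| + 1 in dP.
have C0 : 0 < C by rewrite ltr_wpDl// addr_ge0.
exists (Num.min d (e / C)) => [|w]; first by rewrite lt_min d0 divr_gt0.
rewrite lt_min => /andP[wd we]; rewrite (le_trans (dP w wd))//.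
by rewrite mulrC -ler_pdivlMr// ltW.
Qed.

Lemma ucont_horizontal g a b y :
  (forall t, a <= t <= b -> contat g (t, y)) -> ucont (fun t => g (t, y)) a b.
Proof.
move=> gc; apply: ucont_pointwise => x xab e e0.
have [d d0 dP] := gc x xab e e0; exists d => // t _ tx; apply: dP.
by rewrite prod_norm_lt /= tx subrr normr0.
Qed.

Lemma ucont_vertical g a b x :
  (forall t, a <= t <= b -> contat g (x, t)) -> ucont (fun t => g (x, t)) a b.
Proof.
move=> gc; apply: ucont_pointwise => y yab e e0.
have [d d0 dP] := gc y yab e e0; exists d => // t _ ty; apply: dP.
by rewrite prod_norm_lt /= subrr normr0 d0.
Qed.

Definition hint P y a b := segint (fun t => P (t, y)) a b.
Definition vint Q x c d := segint (fun t => Q (x, t)) c d.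

(** Integral of P du + Q dv along the boundary of [a, b] x [c, d]. *)
Definition rint P Q a b c d :=
  hint P c a b + vint Q b c d - hint P d a b - vint Q a c d.

Definition edge_cont P Q a b c d :=
  [/\ ucont (fun t => P (t, c)) a b, ucont (fun t => P (t, d)) a b,
      ucont (fun t => Q (a, t)) c d & ucont (fun t => Q (b, t)) c d].

Definition rect a b c d : set (R * R) := [set z | a <= z.1 <= b /\ c <= z.2 <= d].

Lemma edge_cont_rect P Q a b c d : a <= b -> c <= d ->
  (forall z, rect a b c d z -> contat P z /\ contat Q z) -> edge_cont P Q a b c d.
Proof.
move=> ab cd PQ; split.
- by apply: ucont_horizontal => t tab; apply: (PQ _ _).1; rewrite /rect/= lexx.
- by apply: ucont_horizontal => t tab; apply: (PQ _ _).1; rewrite /rect/= lexx cd.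
- by apply: ucont_vertical => t tcd; apply: (PQ _ _).2; rewrite /rect/= lexx.
- by apply: ucont_vertical => t tcd; apply: (PQ _ _).2; rewrite /rect/= lexx ab.
Qed.

Lemma rint_le P Q a b c d (M : R) : a <= b -> c <= d -> edge_cont P Q a b c d ->
  (forall z, rect a b c d z -> [|| z.1 == a, z.1 == b, z.2 == c | z.2 == d] ->
     `|P z| <= M /\ `|Q z| <= M) ->
  `|rint P Q a b c d| <= 2 * M * ((b - a) + (d - c)).
Proof.
move=> ab cd [c1 c2 c3 c4] PQ.
have [mab Mab] : Num.min a b = a /\ Num.max a b = b by rewrite min_l ?max_r.
have [mcd Mcd] : Num.min c d = c /\ Num.max c d = d by rewrite min_l ?max_r.
have ba : `|b - a| = b - a by rewrite ger0_norm ?subr_ge0.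
have dc : `|d - c| = d - c by rewrite ger0_norm ?subr_ge0.
have h1 : `|hint P c a b| <= M * (b - a).
  rewrite -ba; apply: segint_le; rewrite mab Mab// => t tab.
  by apply: (PQ (t, c) _ _).1; rewrite /rect/= ?lexx ?eqxx ?orbT.
have h2 : `|hint P d a b| <= M * (b - a).
  rewrite -ba; apply: segint_le; rewrite mab Mab// => t tab.
  by apply: (PQ (t, d) _ _).1; rewrite /rect/= ?lexx ?cd ?eqxx ?orbT.
have h3 : `|vint Q a c d| <= M * (d - c).
  rewrite -dc; apply: segint_le; rewrite mcd Mcd// => t tab.
  by apply: (PQ (a, t) _ _).2; rewrite /rect/= ?lexx ?eqxx ?orbT.
have h4 : `|vint Q b c d| <= M * (d - c).
  rewrite -dc; apply: segint_le; rewrite mcd Mcd// => t tab.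
  by apply: (PQ (b, t) _ _).2; rewrite /rect/= ?lexx ?ab ?eqxx ?orbT.
rewrite /rint.
have k1 := ler_normB (hint P c a b + vint Q b c d - hint P d a b) (vint Q a c d).
have k2 := ler_normB (hint P c a b + vint Q b c d) (hint P d a b).
have k3 := ler_normD (hint P c a b) (vint Q b c d).
lra.
Qed.

Lemma rintD P Q P' Q' a b c d : a <= b -> c <= d ->
  edge_cont P Q a b c d -> edge_cont P' Q' a b c d ->
  rint (fun z => P z + P' z) (fun z => Q z + Q' z) a b c d
  = rint P Q a b c d + rint P' Q' a b c d.
Proof.
move=> ab cd [c1 c2 c3 c4] [d1 d2 d3 d4].
have [mab Mab] : Num.min a b = a /\ Num.max a b = b by rewrite min_l ?max_r.
have [mcd Mcd] : Num.min c d = c /\ Num.max c d = d by rewrite min_l ?max_r.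
by rewrite /rint /hint /vint !segintD ?mab ?Mab ?mcd ?Mcd//; zmodule.
Qed.

Lemma rint_ext P Q P' Q' a b c d : a <= b -> c <= d -> edge_cont P Q a b c d ->
  (forall z, rect a b c d z -> [|| z.1 == a, z.1 == b, z.2 == c | z.2 == d] ->
     P z = P' z /\ Q z = Q' z) ->
  rint P Q a b c d = rint P' Q' a b c d.
Proof.
move=> ab cd [c1 c2 c3 c4] e.
have [mab Mab] : Num.min a b = a /\ Num.max a b = b by rewrite min_l ?max_r.
have [mcd Mcd] : Num.min c d = c /\ Num.max c d = d by rewrite min_l ?max_r.
rewrite /rint /hint /vint; congr (_ + _ - _ - _).
- apply: segint_ext; rewrite mab Mab// => t tab.
  by apply: (e (t, c) _ _).1; rewrite /rect/= ?lexx ?eqxx ?orbT.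
- apply: segint_ext; rewrite mcd Mcd// => t tab.
  by apply: (e (b, t) _ _).2; rewrite /rect/= ?lexx ?ab ?eqxx ?orbT.
- apply: segint_ext; rewrite mab Mab// => t tab.
  by apply: (e (t, d) _ _).1; rewrite /rect/= ?lexx ?cd ?eqxx ?orbT.
- apply: segint_ext; rewrite mcd Mcd// => t tab.
  by apply: (e (a, t) _ _).2; rewrite /rect/= ?lexx ?eqxx ?orbT.
Qed.

Lemma rint_hsplit P Q a m b c d : a <= m <= b ->
  ucont (fun t => P (t, c)) a b -> ucont (fun t => P (t, d)) a b ->
  rint P Q a b c d = rint P Q a m c d + rint P Q m b c d.
Proof.
move=> /andP[am mb] u v; have ab := le_trans am mb.
rewrite /rint /hint -(@segint_cat _ _ (fun t => P (t, c)) a b a m b) ?lexx ?ab ?am//.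
rewrite -(@segint_cat _ _ (fun t => P (t, d)) a b a m b) ?lexx ?ab ?am//.
by rewrite /vint; zmodule.
Qed.

Lemma rint_vsplit P Q a b c m d : c <= m <= d ->
  ucont (fun t => Q (a, t)) c d -> ucont (fun t => Q (b, t)) c d ->
  rint P Q a b c d = rint P Q a b c m + rint P Q a b m d.
Proof.
move=> /andP[cm md] u v; have cd := le_trans cm md.
rewrite /rint /vint.
rewrite -(@segint_cat _ _ (fun t => Q (a, t)) c d c m d) ?lexx ?cd ?cm//.
rewrite -(@segint_cat _ _ (fun t => Q (b, t)) c d c m d) ?lexx ?cd ?cm//.
by rewrite /hint; zmodule.
Qed.

Lemma ucont_affine (u v : E) t0 a b : ucont (fun t => v + (t - t0) *: u) a b.
Proof.
move=> e e0; have u1 : 0 < `|u| + 1 by rewrite ltr_wpDl.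
exists (e / (`|u| + 1)) => [|x y _ _ xy]; first by rewrite divr_gt0.
have -> : v + (x - t0) *: u - (v + (y - t0) *: u) = (x - y) *: u.
  by rewrite !scalerBl; zmodule.
rewrite normrZ; apply: (@le_trans _ _ (`|x - y| * (`|u| + 1))).
  by apply: ler_wpM2l => //; rewrite lerDl.
by rewrite -ler_pdivlMr// ltW.
Qed.

Lemma segint_affine (u v : E) t0 a b : segint (fun t => v + (t - t0) *: u) a b =
  (b - a) *: v + (((b - t0) ^+ 2 - (a - t0) ^+ 2) / 2) *: u.
Proof.
have P : primitive (fun t => v + (t - t0) *: u)
    (fun t => t *: v + ((t - t0) ^+ 2 / 2) *: u) (Num.min a b) (Num.max a b).
  move=> e e0; have u1 : 0 < `|u| + 1 by rewrite ltr_wpDl.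
  exists (e / (`|u| + 1)) => [|x y z ax xz zy yb yx]; first by rewrite divr_gt0.
  have xy := le_trans xz zy.
  have -> : y *: v + ((y - t0) ^+ 2 / 2) *: u - (x *: v + ((x - t0) ^+ 2 / 2) *: u)
     - (y - x) *: (v + (z - t0) *: u) = ((y - x) * ((x + y) / 2 - z)) *: u.
    rewrite scalerDr !scalerA.
    have -> : (y - x) * ((x + y) / 2 - z) =
      (y - t0) ^+ 2 / 2 - (x - t0) ^+ 2 / 2 - (y - x) * (z - t0) by field.
    by rewrite !scalerBl; zmodule.
  have yx0 : 0 <= y - x by rewrite subr_ge0.
  rewrite normrZ normrM (ger0_norm yx0) -mulrA mulrC; apply: ler_wpM2r => //.
  apply: (@le_trans _ _ ((y - x) * (`|u| + 1))).
    apply: ler_pM => //; last by rewrite lerDl.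
    by rewrite ler_norml; apply/andP; split; lra.
  by rewrite -ler_pdivlMr// ltW.
have [ia ib] := min_max_itv a b; rewrite (segintE ia ib P).
by rewrite mulrBl !scalerBl; zmodule.
Qed.

(** A closed form with affine coefficients has a quadratic primitive. *)
Lemma rint_affine (p q A B C : E) z a b c d :
  rint (fun w => p + ((w - z).1 *: A + (w - z).2 *: B))
       (fun w => q + ((w - z).1 *: B + (w - z).2 *: C)) a b c d = 0.
Proof.
have H y : hint (fun w => p + ((w - z).1 *: A + (w - z).2 *: B)) y a b =
  (b - a) *: (p + (y - z.2) *: B) + (((b - z.1) ^+ 2 - (a - z.1) ^+ 2) / 2) *: A.
  rewrite -segint_affine; congr segint; apply/funext => t /=; zmodule.
have W x : vint (fun w => q + ((w - z).1 *: B + (w - z).2 *: C)) x c d =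
  (d - c) *: (q + (x - z.1) *: B) + (((d - z.2) ^+ 2 - (c - z.2) ^+ 2) / 2) *: C.
  rewrite -segint_affine; congr segint; apply/funext => t /=; zmodule.
rewrite /rint !H !W !scalerDr !scalerA.
transitivity (((b - a) * (c - z.2) + (d - c) * (b - z.1) - (b - a) * (d - z.2)
   - (d - c) * (a - z.1)) *: B).
  by rewrite !scalerBl scalerDl !(mulrBl, scalerBl); zmodule.
by rewrite (_ : _ - _ = 0) ?scale0r//; ring.
Qed.

(** The form P du + Q dv is closed at z in the pointwise sense: the coefficients
    are differentiable there and the cross derivatives P_v and Q_u are equal. *)
Definition closedat P Q z := exists A B C, diffat P z A B /\ diffat Q z B C.

Lemma closedat_contP P Q z : closedat P Q z -> contat P z.
Proof. by case=> A [B [C [p _]]]; exact: diffat_cont p. Qed.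

Lemma closedat_contQ P Q z : closedat P Q z -> contat Q z.
Proof. by case=> A [B [C [_ q]]]; exact: diffat_cont q. Qed.

Lemma closed_edge_cont P Q a b c d : a <= b -> c <= d ->
  (forall z, rect a b c d z -> closedat P Q z) -> edge_cont P Q a b c d.
Proof.
move=> ab cd PQ; apply: edge_cont_rect => // z /PQ cz.
by split; [exact: closedat_contP cz | exact: closedat_contQ cz].
Qed.

(** Near a point where it is differentiable a closed form is affine up to a
    relative error, and the affine part does not contribute. *)
Lemma rint_small P Q z a b c d (e D : R) : a <= b -> c <= d ->
  edge_cont P Q a b c d -> rect a b c d z -> 0 <= e -> b - a <= D -> d - c <= D ->
  (exists A B C, forall w, rect a b c d w ->
    `|P w - P z - ((w - z).1 *: A + (w - z).2 *: B)| <= e * `|w - z| /\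
    `|Q w - Q z - ((w - z).1 *: B + (w - z).2 *: C)| <= e * `|w - z|) ->
  `|rint P Q a b c d| <= 4 * e * D ^+ 2.
Proof.
move=> ab cd PQc [/= /andP[az zb] /andP[cz zd]] e0 abD cdD [A [B [C ABC]]].
pose P' w := P z + ((w - z).1 *: A + (w - z).2 *: B).
pose Q' w := Q z + ((w - z).1 *: B + (w - z).2 *: C).
have P'c y x0 x1 : ucont (fun t => P' (t, y)) x0 x1.
  rewrite (_ : (fun t => _) = fun t => (P z + (y - z.2) *: B) + (t - z.1) *: A).
    exact: ucont_affine.
  by apply/funext => t; rewrite /P' /=; zmodule.
have Q'c x y0 y1 : ucont (fun t => Q' (x, t)) y0 y1.
  rewrite (_ : (fun t => _) = fun t => (Q z + (x - z.1) *: B) + (t - z.2) *: C).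
    exact: ucont_affine.
  by apply/funext => t; rewrite /Q' /=; zmodule.
have uB (f g : R -> E) x0 x1 : ucont f x0 x1 -> ucont g x0 x1 ->
    ucont (fun t => f t - g t) x0 x1.
  move=> uf ug r r0; have r2 : 0 < r / 2 by rewrite divr_gt0.
  have [d1 d10 d1P] := uf _ r2; have [d2 d20 d2P] := ug _ r2.
  exists (Num.min d1 d2) => [|x y hx hy]; first by rewrite lt_min d10.
  rewrite lt_min => /andP[xy1 xy2].
  have -> : f x - g x - (f y - g y) = (f x - f y) - (g x - g y) by zmodule.
  by rewrite (le_trans (ler_normB _ _))// [r]splitr lerD ?d1P ?d2P.
have [c1 c2 c3 c4] := PQc.
have Rc : edge_cont (fun w => P w - P' w) (fun w => Q w - Q' w) a b c d.
  by split; apply: uB.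
have -> : rint P Q a b c d = rint (fun w => P w - P' w) (fun w => Q w - Q' w) a b c d.
  have eP : (fun w => (P w - P' w) + P' w) = P by apply/funext => w; rewrite subrK.
  have eQ : (fun w => (Q w - Q' w) + Q' w) = Q by apply/funext => w; rewrite subrK.
  have c' : edge_cont P' Q' a b c d by split.
  by have := rintD ab cd Rc c'; rewrite eP eQ rint_affine addr0.
apply: (@le_trans _ _ (2 * (e * D) * ((b - a) + (d - c)))); last first.
  have D0 : 0 <= D by apply: le_trans abD; rewrite subr_ge0.
  have eD : 0 <= e * D by rewrite mulr_ge0.
  have : 2 * (e * D) * (b - a + (d - c)) <= 2 * (e * D) * (D + D).
    by apply: ler_wpM2l; [rewrite mulr_ge0 | exact: lerD].
  by move/le_trans; apply; rewrite le_eqVlt; apply/orP; left; apply/eqP; ring.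
apply: rint_le => // w abw _.
have wz : `|w - z| <= D.
  case: abw => /= /andP[aw wb] /andP[cw wd].
  rewrite prod_norm_le /= !ler_norml; apply/andP; split; apply/andP; split; lra.
have [Pw Qw] := ABC w abw.
have -> : P w - P' w = P w - P z - ((w - z).1 *: A + (w - z).2 *: B).
  by rewrite /P'; zmodule.
have -> : Q w - Q' w = Q w - Q z - ((w - z).1 *: B + (w - z).2 *: C).
  by rewrite /Q'; zmodule.
by split; [apply: (le_trans Pw)|apply: (le_trans Qw)]; apply: ler_wpM2l.
Qed.

(** The integrals along the boundaries of the four quarters add up to the whole,
    so one of them carries at least a quarter of it. *)
Lemma rint_quarter P Q a b c d : a <= b -> c <= d ->
  (forall z, rect a b c d z -> closedat P Q z) ->
  exists p : R * R, [/\ (p.1 = a \/ p.1 = a + (b - a) / 2),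
    (p.2 = c \/ p.2 = c + (d - c) / 2) &
    `|rint P Q a b c d| <= 4 * `|rint P Q p.1 (p.1 + (b - a) / 2) p.2 (p.2 + (d - c) / 2)|].
Proof.
move=> ab cd cl; set m := a + (b - a) / 2; set k := c + (d - c) / 2.
have am : a <= m by rewrite lerDl divr_ge0// subr_ge0.
have ck : c <= k by rewrite lerDl divr_ge0// subr_ge0.
have mb : m + (b - a) / 2 = b by rewrite /m; field.
have kd : k + (d - c) / 2 = d by rewrite /k; field.
have mleb : m <= b by rewrite -mb lerDl divr_ge0// subr_ge0.
have kled : k <= d by rewrite -kd lerDl divr_ge0// subr_ge0.
have [u1 u2 u3 u4] := closed_edge_cont ab cd cl.
have u5 : ucont (fun t => Q (m, t)) c d.
  apply: ucont_vertical => t tcd; apply: closedat_contQ; apply: cl.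
  by split => //=; rewrite am.
have E1 : rint P Q a b c d = rint P Q a m c k + rint P Q a m k d
   + (rint P Q m b c k + rint P Q m b k d).
  by rewrite (@rint_hsplit P Q a m b)// ?am// !(@rint_vsplit P Q _ _ c k d)// ?ck.
have F : `|rint P Q a b c d| <= `|rint P Q a m c k| + `|rint P Q a m k d|
   + (`|rint P Q m b c k| + `|rint P Q m b k d|).
  rewrite E1 (le_trans (ler_normD _ _))//; apply: lerD; exact: ler_normD.
have [h|/negP h1] := boolP (`|rint P Q a b c d| <= 4 * `|rint P Q a m c k|).
  by exists (a, c); split => //=; left.
have [h|/negP h2] := boolP (`|rint P Q a b c d| <= 4 * `|rint P Q a m k d|).
  by exists (a, k); split => //=; rewrite ?kd; [left|right|].
have [h|/negP h3] := boolP (`|rint P Q a b c d| <= 4 * `|rint P Q m b c k|).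
  by exists (m, c); split => //=; rewrite ?mb; [right|left|].
exists (m, k); split; rewrite /= ?mb ?kd; [by right|by right|].
move/negP: h1; move/negP: h2; move/negP: h3; rewrite -!ltNge => h3 h2 h1; lra.
Qed.

(** Goursat: repeated quartering keeps the ratio of the boundary integral to
    the squared size, which tends to 0 at a point of differentiability. *)
Theorem goursat P Q a b c d : a <= b -> c <= d ->
  (forall z, rect a b c d z -> closedat P Q z) -> rint P Q a b c d = 0.
Proof.
move=> ab cd cl; apply/eqP; rewrite -normr_le0 leNgt; apply/negP => N0.
set N := `|_| in N0.
pose s k : R := 2 ^- k.
have s0 k : 0 < s k by rewrite invr_gt0 exprn_gt0.
have sS k : s k.+1 = s k / 2 by rewrite /s exprS invfM mulrC.
pose w k := s k * (b - a); pose l k := s k * (d - c).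
have w0 k : 0 <= w k by rewrite mulr_ge0 ?subr_ge0// ltW.
have l0 k : 0 <= l k by rewrite mulr_ge0 ?subr_ge0// ltW.
have wS k : w k.+1 = w k / 2 by rewrite /w sS; ring.
have lS k : l k.+1 = l k / 2 by rewrite /l sS; ring.
pose inside k (p : R * R) := [/\ a <= p.1, p.1 + w k <= b, c <= p.2 & p.2 + l k <= d].
pose B k (p : R * R) := rint P Q p.1 (p.1 + w k) p.2 (p.2 + l k).
have step k p : exists q : R * R, inside k p ->
    [/\ inside k.+1 q, p.1 <= q.1, q.1 + w k.+1 <= p.1 + w k &
     [/\ p.2 <= q.2, q.2 + l k.+1 <= p.2 + l k & `|B k p| <= 4 * `|B k.+1 q|]].
  have [[ap pb cp pd]|] := pselect (inside k p); last by exists p.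
  have pw : p.1 <= p.1 + w k by rewrite lerDl.
  have pl : p.2 <= p.2 + l k by rewrite lerDl.
  have [|q] := @rint_quarter P Q _ _ _ _ pw pl.
    move=> z [/= /andP[h1 h2] /andP[h3 h4]]; apply: cl; split => /=.
      by rewrite (le_trans ap) ?(le_trans h2).
    by rewrite (le_trans cp) ?(le_trans h4).
  rewrite !(addrAC _ _ (- p.1)) !(addrAC _ _ (- p.2)) !subrr !add0r -wS -lS.
  case=> q1 q2 qB; exists q => _.
  have wk := w0 k; have lk := l0 k; have := wS k; have := lS k => lSk wSk.
  clear -wk lk lSk wSk q1 q2 qB ap pb cp pd.
  by case: q1 => q1; case: q2 => q2; split; try split => //; lra.
have /choice[f fP] : forall kp : nat * (R * R), exists q, _ := fun kp => step kp.1 kp.2.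
pose p := fix p k := if k is k'.+1 then f (k', p k') else (a, c).
have pin k : inside k (p k).
  elim: k => [|k IH]; last by have [] := fP (k, p k) IH.
  rewrite /inside /w /l /s expr0 invr1 !mul1r /=; split => //; lra.
have pP k := fP (k, p k) (pin k).
have pB k : N <= 4 ^+ k * `|B k (p k)|.
  elim: k => [|k IH].
    rewrite expr0 mul1r /N /B /w /l /s expr0 invr1 !mul1r /=.
    by rewrite !(addrC a) !(addrC c) !subrK.
  apply: (le_trans IH); rewrite exprSr -mulrA ler_wpM2l ?exprn_ge0//.
  by have [_ _ _ [_ _]] := pP k.
have mono1 k m : (k <= m)%N -> (p k).1 <= (p m).1 /\ (p m).1 + w m <= (p k).1 + w k.
  move=> /subnKC <-; elim: (m - k)%N => [|j [IH1 IH2]]; first by rewrite addn0.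
  rewrite addnS; have [_ h1 h2 _] := pP (k + j)%N.
  by split; [exact: le_trans IH1 h1 | exact: le_trans h2 IH2].
have mono2 k m : (k <= m)%N -> (p k).2 <= (p m).2 /\ (p m).2 + l m <= (p k).2 + l k.
  move=> /subnKC <-; elim: (m - k)%N => [|j [IH1 IH2]]; first by rewrite addn0.
  rewrite addnS; have [_ _ _ [h1 h2 _]] := pP (k + j)%N.
  by split; [exact: le_trans IH1 h1 | exact: le_trans h2 IH2].
have ub1 k m : (p m).1 <= (p k).1 + w k.
  have [/mono1[_ h]|/ltnW/mono1[h _]] := leqP k m.
    by apply: le_trans h; rewrite lerDl.
  by apply: (le_trans h); rewrite lerDl.
have ub2 k m : (p m).2 <= (p k).2 + l k.
  have [/mono2[_ h]|/ltnW/mono2[h _]] := leqP k m.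
    by apply: le_trans h; rewrite lerDl.
  by apply: (le_trans h); rewrite lerDl.
pose z : R * R := (sup (range (fun k => (p k).1)), sup (range (fun k => (p k).2))).
have z1 k : (p k).1 <= z.1 <= (p k).1 + w k.
  apply/andP; split.
    apply: ub_le_sup; last by exists k.
    by exists ((p 0%N).1 + w 0%N) => _ [m _ <-].
  by apply: ge_sup; [exists (p 0%N).1; exists 0%N | move=> _ [m _ <-]].
have z2 k : (p k).2 <= z.2 <= (p k).2 + l k.
  apply/andP; split.
    apply: ub_le_sup; last by exists k.
    by exists ((p 0%N).2 + l 0%N) => _ [m _ <-].
  by apply: ge_sup; [exists (p 0%N).2; exists 0%N | move=> _ [m _ <-]].
have abz : rect a b c d z.
  have [i1 i2 i3 i4] := pin 0%N; have /andP[j1 j2] := z1 0%N; have /andP[j3 j4] := z2 0%N.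
  split; apply/andP; split.
  - exact: le_trans i1 j1.
  - exact: le_trans j2 i2.
  - exact: le_trans i3 j3.
  - exact: le_trans j4 i4.
have [A [B' [C [dP dQ]]]] := cl z abz.
pose D := Num.max (b - a) (d - c).
have D0 : 0 <= D by rewrite le_max subr_ge0 ab.
pose e := N / (8 * (D ^+ 2 + 1)).
have D21 : 0 < D ^+ 2 + 1 by rewrite ltr_wpDl// sqr_ge0.
have e0 : 0 < e by rewrite divr_gt0// mulr_gt0.
have [d1 d10 d1P] := dP e e0; have [d2 d20 d2P] := dQ e e0.
have [k kP] : exists k, s k * (D + 1) < Num.min d1 d2.
  have md : 0 < Num.min d1 d2 by rewrite lt_min d10.
  have D1 : 0 < D + 1 by rewrite ltr_wpDl.
  have := @near_infty_natSinv_expn_lt R (PosNum (divr_gt0 md D1)) => -[k _ kP].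
  exists k; rewrite -ltr_pdivlMr//; have := kP k (leqnn k).
  by rewrite /s /= div1r.
have wD : w k <= s k * D by rewrite ler_wpM2l ?(ltW (s0 k))// le_max lexx.
have lD : l k <= s k * D by rewrite ler_wpM2l ?(ltW (s0 k))// le_max lexx orbT.
have sub x : rect (p k).1 ((p k).1 + w k) (p k).2 ((p k).2 + l k) x -> rect a b c d x.
  have [i1 i2 i3 i4] := pin k.
  move=> [/= /andP[j1 j2] /andP[j3 j4]]; split => /=; apply/andP; split.
  - exact: le_trans i1 j1.
  - exact: le_trans j2 i2.
  - exact: le_trans i3 j3.
  - exact: le_trans j4 i4.
have := @rint_small P Q z (p k).1 ((p k).1 + w k) (p k).2 ((p k).2 + l k) e (s k * D).
have -> : (p k).1 + w k - (p k).1 = w k by ring.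
have -> : (p k).2 + l k - (p k).2 = l k by ring.
have pw : (p k).1 <= (p k).1 + w k by rewrite lerDl.
have pl : (p k).2 <= (p k).2 + l k by rewrite lerDl.
move=> /(_ pw pl (closed_edge_cont pw pl (fun x xx => cl x (sub x xx)))).
move=> /(_ (conj (z1 k) (z2 k)) (ltW e0) wD lD).
have near x : rect (p k).1 ((p k).1 + w k) (p k).2 ((p k).2 + l k) x ->
    `|x - z| < Num.min d1 d2.
  move=> [/= /andP[j1 j2] /andP[j3 j4]]; apply: le_lt_trans kP.
  apply: (@le_trans _ _ (s k * D)); last by rewrite ler_pM2l// lerDl.
  rewrite prod_norm_le; apply/andP; split.
    by apply: (itv_dist_le _ (z1 k) wD); rewrite j1.
  by apply: (itv_dist_le _ (z2 k) lD); rewrite j3.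
have h : exists A0 B0 C0 : E, forall w0, rect (p k).1 ((p k).1 + w k) (p k).2 ((p k).2 + l k) w0 ->
    `|P w0 - P z - ((w0 - z).1 *: A0 + (w0 - z).2 *: B0)| <= e * `|w0 - z| /\
    `|Q w0 - Q z - ((w0 - z).1 *: B0 + (w0 - z).2 *: C0)| <= e * `|w0 - z|.
  exists A, B', C => x xr; have := near x xr; rewrite lt_min => /andP[x1 x2].
  by have := d1P _ x1; have := d2P _ x2; rewrite (addrC z) subrK; split.
move=> /(_ h) Bk.
have := pB k; apply/negP; rewrite -ltNge.
have k4 : 4 ^+ k * s k ^+ 2 = 1 :> R.
  by rewrite /s exprVn -exprM mulnC exprM (_ : 2 ^+ 2 = 4 :> R) ?divff ?gt_eqF ?exprn_gt0//; ring.
apply: (@le_lt_trans _ _ (4 ^+ k * (4 * e * (s k * D) ^+ 2))).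
  by rewrite ler_wpM2l// exprn_ge0.
have -> : 4 ^+ k * (4 * e * (s k * D) ^+ 2) = (4 ^+ k * s k ^+ 2) * (4 * e * D ^+ 2) by ring.
rewrite k4 mul1r /e; have -> : 4 * (N / (8 * (D ^+ 2 + 1))) * D ^+ 2 =
  N * ((D ^+ 2 / (D ^+ 2 + 1)) / 2) by field; rewrite gt_eqF.
rewrite gtr_pMr// ltr_pdivrMr// mul1r ltr_pdivrMr//.
have DD := sqr_ge0 D; lra.
Qed.

End PlaneForms.

(** * Differential calculus and the angular form *)

Section Increment.
Variables (R : realType) (E : completeNormedModType R).
Implicit Types (P Q : R * R -> E) (z w p q s : R * R).

Lemma rint_swapl P Q a b c d : rint P Q b a c d = - rint P Q a b c d.
Proof. by rewrite /rint /hint !(segint_opp _ a b); zmodule. Qed.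

Lemma rint_swapr P Q a b c d : rint P Q a b d c = - rint P Q a b c d.
Proof. by rewrite /rint /vint !(segint_opp _ c d); zmodule. Qed.

Definition cball z (r : R) : set (R * R) := [set w | `|w - z| <= r].

Lemma cballE z r w : cball z r w =
  ((z.1 - r <= w.1 <= z.1 + r) && (z.2 - r <= w.2 <= z.2 + r)) :> Prop.
Proof. by rewrite /cball /= prod_norm_le !ler_distl. Qed.

Lemma goursat_cball P Q z r a b c d : cball z r (a, c) -> cball z r (b, d) ->
  (forall w, cball z r w -> closedat P Q w) -> rint P Q a b c d = 0.
Proof.
rewrite !cballE /= => /andP[/andP[a1 a2] /andP[c1 c2]] /andP[/andP[b1 b2] /andP[d1 d2]] cl.
have sub a' b' c' d' : z.1 - r <= a' -> b' <= z.1 + r -> z.2 - r <= c' -> d' <= z.2 + r ->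
    forall w, rect a' b' c' d' w -> closedat P Q w.
  move=> ha hb hc hd w [/andP[w1 w2] /andP[w3 w4]]; apply: cl; rewrite cballE.
  by rewrite (le_trans ha)// (le_trans hc)// (le_trans w2)// (le_trans w4).
case: (leP a b) => ab; case: (leP c d) => cd.
- by apply: goursat => //; exact: sub.
- by rewrite rint_swapr goursat ?oppr0 ?(ltW cd)//; exact: sub.
- by rewrite rint_swapl goursat ?oppr0 ?(ltW ab)//; exact: sub.
- by rewrite rint_swapl rint_swapr goursat ?oppr0 ?(ltW ab) ?(ltW cd)//; exact: sub.
Qed.

(** Integral along the L-shaped path from [p] to [q]. *)
Definition incr P Q p q := hint P p.2 p.1 q.1 + vint Q q.1 p.2 q.2.

Lemma cball_ucont P Q z r p : cball z r p ->
  (forall w, cball z r w -> contat P w /\ contat Q w) ->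
  ucont (fun t => P (t, p.2)) (z.1 - r) (z.1 + r) /\
  ucont (fun t => Q (p.1, t)) (z.2 - r) (z.2 + r).
Proof.
rewrite cballE => /andP[p1 p2] PQ; split.
  apply: ucont_horizontal => t tz; apply: (PQ _ _).1.
  by rewrite cballE /= tz p2.
apply: ucont_vertical => t tz; apply: (PQ _ _).2.
by rewrite cballE /= tz p1.
Qed.

Lemma closed_cball_cont P Q z r : (forall w, cball z r w -> closedat P Q w) ->
  forall w, cball z r w -> contat P w /\ contat Q w.
Proof.
move=> cl w /cl cw; split; [exact: closedat_contP cw | exact: closedat_contQ cw].
Qed.

(** The two L-shaped paths differ by the boundary of a rectangle. *)
Lemma incr_add P Q z r p q s : cball z r p -> cball z r q -> cball z r s ->
  (forall w, cball z r w -> closedat P Q w) ->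
  incr P Q p q + incr P Q q s = incr P Q p s.
Proof.
move=> pz qz sz cl; have ct := closed_cball_cont cl.
have [u _] := cball_ucont pz ct; have [_ v] := cball_ucont sz ct.
move: (pz) (qz) (sz); rewrite !cballE.
move=> /andP[p1 p2] /andP[q1 q2] /andP[s1 s2].
have g : rint P Q q.1 s.1 p.2 q.2 = 0.
  by apply: goursat_cball cl; rewrite cballE /= ?q1 ?p2 ?s1 ?q2.
rewrite /incr /hint -(segint_cat u p1 q1 s1) /vint -(segint_cat v p2 q2 s2).
apply/eqP; rewrite -subr_eq0 -oppr0 -[in X in _ == X]g; apply/eqP.
by rewrite /rint /hint /vint; zmodule.
Qed.

Lemma incr_near P Q z r p q (A B : E) (e : R) : cball z r p -> cball z r q ->
  (forall w, cball z r w -> [/\ contat P w, contat Q w, `|P w - A| <= e & `|Q w - B| <= e]) ->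
  `|incr P Q p q - ((q - p).1 *: A + (q - p).2 *: B)|
  <= e * `|(q - p).1| + e * `|(q - p).2|.
Proof.
move=> pz qz PQ; have ct w : cball z r w -> contat P w /\ contat Q w by case/PQ.
have [u _] := cball_ucont pz ct; have [_ v] := cball_ucont qz ct.
move: (pz) (qz); rewrite !cballE => /andP[/andP[p1 p1'] /andP[p2 p2']].
move=> /andP[/andP[q1 q1'] /andP[q2 q2']].
have -> : incr P Q p q - ((q - p).1 *: A + (q - p).2 *: B) =
  (hint P p.2 p.1 q.1 - (q.1 - p.1) *: A) + (vint Q q.1 p.2 q.2 - (q.2 - p.2) *: B).
  by rewrite /incr /=; zmodule.
rewrite (le_trans (ler_normD _ _))//; apply: lerD.
  apply: segint_near_cst.
    by apply: ucont_sub u; rewrite ?le_min ?ge_max ?p1 ?p1' ?q1 ?q1'.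
  move=> t /andP[t1 t2]; have [] // := PQ (t, p.2); rewrite cballE /= p2 p2' !andbT.
  apply/andP; split; first by apply: le_trans t1; rewrite le_min p1.
  by apply: (le_trans t2); rewrite ge_max p1'.
apply: segint_near_cst.
  by apply: ucont_sub v; rewrite ?le_min ?ge_max ?p2 ?p2' ?q2 ?q2'.
move=> t /andP[t1 t2]; have [] // := PQ (q.1, t); rewrite cballE /= q1 q1' /=.
apply/andP; split; first by apply: le_trans t1; rewrite le_min p2.
by apply: (le_trans t2); rewrite ge_max p2'.
Qed.

End Increment.

Section Calculus.
Variables (R : realType).

Lemma diffat_cst (E : completeNormedModType R) (v : E) z : diffat (fun=> v) z 0 0.
Proof.
move=> e e0; exists 1 => // h _.
by rewrite !scaler0 addr0 subrr subr0 normr0 mulr_ge0// ltW.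
Qed.

Lemma diffat_fst z : @diffat R R^o (fun w => w.1) z 1 0.
Proof.
move=> e e0; exists 1 => // h _.
rewrite /= scaler0 addr0 -[_ *: _]/(h.1 * 1) mulr1 (addrC z.1) addrK subrr normr0.
by rewrite mulr_ge0// ltW.
Qed.

Lemma diffat_snd z : @diffat R R^o (fun w => w.2) z 0 1.
Proof.
move=> e e0; exists 1 => // h _.
rewrite /= scaler0 add0r -[_ *: _]/(h.2 * 1) mulr1 (addrC z.2) addrK subrr normr0.
by rewrite mulr_ge0// ltW.
Qed.

Lemma diffatD (E : completeNormedModType R) (f g : R * R -> E) z A B A' B' :
  diffat f z A B -> diffat g z A' B' ->
  diffat (fun w => f w + g w) z (A + A') (B + B').
Proof.
move=> F G e e0; have e2 : 0 < e / 2 by rewrite divr_gt0.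
have [d d0 dP] := F _ e2; have [c c0 cP] := G _ e2.
exists (Num.min d c) => [|h]; first by rewrite lt_min d0.
rewrite lt_min => /andP[hd hc].
have -> : f (z + h) + g (z + h) - (f z + g z) - (h.1 *: (A + A') + h.2 *: (B + B')) =
  (f (z + h) - f z - (h.1 *: A + h.2 *: B)) + (g (z + h) - g z - (h.1 *: A' + h.2 *: B')).
  by rewrite !scalerDr; zmodule.
by rewrite (le_trans (ler_normD _ _))// [e]splitr mulrDl lerD ?dP ?cP.
Qed.

Lemma diffatN (E : completeNormedModType R) (f : R * R -> E) z A B :
  diffat f z A B -> diffat (fun w => - f w) z (- A) (- B).
Proof.
move=> F e e0; have [d d0 dP] := F e e0; exists d => // h /dP.
rewrite -normrN; apply: le_trans; rewrite le_eqVlt; apply/orP; left; apply/eqP.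
by congr `|_|; rewrite !scalerN; zmodule.
Qed.

Lemma diffat_eq (E : completeNormedModType R) (f : R * R -> E) z A B A' B' :
  diffat f z A B -> A = A' -> B = B' -> diffat f z A' B'.
Proof. by move=> F <- <-. Qed.

Section Bilinear.
Variables (E1 E2 E3 : completeNormedModType R) (beta : E1 -> E2 -> E3) (C : R).
Hypothesis betal : forall y, linear (beta^~ y).
Hypothesis betar : forall x, linear (beta x).
Hypothesis beta_le : forall x y, `|beta x y| <= C * `|x| * `|y|.

Lemma bilinDl x x' y : beta (x + x') y = beta x y + beta x' y.
Proof. by have := betal y 1 x x'; rewrite !scale1r. Qed.
Lemma bilinDr x y y' : beta x (y + y') = beta x y + beta x y'.
Proof. by have := betar x 1 y y'; rewrite !scale1r. Qed.
Lemma bilin0l y : beta 0 y = 0.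
Proof. by apply: (addrI (beta 0 y)); rewrite -bilinDl !addr0. Qed.
Lemma bilin0r x : beta x 0 = 0.
Proof. by apply: (addrI (beta x 0)); rewrite -bilinDr !addr0. Qed.
Lemma bilinZl k x y : beta (k *: x) y = k *: beta x y.
Proof. by have := betal y k x 0; rewrite bilin0l !addr0. Qed.
Lemma bilinZr k x y : beta x (k *: y) = k *: beta x y.
Proof. by have := betar x k y 0; rewrite bilin0r !addr0. Qed.
Lemma bilinNl x y : beta (- x) y = - beta x y.
Proof. by rewrite -scaleN1r bilinZl scaleN1r. Qed.
Lemma bilinNr x y : beta x (- y) = - beta x y.
Proof. by rewrite -scaleN1r bilinZr scaleN1r. Qed.

(** The product rule for bounded bilinear maps. *)
Lemma diffat_bilin f g z A B A' B' : diffat f z A B -> diffat g z A' B' ->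
  diffat (fun w => beta (f w) (g w)) z
    (beta A (g z) + beta (f z) A') (beta B (g z) + beta (f z) B').
Proof.
move=> F G e e0.
have [d1 d10 d1P] := diffat_lip F; have [d2 d20 d2P] := diffat_lip G.
set a := `|A| + _ + 1 in d1P; set b := `|A'| + _ + 1 in d2P.
have a0 : 0 <= a by rewrite !addr_ge0.
have b0 : 0 <= b by rewrite !addr_ge0.
pose K := `|C| * (a * b + `|f z| + `|g z|) + 1.
have K0 : 0 < K by rewrite ltr_wpDl// mulr_ge0// !addr_ge0// mulr_ge0.
have eK : 0 < e / K by rewrite divr_gt0.
have [d3 d30 d3P] := F _ eK; have [d4 d40 d4P] := G _ eK.
exists (Num.min (Num.min d1 d2) (Num.min (Num.min d3 d4) (e / K))) => [|h].
  by rewrite !lt_min d10 d20 d30 d40.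
rewrite !lt_min => /andP[/andP[h1 h2] /andP[/andP[h3 h4] h5]].
have := d1P (z + h); have := d2P (z + h); rewrite addrAC subrr add0r.
move=> /(_ h2) G1 /(_ h1) F1; have {h3}F2 := d3P h h3; have {h4}G2 := d4P h h4.
set df := f (z + h) - f z in F1 F2; set dg := g (z + h) - g z in G1 G2.
set rf := df - _ in F2; set rg := dg - _ in G2.
have -> : beta (f (z + h)) (g (z + h)) - beta (f z) (g z) -
   (h.1 *: (beta A (g z) + beta (f z) A') + h.2 *: (beta B (g z) + beta (f z) B')) =
   beta df dg + beta rf (g z) + beta (f z) rg.
  rewrite /rf /rg /df /dg !(bilinDl, bilinDr, bilinNl, bilinNr, bilinZl, bilinZr, scalerDr).
  by zmodule.
have bl x y u v : `|x| <= u -> `|y| <= v -> `|beta x y| <= `|C| * (u * v).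
  move=> xu yv; rewrite (le_trans (beta_le x y))// -mulrA.
  apply: (@le_trans _ _ (`|C| * (`|x| * `|y|))).
    by rewrite ler_wpM2r ?mulr_ge0// ler_norm.
  by rewrite ler_wpM2l// ler_pM.
have t1 := bl _ _ _ _ F1 G1; have t2 := bl _ _ _ _ F2 (lexx `|g z|).
have t3 := bl _ _ _ _ (lexx `|f z|) G2.
rewrite (le_trans (ler_normD _ _))// (le_trans (lerD (ler_normD _ _) (lexx _)))//.
rewrite (le_trans (lerD (lerD t1 t2) t3))//.
have -> : `|C| * (a * `|h| * (b * `|h|)) + `|C| * (e / K * `|h| * `|g z|)
  + `|C| * (`|f z| * (e / K * `|h|)) =
  (`|C| * (a * b * `|h| + (`|f z| + `|g z|) * (e / K))) * `|h| by ring.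
apply: ler_wpM2r => //.
apply: (@le_trans _ _ (`|C| * (a * b * (e / K) + (`|f z| + `|g z|) * (e / K)))).
  apply: ler_wpM2l => //; apply: lerD => //.
  by apply: ler_wpM2l; [exact: mulr_ge0 | exact: ltW].
rewrite -mulrDl addrA mulrA mulrA ler_pdivrMr// mulrC ler_pM2l//.
by rewrite /K lerDl.
Qed.

End Bilinear.

Lemma diffat_lin (E1 E2 : completeNormedModType R) (L : E1 -> E2) C f z A B :
  linear L -> (forall v, `|L v| <= C * `|v|) -> diffat f z A B ->
  diffat (fun w => L (f w)) z (L A) (L B).
Proof.
move=> Llin LC F e e0; have C1 : 0 < `|C| + 1 by rewrite ltr_wpDl.
have [d d0 dP] := F _ (divr_gt0 e0 C1); exists d => // h /dP {}dP.
have LD u v : L (u + v) = L u + L v by have := Llin 1 u v; rewrite !scale1r.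
have L0 : L 0 = 0 by apply: (addrI (L 0)); rewrite -LD !addr0.
have LZ k v : L (k *: v) = k *: L v by have := Llin k v 0; rewrite L0 !addr0.
have LN v : L (- v) = - L v by rewrite -scaleN1r LZ scaleN1r.
have -> : L (f (z + h)) - L (f z) - (h.1 *: L A + h.2 *: L B) =
  L (f (z + h) - f z - (h.1 *: A + h.2 *: B)) by rewrite !(LD, LN, LZ).
rewrite (le_trans (LC _))//.
apply: (@le_trans _ _ ((`|C| + 1) * (e / (`|C| + 1) * `|h|))).
  apply: (@le_trans _ _ (`|C| * `|f (z + h) - f z - (h.1 *: A + h.2 *: B)|)).
    by rewrite ler_wpM2r// ler_norm.
  by apply: ler_pM => //; rewrite lerDl.
by rewrite mulrA mulrCA divff ?mulr1 ?gt_eqF.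
Qed.

(** The chain rule for a map that is linear up to a quadratic error. *)
Lemma diffat_quadratic (E1 E2 : completeNormedModType R) (L : E1 -> E2) C K r
    (g : R * R -> E1) (u : R * R -> E2) z A B :
  linear L -> (forall v, `|L v| <= C * `|v|) -> 0 < r ->
  (forall w, `|w - z| < r -> `|u w - u z - L (g w - g z)| <= K * `|g w - g z| ^+ 2) ->
  diffat g z A B -> diffat u z (L A) (L B).
Proof.
move=> Llin LC r0 uP G e e0; have e2 : 0 < e / 2 by rewrite divr_gt0.
have [d1 d10 d1P] := diffat_lip G; set a := `|A| + `|B| + 1 in d1P.
have a0 : 0 < a by rewrite ltr_wpDl// addr_ge0.
have [d2 d20 d2P] := diffat_lin Llin LC G e2.
have K1 : 0 < `|K| + 1 by rewrite ltr_wpDl.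
pose t := e / 2 / ((`|K| + 1) * a ^+ 2).
have t0 : 0 < t by rewrite divr_gt0// mulr_gt0// exprn_gt0.
exists (Num.min (Num.min d1 d2) (Num.min r t)) => [|h].
  by rewrite !lt_min d10 d20 r0.
rewrite !lt_min => /andP[/andP[h1 h2] /andP[hr ht]].
have := uP (z + h); have := d1P (z + h); rewrite addrAC subrr add0r.
move=> /(_ h1) G1 /(_ hr) U1; have {d2P}h2 := d2P h h2.
have LB x y : L (x - y) = L x - L y.
  by rewrite addrC -scaleN1r Llin scaleN1r addrC.
have -> : u (z + h) - u z - (h.1 *: L A + h.2 *: L B) =
  (u (z + h) - u z - L (g (z + h) - g z))
  + (L (g (z + h)) - L (g z) - (h.1 *: L A + h.2 *: L B)) by rewrite LB; zmodule.
rewrite (le_trans (ler_normD _ _))// [e]splitr mulrDl lerD// (le_trans U1)//.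
apply: (@le_trans _ _ ((`|K| + 1) * (a * `|h|) ^+ 2)).
  apply: (@le_trans _ _ ((`|K| + 1) * `|g (z + h) - g z| ^+ 2)).
    by rewrite ler_wpM2r ?exprn_ge0// (le_trans (ler_norm K))// lerDl.
  by rewrite ler_wpM2l ?(ltW K1)// lerXn2r// nnegrE ?mulr_ge0// ltW.
have -> : (`|K| + 1) * (a * `|h|) ^+ 2 = (`|h| * ((`|K| + 1) * a ^+ 2)) * `|h| by ring.
apply: ler_wpM2r => //; rewrite -ler_pdivlMr; first exact: ltW.
by rewrite mulr_gt0// exprn_gt0.
Qed.

Lemma diffat_shift (E : completeNormedModType R) (g : R * R -> E) p z A B :
  diffat g (z - p) A B -> diffat (fun w => g (w - p)) z A B.
Proof.
move=> G e e0; have [d d0 dP] := G e e0; exists d => // h /dP.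
by rewrite (addrAC z).
Qed.

Lemma linear_mulro (k : R) : linear (fun v : R^o => k * v : R^o).
Proof. by move=> a u v; rewrite mulrDr -[a *: u]/(a * u) mulrCA. Qed.

Lemma diffat_mulr (f g : R * R -> R^o) z (a b a' b' : R^o) :
  diffat f z a b -> diffat g z a' b' ->
  diffat (fun w => f w * g w : R^o) z (a * g z + f z * a') (b * g z + f z * b').
Proof.
apply: (@diffat_bilin R^o R^o R^o (fun x y => x * y) 1).
- by move=> y k u v /=; rewrite mulrDl -[k *: u]/(k * u) -mulrA.
- by move=> x; exact: linear_mulro.
- by move=> x y; rewrite mul1r normrM.
Qed.

(** 1/s is linear in s up to a quadratic error. *)
Lemma diffat_invr (s : R * R -> R^o) z (a b : R^o) : s z != 0 -> diffat s z a b ->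
  diffat (fun w => (s w)^-1 : R^o) z (- (s z) ^- 2 * a) (- (s z) ^- 2 * b).
Proof.
move=> sz S; have nz : 0 < `|s z| by rewrite normr_gt0.
have [r r0 rP] := diffat_cont S (divr_gt0 nz (ltr0n R 2)).
apply: (@diffat_quadratic R^o R^o (fun v => - (s z) ^- 2 * v) `|- (s z) ^- 2|
  (2 * `|s z| ^- 3) r s _ _ _ _ _ _ r0 _ S).
- exact: linear_mulro.
- by move=> v; rewrite normrM.
move=> w /rP sw; have nw : `|s z| / 2 <= `|s w|.
  have := ler_distD (s w) (s z) 0; rewrite !subr0 distrC => h; lra.
have w0 : s w != 0 by rewrite -normr_gt0; apply: lt_le_trans nw; rewrite divr_gt0.
have -> : (s w)^-1 - (s z)^-1 - - (s z) ^- 2 * (s w - s z) =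
  (s w - s z) ^+ 2 / (s w * s z ^+ 2) by field; rewrite sz w0.
rewrite normrM normrX mulrC; apply: ler_wpM2r; first by rewrite exprn_ge0.
rewrite normfV normrM normrX.
have -> : 2 * `|s z| ^- 3 = (`|s z| / 2 * `|s z| ^+ 2)^-1 by field; rewrite gt_eqF.
rewrite lef_pV2 ?posrE ?mulr_gt0 ?exprn_gt0 ?normr_gt0//.
by rewrite ler_wpM2r// exprn_ge0.
Qed.

Definition sqnorm (w : R * R) : R := w.1 * w.1 + w.2 * w.2.

Lemma sqnorm_eq0 w : (sqnorm w == 0) = (w == 0).
Proof.
rewrite /sqnorm -!expr2 paddr_eq0 ?sqr_ge0// !sqrf_eq0.
by case: w => x y /=; apply/idP/idP => [/andP[/eqP-> /eqP->]|/eqP[-> ->]]; rewrite ?eqxx.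
Qed.

Definition invsq w : R^o := (sqnorm w)^-1.

Lemma diffat_invsq z : z != 0 ->
  diffat invsq z (- invsq z ^+ 2 * (2 * z.1)) (- invsq z ^+ 2 * (2 * z.2)).
Proof.
move=> z0; have S : @diffat R R^o sqnorm z (2 * z.1) (2 * z.2).
  have h := diffatD (diffat_mulr (diffat_fst z) (diffat_fst z))
                    (diffat_mulr (diffat_snd z) (diffat_snd z)).
  by apply: diffat_eq h _ _; ring.
have := diffat_invr (_ : sqnorm z != 0) S; rewrite sqnorm_eq0 => /(_ z0) h.
by apply: diffat_eq h _ _; rewrite /invsq exprVn.
Qed.

(** The coefficients of the differential of the argument of w - p. *)
Definition argP (p w : R * R) : R^o := - ((w - p).2 * invsq (w - p)).
Definition argQ (p w : R * R) : R^o := (w - p).1 * invsq (w - p).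

Lemma dargE p w h : darg p w h = h.1 * argP p w + h.2 * argQ p w.
Proof. by rewrite /darg /argP /argQ /invsq /sqnorm -!expr2; ring. Qed.

Lemma closedat_arg p w : w != p -> closedat (argP p) (argQ p) w.
Proof.
rewrite -subr_eq0 => wp; have I := diffat_invsq wp.
have P := diffat_mulr (diffat_snd (w - p)) I.
have Q := diffat_mulr (diffat_fst (w - p)) I.
have {P}N := diffat_shift (diffatN P); move/diffat_shift : Q => Q.
have key : invsq (w - p) = invsq (w - p) ^+ 2 * sqnorm (w - p).
  by rewrite expr2 -mulrA mulVf ?mulr1// sqnorm_eq0.
do 3 eexists; split; first exact: N.
apply: diffat_eq Q _ _; last by [].
apply/eqP; rewrite -subr_eq0; apply/eqP; rewrite /sqnorm in key.
transitivity (2 * (invsq (w - p) - invsq (w - p) ^+ 2 *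
  ((w - p).1 * (w - p).1 + (w - p).2 * (w - p).2)) : R); first by ring.
by rewrite -key subrr mulr0.
Qed.

Lemma closedat_ucont_arg p a b y : (forall t, a <= t <= b -> (t, y) != p) ->
  ucont (fun t => argP p (t, y)) a b.
Proof.
move=> h; apply: ucont_horizontal => t tab; apply: closedat_contP.
exact: closedat_arg (h t tab).
Qed.

(** A side of a square is seen from its centre under a right angle. *)
Lemma segint_right_angle (s m : R) : 0 < s ->
  segint (fun t => s / ((t - m) ^+ 2 + s ^+ 2) : R^o) (m - s) (m + s) = pi / 2.
Proof.
move=> s0; have sn : s != 0 by rewrite gt_eqF.
have dn t : (t - m) ^+ 2 + s ^+ 2 != 0.
  by rewrite gt_eqF// ltr_wpDl ?sqr_ge0// exprn_gt0.
have uc a b : ucont (fun t => s / ((t - m) ^+ 2 + s ^+ 2) : R^o) a b.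
  have -> : (fun t : R => s / ((t - m) ^+ 2 + s ^+ 2) : R^o) =
            (fun t => argP (m, 0) (t, - s)).
    apply/funext => t; rewrite /argP /invsq /sqnorm /= subr0 -!expr2 sqrrN.
    by rewrite mulNr opprK.
  apply: closedat_ucont_arg => t _; apply/eqP => -[_ /eqP].
  by rewrite oppr_eq0 (negPf sn).
transitivity (atan ((m + s - m) / s) - atan ((m - s - m) / s)); last first.
  rewrite (addrAC m s) (addrAC m (- s)) subrr !add0r mulNr divff// atanN atan1.
  by field.
apply: (@segint_ftc R (fun t => s / ((t - m) ^+ 2 + s ^+ 2)) (fun t => atan ((t - m) / s))).
  exact: uc.
move=> x.
have D : is_derive x 1 (fun t : R => (t - m) / s) (s^-1 : R).
  have -> : (fun t : R => (t - m) / s) = s^-1 *: ((id : R -> R) - cst m).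
    by apply/funext => t; exact: mulrC.
  apply: is_derive_eq.
  by rewrite subr0 -[_ *: _]/(s^-1 * 1) mulr1.
have := @is_derive1_comp _ (@atan R) _ x _ _ (is_derive1_atan ((x - m) / s)) D.
have -> : (1 + ((x - m) / s) ^+ 2)^-1 * s^-1 = s / ((x - m) ^+ 2 + s ^+ 2).
  have nz : s ^+ 2 + (x - m) ^+ 2 != 0 by rewrite addrC.
  by field; rewrite ?sn ?dn ?nz ?andbT.
by [].
Qed.

(** The boundary of a square winds once around its centre: four right angles. *)
Lemma rint_arg_square (s : R) p : 0 < s ->
  rint (argP p) (argQ p) (p.1 - s) (p.1 + s) (p.2 - s) (p.2 + s) = 2 * pi.
Proof.
move=> s0; have sn : s != 0 by rewrite gt_eqF.
pose phi m t : R^o := s / ((t - m) ^+ 2 + s ^+ 2).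
have uc m a b : ucont (phi m) a b.
  have -> : phi m = (fun t => argP (m, 0) (t, - s)).
    apply/funext => t; rewrite /phi /argP /invsq /sqnorm /= subr0 -!expr2 sqrrN.
    by rewrite mulNr opprK.
  apply: closedat_ucont_arg => t _; apply/eqP => -[_ /eqP].
  by rewrite oppr_eq0 (negPf sn).
have opp m a b : segint (fun t => - phi m t) a b = - segint (phi m) a b.
  apply: (@segint_lin R R^o R^o (fun v => - v) 1) => //.
    by move=> k u v; rewrite opprD scalerN.
  by move=> v; rewrite normrN mul1r.
rewrite /rint /hint /vint.
have -> : (fun t => argP p (t, p.2 - s)) = phi p.1.
  apply/funext => t; rewrite /phi /argP /invsq /sqnorm /=.
  by rewrite (addrAC p.2) subrr add0r -!expr2 sqrrN mulNr opprK.
have -> : (fun t => argP p (t, p.2 + s)) = (fun t => - phi p.1 t).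
  apply/funext => t; rewrite /phi /argP /invsq /sqnorm /=.
  by rewrite (addrAC p.2) subrr add0r -!expr2.
have -> : (fun t => argQ p (p.1 + s, t)) = phi p.2.
  apply/funext => t; rewrite /phi /argQ /invsq /sqnorm /=.
  by rewrite (addrAC p.1) subrr add0r -!expr2 addrC.
have -> : (fun t => argQ p (p.1 - s, t)) = (fun t => - phi p.2 t).
  apply/funext => t; rewrite /phi /argQ /invsq /sqnorm /=.
  by rewrite (addrAC p.1) subrr add0r -!expr2 sqrrN mulNr addrC.
rewrite !opp !segint_right_angle//; by field.
Qed.

End Calculus.

(** Summing along the bottom row and then up a column; closedness makes the
    horizontal differences right on the other rows. *)
Lemma lattice_potential (M : zmodType) (H V : nat -> nat -> M) n :
  (forall i j, (i < n)%N -> (j < n)%N -> H i j + V i.+1 j = H i j.+1 + V i j) ->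
  exists Psi : nat -> nat -> M,
    (forall i j, (i < n)%N -> (j <= n)%N -> Psi i.+1 j - Psi i j = H i j) /\
    (forall i j, (j < n)%N -> Psi i j.+1 - Psi i j = V i j).
Proof.
move=> cl; pose Psi i j := \sum_(k < i) H k 0%N + \sum_(k < j) V i k.
have PV i j : Psi i j.+1 - Psi i j = V i j.
  by rewrite /Psi big_ord_recr /=; zmodule.
exists Psi; split => // i j ni; elim: j => [_|j IH jn].
  by rewrite /Psi !big_ord0 big_ord_recr /=; zmodule.
have -> : Psi i.+1 j.+1 - Psi i j.+1 =
  (Psi i.+1 j.+1 - Psi i.+1 j) + (Psi i.+1 j - Psi i j) - (Psi i j.+1 - Psi i j).
  by zmodule.
rewrite !PV (IH (ltnW jn)) (addrC (V _ _)) cl//; zmodule.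
Qed.

(** * Line integrals and lattice cochains *)

Section ClosedForms.
Variables (R : realType) (E : completeNormedModType R).
Implicit Types (P Q : R * R -> E) (z w : R * R).

Lemma closedatD P Q P' Q' z : closedat P Q z -> closedat P' Q' z ->
  closedat (fun w => P w + P' w) (fun w => Q w + Q' w) z.
Proof.
move=> [A [B [C [p q]]]] [A' [B' [C' [p' q']]]].
by exists (A + A'), (B + B'), (C + C'); split; exact: diffatD.
Qed.

Lemma closedat_cst (u v : E) z : closedat (fun=> u) (fun=> v) z.
Proof. by exists 0, 0, 0; split; exact: diffat_cst. Qed.

Lemma closedat_sum (I : Type) (s : seq I) (F G : I -> R * R -> E) z :
  (forall i, closedat (F i) (G i) z) ->
  closedat (fun w => \sum_(i <- s) F i w) (fun w => \sum_(i <- s) G i w) z.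
Proof.
move=> cl; elim: s => [|i s IH].
  have -> : (fun w => \sum_(i <- [::]) F i w) = (fun=> 0).
    by apply/funext => w; rewrite big_nil.
  have -> : (fun w => \sum_(i <- [::]) G i w) = (fun=> 0).
    by apply/funext => w; rewrite big_nil.
  exact: closedat_cst.
have -> : (fun w => \sum_(i <- i :: s) F i w) = (fun w => F i w + \sum_(i <- s) F i w).
  by apply/funext => w; rewrite big_cons.
have -> : (fun w => \sum_(i <- i :: s) G i w) = (fun w => G i w + \sum_(i <- s) G i w).
  by apply/funext => w; rewrite big_cons.
exact: closedatD.
Qed.

Lemma linear_scalev (m : E) : linear (fun k : R^o => k *: m).
Proof. by move=> k u v; rewrite scalerDl -[k *: u]/(k * u) scalerA. Qed.

Lemma norm_scalev_le (m : E) (k : R^o) : `|k *: m| <= `|m| * `|k|.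
Proof. by rewrite normrZ mulrC. Qed.

Lemma closedat_scalev (p q : R * R -> R^o) (m : E) z : closedat p q z ->
  closedat (fun w => p w *: m) (fun w => q w *: m) z.
Proof.
move=> [A [B [C [dp dq]]]]; exists (A *: m), (B *: m), (C *: m).
by split; [exact: (diffat_lin (linear_scalev m) (norm_scalev_le m) dp)
          | exact: (diffat_lin (linear_scalev m) (norm_scalev_le m) dq)].
Qed.

Lemma ucontD (f g : R -> E) x0 x1 : ucont f x0 x1 -> ucont g x0 x1 ->
  ucont (fun t => f t + g t) x0 x1.
Proof.
move=> uf ug r r0; have r2 : 0 < r / 2 by rewrite divr_gt0.
have [d1 d10 d1P] := uf _ r2; have [d2 d20 d2P] := ug _ r2.
exists (Num.min d1 d2) => [|x y hx hy]; first by rewrite lt_min d10.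
rewrite lt_min => /andP[xy1 xy2].
have -> : f x + g x - (f y + g y) = (f x - f y) + (g x - g y) by zmodule.
by rewrite (le_trans (ler_normD _ _))// [r]splitr lerD ?d1P ?d2P.
Qed.

Lemma ucont_lin (E' : completeNormedModType R) (L : E' -> E) C (f : R -> E') x0 x1 :
  linear L -> (forall v, `|L v| <= C * `|v|) -> ucont f x0 x1 ->
  ucont (fun t => L (f t)) x0 x1.
Proof.
move=> Llin LC uf r r0; have C1 : 0 < `|C| + 1 by rewrite ltr_wpDl.
have [d d0 dP] := uf _ (divr_gt0 r0 C1); exists d => // x y hx hy xy.
have -> : L (f x) - L (f y) = L (f x - f y).
  by rewrite -scaleN1r addrC -Llin scaleN1r addrC.
rewrite (le_trans (LC _))//; apply: (@le_trans _ _ ((`|C| + 1) * (r / (`|C| + 1)))).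
  apply: (@le_trans _ _ (`|C| * `|f x - f y|)); first by rewrite ler_wpM2r// ler_norm.
  by apply: ler_pM => //; [rewrite lerDl | exact: dP].
by rewrite mulrCA divff ?mulr1 ?gt_eqF.
Qed.

Lemma ucont_cst (v : E) a b : ucont (fun=> v) a b.
Proof. by move=> e e0; exists 1 => // x y _ _ _; rewrite subrr normr0 ltW. Qed.

Lemma ucont_sum (I : Type) (s : seq I) (f : I -> R -> E) a b :
  (forall i, ucont (f i) a b) -> ucont (fun t => \sum_(i <- s) f i t) a b.
Proof.
move=> u; elim: s => [|i s IH].
  have -> : (fun t => \sum_(i <- [::]) f i t) = (fun=> 0).
    by apply/funext => w; rewrite big_nil.
  exact: ucont_cst.
have -> : (fun t => \sum_(i <- i :: s) f i t) = (fun t => f i t + \sum_(i <- s) f i t).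
  by apply/funext => w; rewrite big_cons.
exact: ucontD.
Qed.

Lemma segint_sum (I : Type) (s : seq I) (f : I -> R -> E) a b :
  (forall i, ucont (f i) (Num.min a b) (Num.max a b)) ->
  segint (fun t => \sum_(i <- s) f i t) a b = \sum_(i <- s) segint (f i) a b.
Proof.
move=> u; elim: s => [|i s IH].
  have -> : (fun t => \sum_(i <- [::]) f i t) = (fun=> 0).
    by apply/funext => w; rewrite big_nil.
  rewrite big_nil; apply/eqP; rewrite -normr_le0 -(mul0r `|b - a|).
  by apply: segint_le => [|x _]; [exact: ucont_cst | rewrite normr0].
have -> : (fun t => \sum_(i <- i :: s) f i t) = (fun t => f i t + \sum_(i <- s) f i t).
  by apply/funext => w; rewrite big_cons.
by rewrite segintD// ?IH ?big_cons//; exact: ucont_sum.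
Qed.

End ClosedForms.

Section LineIntegrals.
Variables (R : realType) (E : normedModType R).
Implicit Types (w : R * R -> R * R -> E) (g : R -> R * R).

Notation LI := (is_line_integral (@Num.norm R E)).

Lemma line_integralD w1 w2 g J1 J2 : LI w1 g J1 -> LI w2 g J2 ->
  LI (fun p h => w1 p h + w2 p h) g (J1 + J2).
Proof.
move=> L1 L2 e e0; have e2 : 0 < e / 2 by rewrite divr_gt0.
have [d1 d10 d1P] := L1 _ e2; have [d2 d20 d2P] := L2 _ e2.
exists (Num.min d1 d2) => [|s tau ps mesh]; first by rewrite lt_min d10.
have m1 k : (k < size s)%N -> node s k.+1 - node s k < d1 /\ node s k <= tau k <= node s k.+1.
  by move=> /mesh[]; rewrite lt_min => /andP[].
have m2 k : (k < size s)%N -> node s k.+1 - node s k < d2 /\ node s k <= tau k <= node s k.+1.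
  by move=> /mesh[]; rewrite lt_min => /andP[].
have := d1P s tau ps m1; have := d2P s tau ps m2; rewrite big_split /=.
set S1 := \sum_(k < _) w1 _ _; set S2 := \sum_(k < _) w2 _ _ => h2 h1.
have -> : S1 + S2 - (J1 + J2) = (S1 - J1) + (S2 - J2) by zmodule.
by rewrite (le_lt_trans (ler_normD _ _))// [e]splitr ltrD.
Qed.

Lemma line_integral_cst0 g : LI (fun _ _ => 0) g 0.
Proof. by move=> e e0; exists 1 => // s tau _ _; rewrite big1// subrr normr0. Qed.

Lemma line_integral_sum (I : Type) (s : seq I) (w : I -> R * R -> R * R -> E) g J :
  (forall i, LI (w i) g (J i)) ->
  LI (fun p h => \sum_(i <- s) w i p h) g (\sum_(i <- s) J i).
Proof.
move=> L; elim: s => [|i s IH].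
  have -> : (fun p h => \sum_(i <- [::]) w i p h) = (fun _ _ => 0).
    by apply/funext => p; apply/funext => h; rewrite big_nil.
  by rewrite big_nil; exact: line_integral_cst0.
have -> : (fun p h => \sum_(i <- i :: s) w i p h) =
          (fun p h => w i p h + \sum_(i <- s) w i p h).
  by apply/funext => p; apply/funext => h; rewrite big_cons.
by rewrite big_cons; exact: line_integralD.
Qed.

Lemma line_integral_scalev (w : R * R -> R * R -> R) g (k : R) (m : E) :
  is_line_integral Num.norm w g k -> LI (fun p h => w p h *: m) g (k *: m).
Proof.
move=> L e e0; have m1 : 0 < `|m| + 1 by rewrite ltr_wpDl.
have [d d0 dP] := L _ (divr_gt0 e0 m1); exists d => // s tau ps mesh.
have {dP} := dP s tau ps mesh; rewrite -scaler_suml -scalerBl normrZ => h.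
apply: (@le_lt_trans _ _ (`|\sum_(k < size s) w (g (tau k)) (g (node s k.+1) - g (node s k)) - k| * (`|m| + 1))).
  by apply: ler_wpM2l => //; rewrite lerDl.
by rewrite -ltr_pdivlMr.
Qed.

Lemma node_itv (s : seq R) k : itv_partition 0 1 s -> (k <= size s)%N ->
  0 <= node s k <= 1.
Proof.
move=> ps ks; rewrite /node.
by rewrite itv_partition_nth_ge// itv_partition_nth_le.
Qed.

Lemma node0 (s : seq R) : node s 0 = 0. Proof. by []. Qed.

Lemma node_size (s : seq R) : itv_partition 0 1 s -> node s (size s) = 1.
Proof. exact: itv_partition_nth_size. Qed.

Lemma prod_norm_le_plane (p : R * R) : `|p| <= plane_norm p.
Proof.
rewrite prod_norm_le /plane_norm; apply/andP; split.
  by rewrite -sqrtr_sqr ler_wsqrtr// lerDl sqr_ge0.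
by rewrite -sqrtr_sqr ler_wsqrtr// lerDr sqr_ge0.
Qed.

(** The Riemann-Stieltjes sums telescope, up to an error that is small relative
    to the length of the curve. *)
Lemma line_integral_exact w g (G : R * R -> E) : g 0 = g 1 -> rectifiable g ->
  (forall e : R, 0 < e -> exists2 d : R, 0 < d & forall a t b,
     0 <= a -> a <= t -> t <= b -> b <= 1 -> b - a < d ->
     `|w (g t) (g b - g a) - (G (g b) - G (g a))| <= e * `|g b - g a|) ->
  LI w g 0.
Proof.
move=> g01 [L LP] wG e e0; have L1 : 0 < `|L| + 1 by rewrite ltr_wpDl.
have [d d0 dP] := wG _ (divr_gt0 e0 L1); exists d => // s tau ps mesh.
have tel : \sum_(k < size s) (G (g (node s k.+1)) - G (g (node s k))) = 0.
  rewrite -(big_mkord xpredT (fun k => G (g (node s k.+1)) - G (g (node s k)))).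
  by rewrite telescope_sumr// node_size// node0 g01 subrr.
rewrite subr0 -[X in `|X|]subr0 -[X in _ - X]tel -sumrB.
apply: (le_lt_trans (ler_norm_sum _ _ _)).
apply: (@le_lt_trans _ _ (\sum_(k < size s) e / (`|L| + 1) *
    plane_norm (g (node s k.+1) - g (node s k)))).
  apply: ler_sum => k _; have [kd /andP[k1 k2]] := mesh k (ltn_ord k).
  have /andP[n0 _] := node_itv ps (ltnW (ltn_ord k)).
  have /andP[_ n1] := node_itv ps (ltn_ord k).
  apply: (le_trans (dP _ _ _ n0 k1 k2 n1 kd)).
  by apply: ler_wpM2l; [rewrite divr_ge0// ltW | exact: prod_norm_le_plane].
rewrite -mulr_sumr; apply: (@le_lt_trans _ _ (e / (`|L| + 1) * `|L|)).
  apply: ler_wpM2l; first by rewrite divr_ge0// ltW.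
  by apply: le_trans (ler_norm L); exact: LP.
by rewrite mulrAC -mulrA gtr_pMr// ltr_pdivrMr// mul1r ltrDl.
Qed.

End LineIntegrals.

Section Grid.
Variable R : realType.
Implicit Types (c h : R).

Definition grid c h (i : nat) : R := - c + i%:R * h.
Definition centre c h k l : R * R := (grid c h k + h / 2, grid c h l + h / 2).

Lemma gridS c h i : grid c h i.+1 = grid c h i + h.
Proof. by rewrite /grid -natr1; ring. Qed.

Lemma grid_le c h i j : 0 <= h -> (i <= j)%N -> grid c h i <= grid c h j.
Proof. by move=> h0 ij; rewrite lerD2l ler_wpM2r// ler_nat. Qed.

(** The differential of a cochain on the face with lower left corner (i, j). *)
Definition dface (M : zmodType) (H V : nat -> nat -> M) i j : M :=
  H i j + V i.+1 j - H i j.+1 - V i j.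

(** The integrals of the angular form around the centre of the face (k, l) along
    the lattice edges. *)
Definition argH c h k l i j : R^o :=
  hint (argP (centre c h k l)) (grid c h j) (grid c h i) (grid c h i.+1).
Definition argV c h k l i j : R^o :=
  vint (argQ (centre c h k l)) (grid c h i) (grid c h j) (grid c h j.+1).

Lemma centre_between c h k i t : 0 < h ->
  grid c h i <= t <= grid c h i.+1 -> t = grid c h k + h / 2 -> i = k.
Proof.
move=> h0 /andP[it ti] tk; apply/eqP; rewrite eqn_leq; apply/andP; split.
  rewrite leqNgt; apply/negP => /(grid_le c (ltW h0)); rewrite gridS => ki; lra.
by rewrite leqNgt; apply/negP => /(grid_le c (ltW h0)) ki; lra.
Qed.

Lemma centre_off_grid c h k i : 0 < h -> grid c h i != grid c h k + h / 2.
Proof.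
move=> h0; apply/eqP => e.
have := @centre_between c h k i (grid c h i) h0; rewrite lexx gridS lerDl (ltW h0).
move=> /(_ isT e) ik; move: e; rewrite ik => /eqP.
by rewrite -subr_eq0 opprD addrA subrr sub0r oppr_eq0 gt_eqF// divr_gt0.
Qed.

(** The angular forms around the centres of the faces are a dual basis for the
    faces, up to the factor 2 pi. *)
Lemma dface_arg c h k l i j : 0 < h ->
  dface (argH c h k l) (argV c h k l) i j = if (i == k) && (j == l) then 2 * pi else 0.
Proof.
move=> h0; rewrite -[LHS]/(rint (argP (centre c h k l)) (argQ (centre c h k l))
  (grid c h i) (grid c h i.+1) (grid c h j) (grid c h j.+1)).
case: ifPn => [/andP[/eqP-> /eqP->]|ijkl].
  have h2 : 0 < h / 2 by rewrite divr_gt0.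
  have hh t : t + h / 2 + h / 2 = t + h by rewrite -addrA -splitr.
  by have := rint_arg_square (centre c h k l) h2; rewrite /= !addrK !hh -!gridS.
apply: goursat; rewrite ?gridS ?lerDl ?(ltW h0)// => z; rewrite -!gridS => -[z1 z2].
apply: closedat_arg; apply: contraNneq ijkl => e.
move: z1 z2; rewrite e /= => z1 z2.
by rewrite (centre_between h0 z1 erefl) (centre_between h0 z2 erefl) !eqxx.
Qed.

End Grid.

(** * Line integrals of closed forms as lattice sums *)

Section CurveOnGrid.
Variables (R : realType) (E : completeNormedModType R) (P Q : R * R -> E).
Variables (O : set (R * R)) (g : R -> R * R) (c h : R) (n : nat).
Variables (etaH etaV : nat -> nat -> E) (kappa : nat -> nat -> R).
Hypothesis h0 : 0 < h.
Hypothesis clO : forall z, O z -> closedat P Q z.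
Hypothesis g_cont : forall t : R, 0 <= t <= 1 -> forall e : R, 0 < e ->
  exists2 d : R, 0 < d & forall s : R, 0 <= s <= 1 -> `|s - t| < d -> `|g s - g t| < e.
Hypothesis g_closed : g 0 = g 1.
Hypothesis g_rect : rectifiable g.
Hypothesis g_in : forall (t : R) w, 0 <= t <= 1 -> cball (g t) (4 * h) w -> O w.
Hypothesis g_box : forall (t : R) w, 0 <= t <= 1 -> cball (g t) (4 * h) w ->
  - c <= w.1 <= grid c h n /\ - c <= w.2 <= grid c h n.
Hypothesis etaH_in : forall i j,
  (forall t, grid c h i <= t <= grid c h i.+1 -> O (t, grid c h j)) ->
  etaH i j = hint P (grid c h j) (grid c h i) (grid c h i.+1).
Hypothesis etaV_in : forall i j,
  (forall t, grid c h j <= t <= grid c h j.+1 -> O (grid c h i, t)) ->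
  etaV i j = vint Q (grid c h i) (grid c h j) (grid c h j.+1).
Hypothesis kappaP : forall k l, (k < n)%N -> (l < n)%N ->
  dface etaH etaV k l != 0 ->
  is_line_integral Num.norm (darg (centre c h k l)) g (kappa k l).

Let x i := grid c h i.
Let m (kl : 'I_n * 'I_n) : E := - ((2 * pi)^-1 *: dface etaH etaV kl.1 kl.2).
Let aP (kl : 'I_n * 'I_n) := argP (centre c h kl.1 kl.2).
Let aQ (kl : 'I_n * 'I_n) := argQ (centre c h kl.1 kl.2).

(** Subtracting the right multiples of the angular forms around the centres of
    the faces kills all the periods. *)
Let P' z := P z + \sum_(kl : 'I_n * 'I_n) aP kl z *: m kl.
Let Q' z := Q z + \sum_(kl : 'I_n * 'I_n) aQ kl z *: m kl.
Let H' i j := etaH i j + \sum_(kl : 'I_n * 'I_n) (argH c h kl.1 kl.2 i j : R) *: m kl.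
Let V' i j := etaV i j + \sum_(kl : 'I_n * 'I_n) (argV c h kl.1 kl.2 i j : R) *: m kl.

(** By Goursat only a face that leaves the domain of closedness can have a
    nonzero defect. *)
Lemma face_not_in k l : dface etaH etaV k l != 0 ->
  exists2 q, ~ O q & `|q - centre c h k l| <= h / 2.
Proof.
move=> d0; apply: contrapT => no; case/eqP: d0.
have inO q : rect (x k) (x k.+1) (x l) (x l.+1) q -> O q.
  move=> [q1 q2]; apply: contrapT => Oq; apply: no; exists q => //.
  move: q1 q2; rewrite /x !gridS => /andP[q1 q1'] /andP[q2 q2'].
  by rewrite prod_norm_le !ler_norml /=; apply/andP; split; apply/andP; split; lra.
have xx i : x i <= x i.+1 by rewrite /x gridS lerDl ltW.
rewrite /dface etaH_in; last by move=> t tk; apply: inO; rewrite /rect/= tk lexx xx.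
rewrite etaV_in; last by move=> t tk; apply: inO; rewrite /rect/= tk lexx xx.
rewrite etaH_in; last by move=> t tk; apply: inO; rewrite /rect/= tk lexx xx.
rewrite etaV_in; last by move=> t tk; apply: inO; rewrite /rect/= tk lexx xx.
by apply: goursat => // z /inO /clO.
Qed.

Lemma cball_trans (z w v : R * R) r s : cball z r w -> cball w s v -> cball z (r + s) v.
Proof.
by move=> zw wv; rewrite /cball /= (le_trans (ler_distD w _ _))// addrC lerD.
Qed.

Lemma cball_le (z w : R * R) (r s : R) : r <= s -> cball z r w -> cball z s w.
Proof. by move=> rs zw; apply: le_trans zw rs. Qed.

Lemma closed_reduced t w : 0 <= t <= 1 -> cball (g t) (3 * h) w -> closedat P' Q' w.
Proof.
move=> t01 wt; apply: closedatD.
  by apply: clO; apply: g_in t01 (cball_le _ wt); rewrite ler_pM2r// ler_nat.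
apply: closedat_sum => kl.
have [m0|m0] := eqVneq (m kl) 0.
  rewrite m0 (_ : (fun w => aP kl w *: 0) = fun=> 0); last first.
    by apply/funext => z; rewrite scaler0.
  rewrite (_ : (fun w => aQ kl w *: 0) = fun=> 0); last first.
    by apply/funext => z; rewrite scaler0.
  exact: closedat_cst.
apply: closedat_scalev; apply: closedat_arg; apply/eqP => wc.
have /face_not_in[q Oq qc] : dface etaH etaV kl.1 kl.2 != 0.
  by apply: contraNneq m0; rewrite /m => ->; rewrite scaler0 oppr0.
apply: Oq; apply: g_in t01 _; rewrite -wc in qc.
apply: cball_le (cball_trans wt qc).
have hh : 0 <= h by exact: ltW.
lra.
Qed.

Lemma reduced_cochain_closed i j : (i < n)%N -> (j < n)%N -> H' i j + V' i.+1 j = H' i j.+1 + V' i j.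
Proof.
move=> ni nj; apply/eqP; rewrite -subr_eq0 opprD addrA; apply/eqP.
transitivity (dface etaH etaV i j + \sum_(kl : 'I_n * 'I_n) (dface (argH c h kl.1 kl.2) (argV c h kl.1 kl.2) i j : R) *: m kl).
  rewrite /H' /V' /dface.
  rewrite [in RHS](eq_bigr (fun kl : 'I_n * 'I_n => ((argH c h kl.1 kl.2 i j : R) *: m kl
     + (argV c h kl.1 kl.2 i.+1 j : R) *: m kl
     + (- ((argH c h kl.1 kl.2 i j.+1 : R) *: m kl) - (argV c h kl.1 kl.2 i j : R) *: m kl)))); last first.
    by move=> kl _; rewrite !(scalerBl, scalerDl); zmodule.
  by rewrite !big_split /= !sumrN; zmodule.
rewrite (bigD1 (Ordinal ni, Ordinal nj))//= dface_arg// !eqxx /= big1 ?addr0.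
  by rewrite /m /= scalerN scalerA divff ?scale1r ?subrr// mulf_neq0// gt_eqF// pi_gt0.
move=> [k l] /= kl; rewrite dface_arg//; case: ifPn => [/andP[/eqP ik /eqP jl]|_].
  by case/eqP: kl; congr pair; apply: val_inj.
by rewrite scale0r.
Qed.

Lemma reduced_hint i j : (forall t, x i <= t <= x i.+1 -> O (t, x j)) ->
  H' i j = hint P' (x j) (x i) (x i.+1).
Proof.
move=> inO; have xx : x i <= x i.+1 by rewrite /x gridS lerDl ltW.
have mM : Num.min (x i) (x i.+1) = x i /\ Num.max (x i) (x i.+1) = x i.+1.
  by rewrite min_l ?max_r.
have ua (kl : 'I_n * 'I_n) : ucont (fun t => aP kl (t, x j)) (x i) (x i.+1).
  apply: closedat_ucont_arg => t _; apply/eqP => -[_ e].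
  by have := centre_off_grid c kl.2 j h0; rewrite -/(x j) e eqxx.
have ul (kl : 'I_n * 'I_n) : ucont (fun t => aP kl (t, x j) *: m kl) (x i) (x i.+1).
  exact: (ucont_lin (linear_scalev (m kl)) (norm_scalev_le (m kl)) (ua kl)).
rewrite /hint /P' segintD ?mM.1 ?mM.2; last 2 first.
- by apply: ucont_horizontal => t /inO /clO /closedat_contP.
- exact: ucont_sum.
rewrite /H' etaH_in//; congr (_ + _); rewrite segint_sum ?mM.1 ?mM.2//.
apply: eq_bigr => kl _.
rewrite (segint_lin (linear_scalev (m kl)) (norm_scalev_le (m kl)))//.
by rewrite mM.1 mM.2.
Qed.

Lemma reduced_vint i j : (forall t, x j <= t <= x j.+1 -> O (x i, t)) ->
  V' i j = vint Q' (x i) (x j) (x j.+1).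
Proof.
move=> inO; have xx : x j <= x j.+1 by rewrite /x gridS lerDl ltW.
have mM : Num.min (x j) (x j.+1) = x j /\ Num.max (x j) (x j.+1) = x j.+1.
  by rewrite min_l ?max_r.
have ua (kl : 'I_n * 'I_n) : ucont (fun t => aQ kl (x i, t)) (x j) (x j.+1).
  apply: ucont_vertical => t _; apply: (@closedat_contQ _ _ (aP kl)).
  apply: closedat_arg; apply/eqP => -[e _].
  by have := centre_off_grid c kl.1 i h0; rewrite -/(x i) e eqxx.
have ul (kl : 'I_n * 'I_n) : ucont (fun t => aQ kl (x i, t) *: m kl) (x j) (x j.+1).
  exact: (ucont_lin (linear_scalev (m kl)) (norm_scalev_le (m kl)) (ua kl)).
rewrite /vint /Q' segintD ?mM.1 ?mM.2; last 2 first.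
- by apply: ucont_vertical => t /inO /clO /closedat_contQ.
- exact: ucont_sum.
rewrite /V' etaV_in//; congr (_ + _); rewrite segint_sum ?mM.1 ?mM.2//.
apply: eq_bigr => kl _.
rewrite (segint_lin (linear_scalev (m kl)) (norm_scalev_le (m kl)))//.
by rewrite mM.1 mM.2.
Qed.

Lemma grid_inj_le i j : x i <= x j -> (i <= j)%N.
Proof.
move=> xij; rewrite leqNgt; apply/negP => /(grid_le c (ltW h0)).
by rewrite gridS leNgt => /negP; apply; rewrite (le_lt_trans xij)// ltrDl.
Qed.

Let idx (u : R) := Num.truncn ((u + c) / h).

Lemma idxP u : - c <= u -> x (idx u) <= u < x (idx u).+1.
Proof.
move=> cu; have u0 : 0 <= (u + c) / h.
  by rewrite divr_ge0 ?(ltW h0)// -lerBlDr sub0r.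
have /andP[i1 i2] := truncn_itv u0; rewrite /x /grid.
apply/andP; split.
  by rewrite addrC -lerBrDr opprK -ler_pdivlMr.
by rewrite addrC -ltrBlDr opprK -ltr_pdivrMr.
Qed.

Lemma idx_adj u v : - c <= u -> - c <= v -> `|u - v| < h -> (idx u <= (idx v).+1)%N.
Proof.
move=> cu cv uv; rewrite leqNgt; apply/negP => /(grid_le c (ltW h0)).
have /andP[a1 a2] := idxP cu; have /andP[b1 b2] := idxP cv.
move: a1 b2 uv; rewrite /x !gridS ltr_norml => a1 b2 /andP[u1 u2] xx; lra.
Qed.

Lemma cball_box t w : 0 <= t <= 1 -> cball (g t) (3 * h) w ->
  [/\ O w, - c <= w.1 <= x n & - c <= w.2 <= x n].
Proof.
move=> t01 wt; have w4 : cball (g t) (4 * h) w.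
  by apply: cball_le wt; rewrite ler_pM2r// ler_nat.
by have [b1 b2] := g_box t01 w4; split => //; exact: g_in t01 w4.
Qed.

Lemma potential_hint Psi t i i' j : 0 <= t <= 1 ->
  (forall i j, (i < n)%N -> (j <= n)%N -> Psi i.+1 j - Psi i j = H' i j) ->
  (i <= i'.+1)%N -> (i' <= i.+1)%N ->
  cball (g t) (3 * h) (x i, x j) -> cball (g t) (3 * h) (x i', x j) ->
  Psi i' j - Psi i j = hint P' (x j) (x i) (x i').
Proof.
move=> t01 PsiH; wlog ii' : i i' / (i <= i')%N => [wl|] ii1 ii2 ti ti'.
  have [/wl|/ltnW/wl h'] := leqP i i'; first exact.
  by rewrite -opprB h'// /hint (segint_opp _ (x i)) opprK.
have [->|ne] := eqVneq i i'; first by rewrite subrr /hint segint_aa.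
have e : i' = i.+1 by apply/eqP; rewrite eqn_leq ii2 ltn_neqAle ne.
rewrite {}e {ii1 ii2 ii' ne} in ti' *.
have [_ /= /andP[_ xn] /andP[_ jn]] := cball_box t01 ti'.
rewrite PsiH; [|exact: grid_inj_le xn|exact: grid_inj_le jn].
apply: reduced_hint => s /andP[s1 s2]; have [] // := @cball_box t (s, x j) t01.
move: ti ti'; rewrite !cballE /= => /andP[/andP[a1 a2] b] /andP[/andP[a3 a4] _].
by rewrite b andbT; apply/andP; split; [exact: le_trans a1 s1 | exact: le_trans s2 a4].
Qed.

Lemma potential_vint Psi t i j j' : 0 <= t <= 1 ->
  (forall i j, (j < n)%N -> Psi i j.+1 - Psi i j = V' i j) ->
  (j <= j'.+1)%N -> (j' <= j.+1)%N ->
  cball (g t) (3 * h) (x i, x j) -> cball (g t) (3 * h) (x i, x j') ->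
  Psi i j' - Psi i j = vint Q' (x i) (x j) (x j').
Proof.
move=> t01 PsiV; wlog jj' : j j' / (j <= j')%N => [wl|] jj1 jj2 tj tj'.
  have [/wl|/ltnW/wl h'] := leqP j j'; first exact.
  by rewrite -opprB h'// /vint (segint_opp _ (x j)) opprK.
have [->|ne] := eqVneq j j'; first by rewrite subrr /vint segint_aa.
have e : j' = j.+1 by apply/eqP; rewrite eqn_leq jj2 ltn_neqAle ne.
rewrite {}e {jj1 jj2 jj' ne} in tj' *.
have [_ _ /= /andP[_ xn]] := cball_box t01 tj'.
rewrite PsiV; last exact: grid_inj_le xn.
apply: reduced_vint => s /andP[s1 s2]; have [] // := @cball_box t (x i, s) t01.
move: tj tj'; rewrite !cballE /= => /andP[b /andP[a1 a2]] /andP[_ /andP[a3 a4]].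
by rewrite b /=; apply/andP; split; [exact: le_trans a1 s1 | exact: le_trans s2 a4].
Qed.

Let corner (q : R * R) : R * R := (x (idx q.1), x (idx q.2)).

(** Values at the nodes extended to a neighbourhood of the curve by
    integrating from the nearest node on the lower left. *)
Let lift (Psi : nat -> nat -> E) q :=
  Psi (idx q.1) (idx q.2) + incr P' Q' (corner q) q.

(** On a neighbourhood of the curve the lifted potential is a primitive of
    P' du + Q' dv. *)
Lemma lift_incr Psi t q q' : 0 <= t <= 1 ->
  (forall i j, (i < n)%N -> (j <= n)%N -> Psi i.+1 j - Psi i j = H' i j) ->
  (forall i j, (j < n)%N -> Psi i j.+1 - Psi i j = V' i j) ->
  cball (g t) h q -> cball (g t) h q' -> `|q' - q| < h ->
  lift Psi q' - lift Psi q = incr P' Q' q q'.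
Proof.
move=> t01 PsiH PsiV tq tq' qq'.
have h3 w : cball (g t) h w -> cball (g t) (3 * h) w.
  by apply: cball_le; rewrite ler_peMl ?(ltW h0)// ler1n.
have [_ /andP[q1 _] /andP[q2 _]] := cball_box t01 (h3 _ tq).
have [_ /andP[q1' _] /andP[q2' _]] := cball_box t01 (h3 _ tq').
have /andP[i1 i2] := idxP q1; have /andP[j1 j2] := idxP q2.
have /andP[i1' i2'] := idxP q1'; have /andP[j1' j2'] := idxP q2'.
move: (tq) (tq') i2 j2 i2' j2'; rewrite !cballE /x !gridS.
move=> /andP[/andP[a1 a2] /andP[a3 a4]] /andP[/andP[a1' a2'] /andP[a3' a4']].
move=> i2 j2 i2' j2'; rewrite /x in i1 j1 i1' j1'.
have b1 : (g t).1 - 3 * h <= x (idx q.1) <= (g t).1 + 3 * h.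
  by apply/andP; split; rewrite /x; lra.
have b2 : (g t).2 - 3 * h <= x (idx q.2) <= (g t).2 + 3 * h.
  by apply/andP; split; rewrite /x; lra.
have b3 : (g t).1 - 3 * h <= x (idx q'.1) <= (g t).1 + 3 * h.
  by apply/andP; split; rewrite /x; lra.
have b4 : (g t).2 - 3 * h <= x (idx q'.2) <= (g t).2 + 3 * h.
  by apply/andP; split; rewrite /x; lra.
have c1 : cball (g t) (3 * h) (corner q) by rewrite cballE /= b1 b2.
have c2 : cball (g t) (3 * h) (x (idx q'.1), x (idx q.2)) by rewrite cballE /= b3 b2.
have c3 : cball (g t) (3 * h) (corner q') by rewrite cballE /= b3 b4.
move: (qq'); rewrite prod_norm_lt => /andP[d1 d2].
have d1' : `|q.1 - q'.1| < h by rewrite distrC.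
have d2' : `|q.2 - q'.2| < h by rewrite distrC.
have PsiE : Psi (idx q'.1) (idx q'.2) - Psi (idx q.1) (idx q.2) =
    incr P' Q' (corner q) (corner q').
  rewrite /incr /=.
  rewrite -(potential_hint t01 PsiH _ _ c1 c2) ?idx_adj//.
  by rewrite -(potential_vint t01 PsiV _ _ c2 c3) ?idx_adj//; zmodule.
have cl w : cball (g t) (3 * h) w -> closedat P' Q' w by exact: closed_reduced.
have s1 := incr_add c1 c3 (h3 _ tq') cl.
have s2 := incr_add c1 (h3 _ tq) (h3 _ tq') cl.
rewrite /lift; transitivity ((Psi (idx q'.1) (idx q'.2) - Psi (idx q.1) (idx q.2))
  + incr P' Q' (corner q') q' - incr P' Q' (corner q) q); first by zmodule.
by rewrite PsiE s1 -s2; zmodule.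
Qed.

Lemma curve_ucont (r : R) : 0 < r -> exists2 d : R, 0 < d &
  forall s t : R, 0 <= s <= 1 -> 0 <= t <= 1 -> `|s - t| < d -> `|g s - g t| < r.
Proof.
move=> r0; have r2 : 0 < r / 2 by rewrite divr_gt0.
pose S (d : R) t := forall s : R, 0 <= s <= 1 -> `|s - t| < d -> `|g s - g t| < r.
have [||d d0 dP] := @compact_uniform R R _ S (@segment_compact R 0 1).
- by move=> d d' t _ dd Sd s s01 st; apply: Sd => //; exact: lt_le_trans st dd.
- move=> t /=; rewrite in_itv /= => t01; have [d d0 dP] := g_cont t01 r2.
  have d2 : 0 < d / 2 by rewrite divr_gt0.
  exists (d / 2) => // t' /=; rewrite in_itv /= => t'01; rewrite /ball /= => tt' s s01 st.
  rewrite (le_lt_trans (ler_distD (g t) _ _))// [r]splitr ltrD//.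
    apply: dP => //; rewrite (le_lt_trans (ler_distD t' _ _))// [d]splitr ltrD//.
    by rewrite distrC.
  rewrite distrC; apply: dP => //; rewrite distrC (lt_trans tt')//.
  by rewrite gtr_pMr// invf_lt1 ?ltr1n.
by exists d => // s t s01 t01 st; apply: dP => //=.
Qed.

Lemma curve_form_ucont (e : R) : 0 < e -> exists2 d : R, 0 < d & forall t : R, 0 <= t <= 1 ->
  forall w, cball (g t) d w -> `|P' w - P' (g t)| <= e /\ `|Q' w - Q' (g t)| <= e.
Proof.
move=> e0; have e2 : 0 < e / 2 by rewrite divr_gt0.
pose S (d : R) t := forall w, cball (g t) d w ->
  `|P' w - P' (g t)| <= e /\ `|Q' w - Q' (g t)| <= e.
have [||d d0 dP] := @compact_uniform R R _ S (@segment_compact R 0 1).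
- by move=> d d' t _ dd Sd w wt; apply: Sd; exact: cball_le wt.
- move=> t /=; rewrite in_itv /= => t01.
  have cl : closedat P' Q' (g t).
    by apply: (closed_reduced t01); rewrite /cball /= subrr normr0 mulr_ge0// ltW.
  have [d1 d10 d1P] := closedat_contP cl e2; have [d2 d20 d2P] := closedat_contQ cl e2.
  pose d := Num.min d1 d2 / 2.
  have d0 : 0 < d by rewrite divr_gt0// lt_min d10.
  have [r r0 rP] := g_cont t01 d0.
  exists (Num.min r d) => [|t' /=]; first by rewrite lt_min r0.
  rewrite in_itv /= => t'01; rewrite /ball /= lt_min => /andP[tr td] w wt.
  have gt' : `|g t' - g t| < d by apply: rP => //; rewrite distrC.
  have wd : `|w - g t| < Num.min d1 d2.
    rewrite (le_lt_trans (ler_distD (g t') _ _))// [ltRHS]splitr -/d.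
    apply: ler_ltD gt'; apply: le_trans wt _; rewrite ge_min lexx orbT//.
  have gtd : `|g t' - g t| < Num.min d1 d2.
    by apply: (lt_trans gt'); rewrite /d gtr_pMr ?lt_min ?d10// invf_lt1 ?ltr1n.
  move: wd gtd; rewrite !lt_min => /andP[w1 w2] /andP[g1 g2].
  split; rewrite [e]splitr.
    by rewrite (le_trans (ler_distD (P' (g t)) _ _))// lerD ?d1P// distrC d1P.
  by rewrite (le_trans (ler_distD (Q' (g t)) _ _))// lerD ?d2P// distrC d2P.
by exists d => // t t01; apply: dP => /=; rewrite in_itv.
Qed.

(** All periods of the reduced form around the lattice faces vanish, so it has a
    primitive near the curve. *)
Lemma line_integral_reduced :
  is_line_integral (@Num.norm _ E) (fun z v => v.1 *: P' z + v.2 *: Q' z) g 0.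
Proof.
have [Psi [PsiH PsiV]] := lattice_potential reduced_cochain_closed.
apply: (@line_integral_exact R E _ g (lift Psi) g_closed g_rect) => e e0.
have e2 : 0 < e / 2 by rewrite divr_gt0.
have [r r0 rP] := curve_form_ucont e2.
pose r' := Num.min r (h / 2); have r'0 : 0 < r' by rewrite lt_min r0 divr_gt0.
have [d d0 dP] := curve_ucont r'0.
exists d => // a t b a0 atle tb b1 ab.
have t01 : 0 <= t <= 1 by rewrite (le_trans a0) ?(le_trans tb).
have a01 : 0 <= a <= 1 by rewrite a0 (le_trans atle) ?(le_trans tb).
have b01 : 0 <= b <= 1 by rewrite b1 (le_trans a0) ?(le_trans atle).
have at1 : `|a - t| < d by rewrite ler0_norm ?subr_le0// opprB; lra.
have bt1 : `|b - t| < d by rewrite ger0_norm ?subr_ge0//; lra.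
have ga := dP a t a01 t01 at1; have gb := dP b t b01 t01 bt1.
have r'h : r' <= h / 2 by rewrite ge_min lexx orbT.
have hh : h / 2 <= h by rewrite ler_pdivrMr// ler_peMr ?(ltW h0)// ler1n.
have r'r : r' <= r by rewrite ge_min lexx.
have Ga : cball (g t) r' (g a) by exact: ltW.
have Gb : cball (g t) r' (g b) by exact: ltW.
rewrite (lift_incr t01 PsiH PsiV).
- rewrite distrC; apply: (le_trans (@incr_near R E P' Q' (g t) r' _ _ (P' (g t)) (Q' (g t)) (e / 2) Ga Gb _)).
    move=> w wt; have wr : cball (g t) r w by exact: cball_le wt.
    have wh : cball (g t) (3 * h) w.
      apply: cball_le wt; rewrite (le_trans r'h)// (le_trans hh)//.
      by rewrite ler_peMl ?(ltW h0)// ler1n.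
    have cw := closed_reduced t01 wh; have [Pw Qw] := rP t t01 w wr.
    by split => //; [exact: closedat_contP cw | exact: closedat_contQ cw].
  rewrite -mulrDr mulrAC -mulrA; apply: ler_wpM2l; first exact: ltW.
  rewrite ler_pdivrMr// mulr_natr mulr2n.
  by apply: lerD; [exact: prod_norm_fst | exact: prod_norm_snd].
- by apply: cball_le Ga; exact: le_trans hh.
- by apply: cball_le Gb; exact: le_trans hh.
rewrite (le_lt_trans (ler_distD (g t) _ _))// [h]splitr.
apply: ltrD; first exact: lt_le_trans r'h.
by rewrite distrC; exact: lt_le_trans r'h.
Qed.

(** The residue formula on a grid: only the faces that carry a defect of the
    cochain contribute, each with the winding number of its centre. *)
Theorem line_integral_grid :
  is_line_integral (@Num.norm _ E) (fun z v => v.1 *: P z + v.2 *: Q z) g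
    (\sum_(kl : 'I_n * 'I_n)
       (kappa kl.1 kl.2 / (2 * pi)) *: dface etaH etaV kl.1 kl.2).
Proof.
have L (kl : 'I_n * 'I_n) : is_line_integral (@Num.norm _ E)
    (fun z v => darg (centre c h kl.1 kl.2) z v *: (- m kl)) g
    ((kappa kl.1 kl.2 / (2 * pi)) *: dface etaH etaV kl.1 kl.2).
  have [d0|d0] := eqVneq (dface etaH etaV kl.1 kl.2) 0.
    rewrite /m d0 !scaler0 !oppr0.
    rewrite (_ : (fun _ _ => _) = fun _ _ => 0); first exact: line_integral_cst0.
    by apply/funext => z; apply/funext => v; rewrite scaler0.
  have := line_integral_scalev (- m kl) (kappaP (ltn_ord kl.1) (ltn_ord kl.2) d0).
  by rewrite {3}/m opprK scalerA.
have := line_integralD line_integral_reduced (line_integral_sum (index_enum _) L).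
rewrite add0r; congr is_line_integral.
apply/funext => z; apply/funext => v; rewrite /P' /Q' !scalerDr !scaler_sumr.
rewrite addrACA -[LHS]addrA -[RHS]addr0; congr (_ + _).
rewrite -!big_split big1// => kl _ /=.
by rewrite dargE; move: (m kl) => mk; rewrite scalerN scalerDl !scalerA subrr.
Qed.

End CurveOnGrid.

(** * From a boundary cycle to a lattice contour *)

Section Region.
Variable R : realType.

(** The segment from p to q is connected and does not meet the boundary. *)
Lemma near_boundary_free (D : set (R * R)) p q (r : R) : open D -> `|p - q| <= r ->
  (forall w, cball q r w -> ~ boundary D w) ->
  (D q /\ D p) \/ (~ closure D q /\ ~ closure D p).
Proof.
move=> oD pq nb; pose f (t : R) : R * R := (q.1 + t * (p - q).1, q.2 + t * (p - q).2).
pose S := f @` `[0, 1].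
have fc : continuous f.
  have cc (a b t : R) : (fun t : R => a + t * b) x @[x --> t] --> a + t * b.
    by apply: cvgD; [exact: cvg_cst | apply: cvgM; [exact: cvg_id | exact: cvg_cst]].
  by move=> t; exact: cvg_pair (cc _ _ _) (cc _ _ _).
have Sc : connected S.
  apply: connected_continuous_connected; first exact: segment_connected.
  exact: continuous_subspaceT.
have Sball w : S w -> cball q r w.
  move=> [t /=]; rewrite in_itv /= => /andP[t0 t1] <-; rewrite /cball /=.
  apply: le_trans pq; rewrite prod_norm_le /= !(addrAC _ _ (- _)) !subrr !add0r.
  rewrite !normrM (ger0_norm t0).
  apply/andP; split; [apply: le_trans (prod_norm_fst (p - q))|apply: le_trans (prod_norm_snd (p - q))];
    by rewrite ler_piMl.
have sep : separated D (~` closure D).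
  split; first by apply/disjoints_subset; rewrite setCK.
  apply/disjoints_subset => w Dw cw; have [v [Dv nv]] := cw D (open_nbhs_nbhs (conj oD Dw)).
  by apply: Dv; exact: subset_closure.
have Scov : S `<=` D `|` ~` closure D.
  move=> w Sw; have [Dw|nDw] := pselect (D w); first by left.
  right => cw; apply: (nb w (Sball w Sw)); split => //.
  by move/interior_subset.
have Sq : S q.
  by exists 0; [rewrite /= in_itv /= lexx ler01|rewrite /f !mul0r !addr0 -surjective_pairing].
have Sp : S p.
  exists 1; first by rewrite /= in_itv /= lexx ler01.
  by rewrite /f !mul1r /= !(addrC q.1) !(addrC q.2) !subrK -surjective_pairing.
by have [h|h] := connected_subset sep Scov Sc; [left|right]; split; apply: h.
Qed.

Lemma finite_uniform (I : finType) (S : R -> I -> Prop) :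
  (forall d d' i, 0 < d' -> d' <= d -> S d i -> S d' i) ->
  (forall i, exists2 d : R, 0 < d & S d i) -> exists2 d : R, 0 < d & forall i, S d i.
Proof.
move=> Sle Sex; have /choice[d dP] i : exists d : R, 0 < d /\ S d i.
  by have [d d0 Sd] := Sex i; exists d.
exists (\big[Num.min/1]_i d i) => [|i].
  by apply/lt_bigmin => // i _; have [] := dP i.
have [di Si] := dP i; apply: Sle Si; last exact: bigmin_le_cond.
by apply/lt_bigmin => // j _; have [] := dP j.
Qed.

Variable E : completeNormedModType R.
Implicit Types (P Q : R * R -> E) (K : set (R * R)).

(** Edge integrals, discarded on the edges that meet [K]. *)
Definition cutH K P (c h : R) i j : E :=
  if `[< exists t, grid c h i <= t <= grid c h i.+1 /\ K (t, grid c h j) >] then 0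
  else hint P (grid c h j) (grid c h i) (grid c h i.+1).
Definition cutV K Q (c h : R) i j : E :=
  if `[< exists t, grid c h j <= t <= grid c h j.+1 /\ K (grid c h i, t) >] then 0
  else vint Q (grid c h i) (grid c h j) (grid c h j.+1).

Definition meets K (c h : R) i j :=
  `[< exists2 z, rect (grid c h i) (grid c h i.+1) (grid c h j) (grid c h j.+1) z & K z >].

(** The integral of P du + Q dv along a lattice contour around [K]: the sum of
    the boundaries of the faces that meet [K]. *)
Definition lattice_residue K P Q (c h : R) n : E :=
  \sum_(kl : 'I_n * 'I_n | meets K c h kl.1 kl.2)
    dface (cutH K P c h) (cutV K Q c h) kl.1 kl.2.

Lemma rect_centre (c h : R) k l q : 0 < h ->
  (rect (grid c h k) (grid c h k.+1) (grid c h l) (grid c h l.+1) q <->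
   `|q - centre c h k l| <= h / 2).
Proof.
move=> h0; rewrite prod_norm_le !ler_distl /rect !gridS /=.
have hh t : t + h / 2 + h / 2 = t + h by rewrite -addrA -splitr.
by rewrite !addrK !hh; split => [[-> ->]//|/andP[-> ->]].
Qed.

Lemma jordan_continuous (g : R -> R * R) : jordan_curve g ->
  forall t : R, 0 <= t <= 1 -> forall e : R, 0 < e ->
  exists2 d : R, 0 < d & forall s : R, 0 <= s <= 1 -> `|s - t| < d -> `|g s - g t| < e.
Proof.
move=> [/subspace_continuousP gc _ _] t t01 e e0.
have t01' : `[0, 1]%classic t by rewrite /= in_itv.
have /cvgrPdist_lt/(_ e e0) := gc t t01'; rewrite near_withinE.
move=> /nbhs_ballP[d /= d0 dP]; exists d => // s s01 st.
rewrite distrC; apply: dP; last by rewrite /= in_itv.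
by rewrite -ball_normE /= distrC.
Qed.

Lemma curve_tube (g : R -> R * R) (O : set (R * R)) : open O ->
  (forall t : R, 0 <= t <= 1 -> forall e : R, 0 < e ->
    exists2 d : R, 0 < d & forall s : R, 0 <= s <= 1 -> `|s - t| < d -> `|g s - g t| < e) ->
  (forall t : R, 0 <= t <= 1 -> O (g t)) ->
  exists2 d : R, 0 < d & forall t w, 0 <= t <= 1 -> cball (g t) d w -> O w.
Proof.
move=> oO gc gO; pose S (d : R) t := forall w, cball (g t) d w -> O w.
have [||d d0 dP] := @compact_uniform R R _ S (@segment_compact R 0 1).
- by move=> d d' t _ dd Sd w wt; apply: Sd; exact: cball_le wt.
- move=> t /=; rewrite in_itv /= => t01.
  have /nbhs_ballP[e /= e0 eP] : nbhs (g t) O by exact: open_nbhs_nbhs (conj oO (gO t t01)).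
  have e2 : 0 < e / 2 by rewrite divr_gt0.
  have [r r0 rP] := gc t t01 _ e2.
  exists (Num.min r (e / 2)) => [|t' /=]; first by rewrite lt_min r0.
  rewrite in_itv /= => t'01; rewrite /ball /= lt_min => /andP[tr te] w wt.
  apply: eP; rewrite -ball_normE /= distrC (le_lt_trans (ler_distD (g t') _ _))//.
  rewrite [e]splitr; apply: ler_ltD.
    by apply: le_trans wt _; rewrite ge_min lexx orbT.
  by apply: rP => //; rewrite distrC.
by exists d => // t w t01; apply: dP => /=; rewrite in_itv.
Qed.

Lemma curve_bounded (g : R -> R * R) :
  (forall t : R, 0 <= t <= 1 -> forall e : R, 0 < e ->
    exists2 d : R, 0 < d & forall s : R, 0 <= s <= 1 -> `|s - t| < d -> `|g s - g t| < e) ->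
  exists2 M : R, 0 < M & forall t : R, 0 <= t <= 1 -> `|g t| <= M.
Proof.
move=> gc; pose S (d : R) t := `|g t| <= d^-1.
have [||d d0 dP] := @compact_uniform R R _ S (@segment_compact R 0 1).
- move=> d d' t d'0 dd /le_trans; apply; rewrite lef_pV2 ?posrE//.
  exact: lt_le_trans d'0 dd.
- move=> t /=; rewrite in_itv /= => t01.
  have [r r0 rP] := gc t t01 _ (@ltr01 R).
  have g1 : 0 < (`|g t| + 1)^-1 by rewrite invr_gt0 ltr_wpDl.
  exists (Num.min r (`|g t| + 1)^-1) => [|t' /=]; first by rewrite lt_min r0.
  rewrite in_itv /= => t'01; rewrite /ball /= lt_min => /andP[tr _].
  apply: (@le_trans _ _ (`|g t| + 1)).
    rewrite -[g t'](subrK (g t)) addrC (le_trans (ler_normD _ _))// lerD2l ltW//.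
    by apply: rP => //; rewrite distrC.
  by rewrite -[leLHS]invrK lef_pV2 ?posrE ?lt_min ?r0// ge_min lexx orbT.
by exists d^-1 => [|t t01]; [rewrite invr_gt0 | apply: dP => /=; rewrite in_itv].
Qed.

(** On a fine lattice the faces with a defect either meet K, and then the cycle
    winds once around their centres, or leave W, and then their centres are
    outside the closure of D and have winding number 0. *)
Lemma cycle_integral_lattice P Q (W K D : set (R * R)) m (G : 'I_m -> R -> R * R) :
  open D -> jordan_boundary D G -> positively_oriented D G ->
  K `<=` D -> closed K -> closure D `<=` W -> open W ->
  (forall z, W z -> ~ K z -> closedat P Q z) ->
  exists c0 : R, forall c, c0 <= c -> exists2 r : R, 0 < r &
    forall h n, 0 < h -> h < r -> n%:R * h = 2 * c ->
    is_cycle_integral (@Num.norm _ E) (fun z v => v.1 *: P z + v.2 *: Q z) G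
      (lattice_residue K P Q c h n).
Proof.
move=> oD [Gj bD] [oin oout] KD cK DW oW cl.
pose O := W `&` ~` K.
have oO : open O by apply: openI => //; exact: closed_openC.
have tr k (t : R) : 0 <= t <= 1 -> boundary D (G k t).
  by move=> t01; rewrite bD; exists k => //; exists t => //=; rewrite in_itv.
have GO k (t : R) : 0 <= t <= 1 -> O (G k t).
  move=> /(tr k)[cD nD]; split; first exact: DW.
  by move=> /KD Dg; apply: nD; exact: open_nbhs_nbhs (conj oD Dg).
have [r0 r00 r0P] : exists2 r : R, 0 < r & forall k (t : R) w, 0 <= t <= 1 -> cball (G k t) r w -> O w.
  apply: (@finite_uniform _ (fun r k => forall (t : R) w, 0 <= t <= 1 -> cball (G k t) r w -> O w)).
    by move=> d d' k _ dd Sd t w t01 wt; apply: Sd t01 (cball_le dd wt).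
  by move=> k; have [jk _] := Gj k; exact: (curve_tube oO (jordan_continuous jk) (GO k)).
have [b b0 bP] : exists2 b : R, 0 < b & forall k (t : R), 0 <= t <= 1 -> `|G k t| <= b^-1.
  apply: (@finite_uniform _ (fun b k => forall t : R, 0 <= t <= 1 -> `|G k t| <= b^-1)).
    move=> d d' k d'0 dd Sd t t01; apply: le_trans (Sd t t01) _.
    by rewrite lef_pV2 ?posrE//; exact: lt_le_trans d'0 dd.
  move=> k; have [jk _] := Gj k; have [M M0 MP] := curve_bounded (jordan_continuous jk).
  by exists M^-1 => [|t t01]; [rewrite invr_gt0 | rewrite invrK; exact: MP].
exists (b^-1 + 1) => c bc; exists (Num.min (r0 / 4) (1 / 4)).
  by rewrite lt_min !divr_gt0.
move=> h n h0; rewrite lt_min => /andP[hr h1] nh.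
have gridn : grid c h n = c by rewrite /grid nh; ring.
have h4 : 4 * h <= r0 by move: hr; rewrite ltr_pdivlMr// mulrC => /ltW.
have tube k (t : R) w : 0 <= t <= 1 -> cball (G k t) (4 * h) w -> O w.
  by move=> t01 wt; apply: r0P t01 (cball_le h4 wt).
have box k (t : R) w : 0 <= t <= 1 -> cball (G k t) (4 * h) w ->
    - c <= w.1 <= grid c h n /\ - c <= w.2 <= grid c h n.
  move=> t01 wt; rewrite gridn -!ler_norml.
  have wc : `|w| <= c.
    rewrite -(subrK (G k t) w) addrC (le_trans (ler_normD _ _))// (le_trans _ bc)//.
    apply: lerD; first exact: bP.
    by apply: (le_trans wt); move: h1; rewrite ltr_pdivlMr// mulrC => /ltW.
  by split; [exact: le_trans (prod_norm_fst _) wc | exact: le_trans (prod_norm_snd _) wc].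
pose eH := cutH K P c h; pose eV := cutV K Q c h.
have eHin i j : (forall t, grid c h i <= t <= grid c h i.+1 -> O (t, grid c h j)) ->
    eH i j = hint P (grid c h j) (grid c h i) (grid c h i.+1).
  by move=> inO; rewrite /eH /cutH; case: asboolP => // -[t [/inO[_ nK] /nK]].
have eVin i j : (forall t, grid c h j <= t <= grid c h j.+1 -> O (grid c h i, t)) ->
    eV i j = vint Q (grid c h i) (grid c h j) (grid c h j.+1).
  by move=> inO; rewrite /eV /cutV; case: asboolP => // -[t [/inO[_ nK] /nK]].
have clO z : O z -> closedat P Q z by case; exact: cl.
have hh : h / 2 <= 4 * h by lra.
(* The trace stays away from the faces that leave O, because h is small
   compared with its distance from the complement of O. *)
have far q : ~ O q -> forall w, cball q (h / 2) w -> ~ boundary D w.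
  move=> nO w wq; rewrite bD => -[k _ [t /=]]; rewrite in_itv /= => t01 gt.
  apply: nO; apply: (tube k t) => //; rewrite gt /cball /= distrC.
  exact: le_trans hh.
have side k l q : ~ O q -> `|q - centre c h k l| <= h / 2 ->
    (D q /\ D (centre c h k l)) \/ (~ closure D q /\ ~ closure D (centre c h k l)).
  move=> nO qc; apply: (@near_boundary_free D (centre c h k l) q (h / 2) oD).
    by rewrite distrC.
  exact: far.
pose w k l : R := if `[< D (centre c h k l) >] then 2 * pi else 0.
have wind kl : exists ka : 'I_m -> R, dface eH eV kl.1 kl.2 != 0 ->
    (forall k, is_line_integral Num.norm (darg (centre c h kl.1 kl.2)) (G k) (ka k)) /\
    w kl.1 kl.2 = \sum_k ka k.
  have [d0|d0] := eqVneq (dface eH eV kl.1 kl.2) 0; first by exists (fun=> 0).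
  have [q nO qc] := face_not_in h0 clO eHin eVin d0.
  rewrite /w; case: asboolP => Dc.
    by have [ka kaP kaE] := oin _ Dc; exists ka.
  have [[_ /Dc//]|[_ ncD]] := side _ _ q nO qc.
  by have [ka kaP kaE] := oout _ ncD; exists ka.
have {wind}/choice[ka kaP] := wind.
exists (fun k => \sum_(kl : 'I_n * 'I_n)
   (ka (kl.1 : nat, kl.2 : nat) k / (2 * pi)) *: dface eH eV kl.1 kl.2).
  move=> k; have [jk rk] := Gj k; have [_ g01 _] := jk.
  apply: (@line_integral_grid R E P Q O (G k) c h n eH eV (fun i j => ka (i, j) k)) => //.
  - exact: jordan_continuous.
  - exact: tube.
  - exact: box.
  - by move=> i j _ _ d0; have [] := kaP (i, j) d0.
rewrite exchange_big /= /lattice_residue big_mkcond; apply: eq_bigr => kl _.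
rewrite -scaler_suml -mulr_suml -/eH -/eV.
have [d0|d0] := eqVneq (dface eH eV kl.1 kl.2) 0; first by rewrite d0 scaler0 if_same.
have [_ <-] := kaP (kl.1 : nat, kl.2 : nat) d0.
have pi2 : 2 * pi != 0 :> R by rewrite mulf_neq0// gt_eqF// pi_gt0.
rewrite /w /meets /=; case: asboolP => mK; case: asboolP => Dc.
- by rewrite divff// scale1r.
- case: mK => z /(rect_centre _ _ _ _ h0) zc Kz.
  have nO : ~ O z by case.
  have [[_ /Dc//]|[nz _]] := side _ _ z nO zc.
  by exfalso; apply: nz; exact: (@subset_closure _ D z (KD z Kz)).
- have [q nO qc] := face_not_in h0 clO eHin eVin d0.
  have [Kq|nKq] := pselect (K q).
    by exfalso; apply: mK; exists q => //; exact/rect_centre.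
  have [[Dq _]|[_ nc]] := side _ _ q nO qc.
    by exfalso; apply: nO; split => //; apply: DW; exact: (@subset_closure _ D q Dq).
  by exfalso; apply: nc; exact: (@subset_closure _ D _ Dc).
- by rewrite mul0r scale0r.
Qed.

End Region.

(** * Lattice contours and reflections *)

Section Residue.
Variables (R : realType) (E : completeNormedModType R) (K : set (R * R)).
Variables (c h : R) (n : nat).
Hypothesis h0 : 0 < h.
Implicit Types (P Q : R * R -> E) (z : R * R).

Local Notation x := (grid c h).

(** The punctured neighbourhood of [K] on which the lattice residue depends. *)
Definition collar z := (exists2 w, K w & `|z - w| <= h) /\ ~ K z.

Definition collar_cont P Q := forall z, collar z -> contat P z /\ contat Q z.

Let xx i : x i <= x i.+1. Proof. by rewrite gridS lerDl ltW. Qed.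

Let mM i : Num.min (x i) (x i.+1) = x i /\ Num.max (x i) (x i.+1) = x i.+1.
Proof. by rewrite min_l ?max_r. Qed.

Lemma rect_near i j z w : rect (x i) (x i.+1) (x j) (x j.+1) z ->
  rect (x i) (x i.+1) (x j) (x j.+1) w -> `|z - w| <= h.
Proof.
rewrite /rect !gridS => -[z1 z2] [w1 w2]; rewrite prod_norm_le.
by rewrite (itv_dist_le z1 w1)// (itv_dist_le z2 w2).
Qed.

(** The edges of a face that meets [K] lie in the collar or are cut. *)
Lemma meets_collar i j z : meets K c h i j -> rect (x i) (x i.+1) (x j) (x j.+1) z ->
  ~ K z -> collar z.
Proof.
move=> /asboolP[w wr Kw] zr nK; split => //; exists w => //.
exact: rect_near zr wr.
Qed.

Let rectH i j i' j' t : meets K c h i j -> i' = i -> (j' = j \/ j' = j.+1) ->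
  x i' <= t <= x i'.+1 -> rect (x i) (x i.+1) (x j) (x j.+1) (t, x j').
Proof. by move=> _ -> [] -> tt; split => //=; rewrite lexx xx. Qed.

Let rectV i j i' j' t : meets K c h i j -> j' = j -> (i' = i \/ i' = i.+1) ->
  x j' <= t <= x j'.+1 -> rect (x i) (x i.+1) (x j) (x j.+1) (x i', t).
Proof. by move=> _ -> [] -> tt; split => //=; rewrite lexx xx. Qed.

Let collarH i j i' j' : meets K c h i j -> i' = i -> (j' = j \/ j' = j.+1) ->
  ~ (exists t, x i' <= t <= x i'.+1 /\ K (t, x j')) ->
  forall t, x i' <= t <= x i'.+1 -> collar (t, x j').
Proof.
move=> mK ii jj no t tt; apply: (meets_collar mK (rectH mK ii jj tt)) => Kt.
by apply: no; exists t.
Qed.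

Let collarV i j i' j' : meets K c h i j -> j' = j -> (i' = i \/ i' = i.+1) ->
  ~ (exists t, x j' <= t <= x j'.+1 /\ K (x i', t)) ->
  forall t, x j' <= t <= x j'.+1 -> collar (x i', t).
Proof.
move=> mK jj ii no t tt; apply: (meets_collar mK (rectV mK jj ii tt)) => Kt.
by apply: no; exists t.
Qed.

Lemma lattice_residue_ext P Q P' Q' : collar_cont P Q ->
  (forall z, collar z -> P z = P' z /\ Q z = Q' z) ->
  lattice_residue K P Q c h n = lattice_residue K P' Q' c h n.
Proof.
move=> PQ e; apply: eq_bigr => -[k l] /= mK.
have EH (j' : nat) : (j' = l \/ j' = l.+1 :> nat) -> cutH K P c h k j' = cutH K P' c h k j'.
  move=> jj; rewrite /cutH; case: asboolP => // no.
  have col := collarH mK erefl jj no.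
  apply: segint_ext; rewrite (mM k).1 (mM k).2.
    by move=> t /col /e[].
  by apply: ucont_horizontal => t /col /PQ[].
have EV (i' : nat) : (i' = k \/ i' = k.+1 :> nat) -> cutV K Q c h i' l = cutV K Q' c h i' l.
  move=> ii; rewrite /cutV; case: asboolP => // no.
  have col := collarV mK erefl ii no.
  apply: segint_ext; rewrite (mM l).1 (mM l).2.
    by move=> t /col /e[].
  by apply: ucont_vertical => t /col /PQ[].
by rewrite /dface !EH ?EV; [|left|right|right|left].
Qed.

Lemma lattice_residueD P Q P' Q' : collar_cont P Q -> collar_cont P' Q' ->
  lattice_residue K (fun z => P z + P' z) (fun z => Q z + Q' z) c h n =
  lattice_residue K P Q c h n + lattice_residue K P' Q' c h n.
Proof.
move=> PQ PQ'; rewrite /lattice_residue -big_split; apply: eq_bigr => -[k l] /= mK.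
have EH (j' : nat) : (j' = l \/ j' = l.+1 :> nat) ->
    cutH K (fun z => P z + P' z) c h k j' = cutH K P c h k j' + cutH K P' c h k j'.
  move=> jj; rewrite /cutH; case: asboolP => [_|no]; first by rewrite addr0.
  have col := collarH mK erefl jj no.
  apply: segintD; rewrite (mM k).1 (mM k).2; apply: ucont_horizontal => t /col.
    by case/PQ.
  by case/PQ'.
have EV (i' : nat) : (i' = k \/ i' = k.+1 :> nat) ->
    cutV K (fun z => Q z + Q' z) c h i' l = cutV K Q c h i' l + cutV K Q' c h i' l.
  move=> ii; rewrite /cutV; case: asboolP => [_|no]; first by rewrite addr0.
  have col := collarV mK erefl ii no.
  apply: segintD; rewrite (mM l).1 (mM l).2; apply: ucont_vertical => t /col.
    by case/PQ.
  by case/PQ'.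
by rewrite /dface !EH ?EV; [zmodule|left|right|right|left].
Qed.

Definition reflect z : R * R := (z.1, - z.2).

Lemma reflectK z : reflect (reflect z) = z.
Proof. by rewrite /reflect /= opprK -surjective_pairing. Qed.

Lemma reflect_norm z w : `|reflect z - reflect w| = `|z - w|.
Proof. by rewrite !prod_normE /= -opprD normrN. Qed.

Lemma contat_reflect P z : contat P (reflect z) -> contat (fun w => P (reflect w)) z.
Proof.
move=> Pc e e0; have [d d0 dP] := Pc e e0; exists d => // w wz.
by apply: dP; rewrite reflect_norm.
Qed.

Lemma contat_opp P z : contat P z -> contat (fun w => - P w) z.
Proof.
move=> Pc e e0; have [d d0 dP] := Pc e e0; exists d => // w wz.
by rewrite -opprD normrN; apply: dP.
Qed.

Hypothesis K_reflect : forall z, K z -> K (reflect z).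
Hypothesis nh : n%:R * h = 2 * c.

Lemma collar_reflect z : collar z -> collar (reflect z).
Proof.
move=> [[w Kw zw] nK]; split.
  by exists (reflect w); [exact: K_reflect | rewrite reflect_norm].
by move=> /K_reflect; rewrite reflectK.
Qed.

Lemma grid_reflect j : (j <= n)%N -> x (n - j)%N = - x j.
Proof. by move=> jn; rewrite /grid natrB// mulrBl nh; ring. Qed.

(** The reflection maps the lattice contour to itself with the opposite
    orientation; it keeps du and changes the sign of dv, so the form on
    the left-hand side is minus the pulled back one. *)
Lemma lattice_residue_reflect P Q : collar_cont P Q ->
  lattice_residue K (fun z => - P (reflect z)) (fun z => Q (reflect z)) c h n
  = lattice_residue K P Q c h n.
Proof.
move=> PQ; rewrite /lattice_residue.
pose rho (kl : 'I_n * 'I_n) := (kl.1, rev_ord kl.2).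
have rhoK : involutive rho by move=> [k l]; rewrite /rho /= rev_ordK.
rewrite [RHS](reindex_inj (inv_inj rhoK)) /=.
have rl (l : 'I_n) : x (n - l.+1).+1%N = - x l.
  by rewrite -subSn// subSS grid_reflect// ltnW.
have rl' (l : 'I_n) : x (n - l.+1)%N = - x l.+1 by rewrite grid_reflect.
have Km z : K z <-> K (reflect z).
  by split; [exact: K_reflect | move/K_reflect; rewrite reflectK].
have mrev (k l : 'I_n) : meets K c h k l = meets K c h k (n - l.+1)%N.
  apply: asbool_equiv_eq; split => -[z zr Kz]; exists (reflect z).
  - move: zr; rewrite /rect /= rl rl' => -[-> /andP[z1 z2]]; split => //.
    by rewrite !lerN2 z1 z2.
  - exact: K_reflect.
  - move: zr; rewrite /rect /= rl rl' => -[-> /andP[z1 z2]]; split => //.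
    by rewrite lerNr z2 lerNl.
  - exact: K_reflect.
apply: eq_big => [[k l]|[k l]] /=; first exact: mrev.
move=> mK; have mK' : meets K c h k (n - l.+1)%N by rewrite -mrev.
have EH (j : nat) : (j = l \/ j = l.+1 :> nat) ->
    cutH K (fun z => - P (reflect z)) c h k j = - cutH K P c h k (n - j)%N.
  move=> jj; have jn : (j <= n)%N by case: jj => ->; [exact: ltnW | exact: ltn_ord].
  have jj' : (n - j)%N = (n - l.+1)%N \/ (n - j)%N = (n - l.+1).+1%N.
    by case: jj => ->; [right; rewrite -subSn// subSS | left].
  rewrite /cutH grid_reflect//.
  have -> : `[< exists t, x k <= t <= x k.+1 /\ K (t, - x j) >] =
            `[< exists t, x k <= t <= x k.+1 /\ K (t, x j) >].
    by apply: asbool_equiv_eq; split => -[t [tt /Km]]; rewrite /reflect /= ?opprK; exists t.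
  case: asboolP => [_|no]; first by rewrite oppr0.
  have no' : ~ (exists t, x k <= t <= x k.+1 /\ K (t, x (n - j)%N)).
    by move=> [t [tt]]; rewrite grid_reflect// => /Km Kt; apply: no; exists t; move: Kt; rewrite /reflect /= opprK.
  have col := collarH mK' erefl jj' no'.
  rewrite /hint; apply: (@segint_lin R E E (fun v => - v) 1 (fun t => P (t, - x j))).
  - by move=> a u v; rewrite opprD scalerN.
  - by move=> v; rewrite normrN mul1r.
  rewrite (mM k).1 (mM k).2; apply: (@ucont_horizontal R E P _ _ (- x j)) => t /col.
  by rewrite grid_reflect// => /PQ[].
have EV (i : nat) : (i = k \/ i = k.+1 :> nat) ->
    cutV K (fun z => Q (reflect z)) c h i l = cutV K Q c h i (n - l.+1)%N.
  move=> ii; rewrite /cutV.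
  have -> : `[< exists t, x (n - l.+1)%N <= t <= x (n - l.+1).+1%N /\ K (x i, t) >] =
            `[< exists t, x l <= t <= x l.+1 /\ K (x i, t) >].
    apply: asbool_equiv_eq; rewrite rl rl'; split => -[t [/andP[t1 t2] /Km]] Kt; exists (- t).
      by split => //; rewrite lerNr t2 lerNl.
    by split => //; rewrite !lerN2 t1 t2.
  case: asboolP => // no.
  have no' : ~ (exists t, x (n - l.+1)%N <= t <= x (n - l.+1).+1%N /\ K (x i, t)).
    move=> [t [/andP[t1 t2] /Km Kt]]; apply: no; exists (- t); split => //.
    by move: t1 t2; rewrite rl rl' => t1 t2; rewrite lerNr t2 lerNl.
  have col := collarV mK' erefl ii no'.
  rewrite /vint rl rl'.
  apply: (@segint_reflect R E (fun t => Q (x i, t))).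
  have -> : Num.min (- x l) (- x l.+1) = x (n - l.+1)%N.
    by rewrite -rl -rl' min_r.
  have -> : Num.max (- x l) (- x l.+1) = x (n - l.+1).+1%N.
    by rewrite -rl -rl' max_l.
  by apply: ucont_vertical => t /col /PQ[].
have e1 : (n - l = (n - l.+1).+1)%N by rewrite -subSn// subSS.
by rewrite /dface !EH ?EV ?e1; [zmodule|left|right|right|left].
Qed.

(** By [lattice_residue_reflect], twice the residue of a form is the residue of
    the sum of the form and its reflected copy. *)
Lemma lattice_residue_even P Q P' Q' : collar_cont P Q -> collar_cont P' Q' ->
  (forall z, collar z -> P z - P (reflect z) = P' z - P' (reflect z) /\
     Q z + Q (reflect z) = Q' z + Q' (reflect z)) ->
  lattice_residue K P Q c h n = lattice_residue K P' Q' c h n.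
Proof.
move=> PQ PQ' e.
have sym P1 Q1 : collar_cont P1 Q1 ->
    collar_cont (fun z => - P1 (reflect z)) (fun z => Q1 (reflect z)).
  move=> PQ1 z /collar_reflect /PQ1[p q].
  by split; [apply: contat_opp|]; exact: contat_reflect.
have dbl P1 Q1 : collar_cont P1 Q1 ->
    lattice_residue K (fun z => P1 z - P1 (reflect z)) (fun z => Q1 z + Q1 (reflect z)) c h n
    = 2 *: lattice_residue K P1 Q1 c h n.
  move=> PQ1; rewrite lattice_residueD//; last exact: sym.
  by rewrite lattice_residue_reflect// scaler_nat mulr2n.
have : 2 *: lattice_residue K P Q c h n = 2 *: lattice_residue K P' Q' c h n.
  rewrite -!dbl//; apply: lattice_residue_ext e.
  move=> z cz; have [p q] := PQ z cz; have [p' q'] := sym _ _ PQ z cz.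
  split.
    move=> r r0; have r2 : 0 < r / 2 by rewrite divr_gt0.
    have [d1 d10 d1P] := p _ r2; have [d2 d20 d2P] := p' _ r2.
    exists (Num.min d1 d2) => [|w]; first by rewrite lt_min d10.
    rewrite lt_min => /andP[w1 w2].
    have -> : P w - P (reflect w) - (P z - P (reflect z)) =
      (P w - P z) + (- P (reflect w) - - P (reflect z)) by zmodule.
    by rewrite (le_trans (ler_normD _ _))// [r]splitr lerD ?d1P ?d2P.
  move=> r r0; have r2 : 0 < r / 2 by rewrite divr_gt0.
  have [d1 d10 d1P] := q _ r2; have [d2 d20 d2P] := q' _ r2.
  exists (Num.min d1 d2) => [|w]; first by rewrite lt_min d10.
  rewrite lt_min => /andP[w1 w2].
  have -> : Q w + Q (reflect w) - (Q z + Q (reflect z)) =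
    (Q w - Q z) + (Q (reflect w) - Q (reflect z)) by zmodule.
  by rewrite (le_trans (ler_normD _ _))// [r]splitr lerD ?d1P ?d2P.
by move/(congr1 ( *:%R 2^-1)); rewrite !scalerA mulVf ?scale1r// gt_eqF.
Qed.

End Residue.

(** * Holomorphy in a Banach algebra with an imaginary unit *)

Section ShrinkRectangle.
Variables (R : realType) (E : completeNormedModType R).
Implicit Types (P Q : R * R -> E).

(** The region between the two boundaries is cut into four rectangles on which
    the form is closed. *)
Lemma rint_shrink P Q a b c d (z : R * R) (e : R) : 0 < e ->
  a <= z.1 - e -> z.1 + e <= b -> c <= z.2 - e -> z.2 + e <= d ->
  (forall w, rect a b c d w -> w != z -> closedat P Q w) ->
  rint P Q a b c d = rint P Q (z.1 - e) (z.1 + e) (z.2 - e) (z.2 + e).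
Proof.
move=> e0 a1 b1 c1 d1 cl.
have z1 : z.1 - e < z.1 by rewrite gtrBl. have z1' : z.1 < z.1 + e by rewrite ltrDl.
have z2 : z.2 - e < z.2 by rewrite gtrBl. have z2' : z.2 < z.2 + e by rewrite ltrDl.
have a1b : a <= b by lra. have c1d : c <= d by lra.
have H x0 x1 y : a <= x0 -> x1 <= b -> c <= y <= d -> (y < z.2 \/ z.2 < y) ->
    ucont (fun t => P (t, y)) x0 x1.
  move=> ax xb ycd yz; apply: ucont_horizontal => t /andP[t1 t2].
  apply: (@closedat_contP _ _ _ Q); apply: cl.
    by split => //=; rewrite (le_trans ax)//= (le_trans t2).
  by apply/eqP => tz; case: yz; rewrite -tz ltxx.
have W x y0 y1 : c <= y0 -> y1 <= d -> a <= x <= b -> (x < z.1 \/ z.1 < x) ->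
    ucont (fun t => Q (x, t)) y0 y1.
  move=> cy yd xab xz; apply: ucont_vertical => t /andP[t1 t2].
  apply: (@closedat_contQ _ _ P); apply: cl.
    by split => //=; rewrite (le_trans cy)//= (le_trans t2).
  by apply/eqP => tz; case: xz; rewrite -tz ltxx.
have G x0 x1 y0 y1 : a <= x0 -> x0 <= x1 -> x1 <= b -> c <= y0 -> y0 <= y1 -> y1 <= d ->
    (x1 < z.1 \/ z.1 < x0 \/ y1 < z.2 \/ z.2 < y0) -> rint P Q x0 x1 y0 y1 = 0.
  move=> ax xx xb cy yy yd out; apply: goursat => // w [/andP[w1 w2] /andP[w3 w4]].
  apply: cl; first by split; apply/andP; split; lra.
  by apply/eqP => wz; move: w1 w2 w3 w4; rewrite wz => *; case: out => [|[|[]]] ?; lra.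
rewrite (@rint_hsplit _ _ P Q a (z.1 - e) b c d); first last.
- by apply: H => //; [rewrite lexx c1d | right; lra].
- by apply: H => //; [rewrite lexx c1d | left; lra].
- by rewrite a1; lra.
rewrite (G a (z.1 - e)) ?add0r//; [|lra|by left].
rewrite (@rint_hsplit _ _ P Q (z.1 - e) (z.1 + e) b c d); first last.
- by apply: H => //; [rewrite lexx c1d | right; lra].
- by apply: H => //; [rewrite lexx c1d | left; lra].
- by rewrite b1 andbT; lra.
rewrite (G (z.1 + e) b) ?addr0//; [|lra|by right; left].
rewrite (@rint_vsplit _ _ P Q _ _ c (z.2 - e) d); first last.
- by apply: W => //; [apply/andP; split; lra | right].
- by apply: W => //; [apply/andP; split; lra | left].
- by rewrite c1; lra.
rewrite (G _ _ c (z.2 - e)) ?add0r//; [|lra|lra|by right; right; left].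
rewrite (@rint_vsplit _ _ P Q _ _ (z.2 - e) (z.2 + e) d); first last.
- by apply: W => //; [apply/andP; split; lra | right].
- by apply: W => //; [apply/andP; split; lra | left].
- by rewrite d1 andbT; lra.
by rewrite (G _ _ (z.2 + e) d) ?addr0//; [lra|lra|right; right; right].
Qed.

Lemma rint_lin (E' : completeNormedModType R) (L : E -> E') C P Q a b c d :
  linear L -> (forall v, `|L v| <= C * `|v|) -> a <= b -> c <= d ->
  edge_cont P Q a b c d ->
  rint (fun z => L (P z)) (fun z => L (Q z)) a b c d = L (rint P Q a b c d).
Proof.
move=> Llin LC ab cd [c1 c2 c3 c4].
have [mab Mab] : Num.min a b = a /\ Num.max a b = b by rewrite min_l ?max_r.
have [mcd Mcd] : Num.min c d = c /\ Num.max c d = d by rewrite min_l ?max_r.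
have LD u v : L (u + v) = L u + L v by have := Llin 1 u v; rewrite !scale1r.
have LN v : L (- v) = - L v.
  have L0 : L 0 = 0 by apply: (addrI (L 0)); rewrite -LD !addr0.
  by apply: (addrI (L v)); rewrite -LD !subrr.
have L4 x y z w : L (x + y - z - w) = L x + L y - L z - L w by rewrite !LD !LN.
rewrite /rint /hint /vint L4.
rewrite (segint_lin Llin LC (phi := fun t => P (t, c))) ?mab ?Mab//.
rewrite (segint_lin Llin LC (phi := fun t => P (t, d))) ?mab ?Mab//.
rewrite (segint_lin Llin LC (phi := fun t => Q (a, t))) ?mcd ?Mcd//.
by rewrite (segint_lin Llin LC (phi := fun t => Q (b, t))) ?mcd ?Mcd.
Qed.

Lemma contat_bounded (g : R * R -> E) z r :
  (forall w, cball z r w -> contat g w) ->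
  exists2 M : R, 0 < M & forall w, cball z r w -> `|g w| <= M.
Proof.
move=> gc; pose S (d : R) w := `|g w| <= d^-1.
have cA : compact (`[z.1 - r, z.1 + r] `*` `[z.2 - r, z.2 + r]).
  by apply: compact_setX; exact: segment_compact.
have AE w : (`[z.1 - r, z.1 + r] `*` `[z.2 - r, z.2 + r])%classic w <-> cball z r w.
  by rewrite cballE /setX /= !in_itv /=; split => [[-> ->]|/andP[]].
have [||d d0 dP] := @compact_uniform R (R * R)%type _ S cA.
- move=> d d' w d'0 dd /le_trans; apply; rewrite lef_pV2 ?posrE//.
  exact: lt_le_trans d'0 dd.
- move=> w /AE wz; have [d d0 dP] := gc w wz _ ltr01.
  have g1 : 0 < (`|g w| + 1)^-1 by rewrite invr_gt0 ltr_wpDl.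
  exists (Num.min d (`|g w| + 1)^-1) => [|v _]; first by rewrite lt_min d0.
  rewrite -ball_normE /= lt_min => /andP[vd _].
  apply: (@le_trans _ _ (`|g w| + 1)).
    rewrite -[g v](subrK (g w)) addrC (le_trans (ler_normD _ _))// lerD2l.
    by apply: dP; rewrite distrC.
  by rewrite -[leLHS]invrK lef_pV2 ?posrE ?lt_min ?d0// ge_min lexx orbT.
by exists d^-1 => [|w /AE wz]; [rewrite invr_gt0 | exact: dP].
Qed.

End ShrinkRectangle.

Section BanachAlgebra.
Variables (R : realType) (V : completeNormedModType R) (n : nat).
Local Notation E := (cliff n (bop V)).
Implicit Types (f g S : R * R -> E) (z w : R * R).

Lemma linear_lmul (a : E) : linear (fun b : E => a * b : E).
Proof. by move=> k u v; rewrite mulrDr cliff_scalerAr. Qed.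

Lemma linear_rmul (b : E) : linear (fun a : E => a * b : E).
Proof. by move=> k u v; rewrite mulrDl cliff_scalerAl. Qed.

Lemma norm_lmul (a b : E) : `|a * b| <= `|a| * `|b|. Proof. exact: cliff_normM. Qed.

Lemma norm_rmul (a b : E) : `|a * b| <= `|b| * `|a|.
Proof. by rewrite mulrC cliff_normM. Qed.

Lemma diffat_mul f g z (A B A' B' : E) : diffat f z A B -> diffat g z A' B' ->
  diffat (fun w => f w * g w) z (A * g z + f z * A') (B * g z + f z * B').
Proof.
apply: (@diffat_bilin R E E E (fun x y => x * y) 1).
- exact: linear_rmul.
- exact: linear_lmul.
- by move=> x y; rewrite mul1r cliff_normM.
Qed.

Lemma diffat_scale (k : R * R -> R^o) g z (a b : R^o) (A B : E) :
  diffat k z a b -> diffat g z A B ->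
  diffat (fun w => k w *: g w) z (a *: g z + k z *: A) (b *: g z + k z *: B).
Proof.
apply: (@diffat_bilin R R^o E E (fun x y => x *: y) 1).
- by move=> y c u v /=; rewrite scalerDl -[c *: u]/(c * u) scalerA.
- by move=> x c u v /=; rewrite scalerDr !scalerA mulrC.
- by move=> x y; rewrite mul1r normrZ.
Qed.

Lemma normX_le (a : E) k : `|a ^+ k| <= `|a| ^+ k.
Proof.
elim: k => [|k IH]; first by rewrite !expr0 cliff_norm1.
by rewrite !exprS (le_trans (cliff_normM _ _))// ler_wpM2l.
Qed.

Section ImaginaryUnit.
Variable i : E.
Hypothesis ii : i * i = -1.

(** The Cauchy-Riemann equations g_u + i g_v = 0 and g_u + g_v i = 0; the algebra
    is not commutative and both sides occur. *)
Definition lholo g z := exists A B : E, diffat g z A B /\ A + i * B = 0.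
Definition rholo g z := exists A B : E, diffat g z A B /\ A + B * i = 0.

Lemma lholo_cont g z : lholo g z -> contat g z.
Proof. by case=> A [B [D _]]; exact: diffat_cont D. Qed.

(** In the product rule for S dz g, with dz = du + i dv, the Cauchy-Riemann
    equations of S and of g are used on the two sides of dz. *)
Lemma closedat_product S g z : rholo S z -> lholo g z ->
  closedat (fun w => S w * g w) (fun w => S w * i * g w) z.
Proof.
move=> [A [B [dS AB]]] [A' [B' [dg AB']]].
have eA : A = - (B * i) by apply/eqP; rewrite -addr_eq0 AB.
have eA' : A' = - (i * B') by apply/eqP; rewrite -addr_eq0 AB'.
have dSi : diffat (fun w => S w * i) z (A * i) (B * i).
  exact: (diffat_lin (linear_rmul i) (fun a => norm_rmul a i) dS).
exists (A * g z + S z * A'), (B * g z + S z * B'), (B * i * g z + S z * i * B').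
split; first exact: diffat_mul.
apply: diffat_eq (diffat_mul dSi dg) _ _ => //.
have l1 : A * i = B by rewrite eA mulNr -mulrA ii mulrN1 opprK.
have l2 : i * A' = B' by rewrite eA' mulrN mulrA ii mulN1r opprK.
by rewrite l1 -(mulrA (S z)) l2.
Qed.

(** The copy of the complex plane in the algebra. *)
Definition cpx z : E := z.1 *: (1 : E) + z.2 *: (i : E).

Lemma cpxB z w : cpx (z - w) = cpx z - cpx w.
Proof. by rewrite /cpx /= !scalerBl; zmodule. Qed.

Definition cmulp z w : R * R := (z.1 * w.1 - z.2 * w.2, z.1 * w.2 + z.2 * w.1).

Lemma cpxM z w : cpx z * cpx w = cpx (cmulp z w).
Proof.
rewrite /cpx /cmulp /= mulrDl !mulrDr -!cliff_scalerAl -!cliff_scalerAr !mul1r !mulr1 ii.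
by rewrite !scalerA ?mulrN1 ?scaleNr ?scalerN scalerBl scalerDl; zmodule.
Qed.

Lemma cpx_comm z w : GRing.comm (cpx z) (cpx w).
Proof. by rewrite /GRing.comm !cpxM; congr cpx; rewrite /cmulp; congr pair; ring. Qed.

Lemma cpx_i : cpx (0, 1) = i. Proof. by rewrite /cpx scale0r add0r scale1r. Qed.

Lemma cpx_commi z : cpx z * i = i * cpx z.
Proof. by have := cpx_comm z (0, 1); rewrite cpx_i. Qed.

(** The inverse of [cpx z] as conjugate over squared modulus. *)
Definition cinv z : E := cpx (invsq z * z.1, - (invsq z * z.2)).

Lemma cinvK z : z != 0 -> cinv z * cpx z = 1.
Proof.
rewrite -sqnorm_eq0 => z0; rewrite /cinv cpxM /cmulp /= /cpx /=.
have -> : invsq z * z.1 * z.1 - - (invsq z * z.2) * z.2 = 1.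
  by rewrite -[RHS](mulVf z0) /invsq /sqnorm; ring.
have -> : invsq z * z.1 * z.2 + - (invsq z * z.2) * z.1 = 0 by ring.
by rewrite scale1r scale0r addr0.
Qed.

Let kap : R := `|1 : E| + `|i|.

Lemma cpx_le z : `|cpx z| <= kap * `|z|.
Proof.
rewrite /cpx (le_trans (ler_normD _ _))// !normrZ /kap mulrDl.
by rewrite !(mulrC _ `|z|); apply: lerD; apply: ler_wpM2r; rewrite ?prod_norm_fst ?prod_norm_snd.
Qed.

Lemma sqnorm_ge z : `|z| ^+ 2 <= sqnorm z.
Proof.
rewrite /sqnorm -!expr2 prod_normE; case: (leP `|z.1| `|z.2|) => _.
  by rewrite -normrX ger0_norm ?sqr_ge0// lerDr sqr_ge0.
by rewrite -normrX ger0_norm ?sqr_ge0// lerDl sqr_ge0.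
Qed.

Lemma cinv_le z : z != 0 -> `|cinv z| <= kap / `|z|.
Proof.
move=> z0; have nz : 0 < `|z| by rewrite normr_gt0.
have sz : 0 < sqnorm z by apply: lt_le_trans (sqnorm_ge z); rewrite exprn_gt0.
rewrite (le_trans (cpx_le _))//; apply: ler_wpM2l; first by rewrite addr_ge0.
have iz : `|invsq z| <= `|z| ^- 2.
  by rewrite /invsq normfV ger0_norm ?(ltW sz)// lef_pV2 ?posrE ?exprn_gt0// sqnorm_ge.
rewrite prod_norm_le /= normrN !normrM.
have -> : `|z|^-1 = `|z| ^- 2 * `|z| by field; rewrite gt_eqF.
by apply/andP; split; apply: ler_pM; rewrite ?prod_norm_fst ?prod_norm_snd.
Qed.

Lemma diffat_cpx z : diffat cpx z 1 i.
Proof.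
have c1 := diffat_scale (diffat_fst z) (diffat_cst (1 : E) z).
have c2 := diffat_scale (diffat_snd z) (diffat_cst i z).
apply: diffat_eq (diffatD c1 c2) _ _.
  by rewrite !scaler0 scale1r scale0r !addr0.
by rewrite !scaler0 scale1r scale0r !addr0 add0r.
Qed.

Lemma rholo_cinv z : z != 0 -> rholo cinv z.
Proof.
move=> z0; have I := diffat_invsq z0.
have D1 := diffat_scale (diffat_fst z) (diffat_cst (1 : E) z).
have D2 := diffat_scale (diffat_snd z) (diffat_cst i z).
have D := diffat_scale I (diffatD D1 (diffatN D2)).
have eq : (fun w => (invsq w : R) *: (w.1 *: (1 : E) + - (w.2 *: (i : E)))) = cinv.
  apply/funext => w; rewrite /cinv /cpx /= scalerDr scalerN !scalerA scaleNr.
  by [].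
rewrite eq in D; do 2 eexists; split; first exact: D.
have key : invsq z = invsq z ^+ 2 * sqnorm z.
  by rewrite expr2 -mulrA mulVf ?mulr1// sqnorm_eq0.
rewrite !scaler0 !scale1r !scale0r !addr0 !oppr0 !addr0 !add0r.
have e1 : (z.1 *: (1 : E) - z.2 *: i) * i = z.1 *: i + z.2 *: (1 : E).
  by rewrite mulrBl -!cliff_scalerAl mul1r ii scalerN opprK.
rewrite [X in _ + X = _]mulrDl -!cliff_scalerAl e1 ii scaleN1r opprK !scalerBr !scalerDr !scalerA.
set rho := invsq z in key *; set p := z.1; set q := z.2.
transitivity ((2 * (rho - rho ^+ 2 * sqnorm z)) *: (1 : E)); last first.
  by rewrite -key subrr mulr0 scale0r.
rewrite /sqnorm -/p -/q.
have -> : 2 * (rho - rho ^+ 2 * (p * p + q * q)) =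
  (- rho ^+ 2 * (2 * p) * p) + rho + ((- rho ^+ 2 * (2 * q) * q) + rho) by ring.
have -> : - rho ^+ 2 * (2 * p) * q = - rho ^+ 2 * (2 * q) * p by ring.
by rewrite !scalerDl; zmodule.
Qed.

Lemma rholo_shift S p z : rholo S (z - p) -> rholo (fun w => S (w - p)) z.
Proof. by move=> [A [B [D e]]]; exists A, B; split; [exact: diffat_shift D | exact: e]. Qed.

Lemma rholo_mul S S' z : rholo S z -> rholo S' z -> S' z * i = i * S' z ->
  rholo (fun w => S w * S' w) z.
Proof.
move=> [A [B [D e]]] [A' [B' [D' e']]] c; do 2 eexists; split.
  exact: diffat_mul D D'.
rewrite mulrDl -!mulrA c !mulrA.
transitivity ((A + B * i) * S' z + S z * (A' + B' * i)).
  by rewrite mulrDl mulrDr !mulrA; zmodule.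
by rewrite e e' mul0r mulr0 addr0.
Qed.

Lemma rholo_cst1 z : rholo (fun=> 1) z.
Proof. by exists 0, 0; split; [exact: diffat_cst | rewrite mul0r addr0]. Qed.

Lemma rholo_exp S k z : rholo S z -> S z * i = i * S z ->
  rholo (fun w => S w ^+ k) z.
Proof.
move=> h c; elim: k => [|k IH]; first exact: rholo_cst1.
rewrite (_ : (fun w => _) = fun w => S w * S w ^+ k); last first.
  by apply/funext => w; rewrite exprS.
apply: rholo_mul => //; apply: commr_sym; apply: commrX; exact: commr_sym.
Qed.

End ImaginaryUnit.
End BanachAlgebra.

(** * Cauchy's formula on a square *)

Section SquareBoundary.
Variables (R : realType) (E : completeNormedModType R).
Implicit Types (P Q : R * R -> E) (z w : R * R) (r : R).

Definition bsquare z r : set (R * R) :=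
  [set w | rect (z.1 - r) (z.1 + r) (z.2 - r) (z.2 + r) w /\
     [|| w.1 == z.1 - r, w.1 == z.1 + r, w.2 == z.2 - r | w.2 == z.2 + r]].

Lemma bsquare_norm z r w : 0 <= r -> bsquare z r w -> `|w - z| = r.
Proof.
move=> r0 [[w1 w2] wb]; apply/eqP; rewrite eq_le; apply/andP; split.
  by rewrite prod_norm_le !ler_distl w1.
have h (x y : R) : x = y - r \/ x = y + r -> r <= `|x - y|.
  by case=> ->; rewrite (addrAC y) subrr add0r ?normrN ger0_norm.
case/or4P: wb => /eqP e.
- by apply: le_trans (prod_norm_fst _); apply: h; left.
- by apply: le_trans (prod_norm_fst _); apply: h; right.
- by apply: le_trans (prod_norm_snd _); apply: h; left.
- by apply: le_trans (prod_norm_snd _); apply: h; right.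
Qed.

Lemma bsquare_cball z r w : 0 <= r -> bsquare z r w -> cball z r w.
Proof. by move=> r0 wb; rewrite /cball /= (bsquare_norm r0 wb). Qed.

Definition sqint P Q z r := rint P Q (z.1 - r) (z.1 + r) (z.2 - r) (z.2 + r).
Definition sqcont P Q z r := edge_cont P Q (z.1 - r) (z.1 + r) (z.2 - r) (z.2 + r).

Lemma sqcont_bsquare P Q z r : 0 <= r -> (forall w, bsquare z r w -> closedat P Q w) ->
  sqcont P Q z r.
Proof.
move=> r0 cl; have rr (x : R) : x - r <= x + r by lra.
have bP y : [|| y == z.2 - r | y == z.2 + r] -> z.2 - r <= y <= z.2 + r ->
    ucont (fun t => P (t, y)) (z.1 - r) (z.1 + r).
  move=> yb yr; apply: ucont_horizontal => t tt; apply: (@closedat_contP _ _ P Q).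
  by apply: cl; split; rewrite /rect /= ?tt ?yr ?yb ?orbT.
have bQ x : [|| x == z.1 - r | x == z.1 + r] -> z.1 - r <= x <= z.1 + r ->
    ucont (fun t => Q (x, t)) (z.2 - r) (z.2 + r).
  move=> xb xr; apply: ucont_vertical => t tt; apply: (@closedat_contQ _ _ P Q).
  by apply: cl; split; rewrite /rect /= ?tt ?xr// orbA xb.
by split; [apply: bP|apply: bP|apply: bQ|apply: bQ]; rewrite ?eqxx ?orbT// ?lexx ?rr.
Qed.

Lemma sqint_ext P Q P' Q' z r : 0 <= r -> sqcont P Q z r ->
  (forall w, bsquare z r w -> P w = P' w /\ Q w = Q' w) ->
  sqint P Q z r = sqint P' Q' z r.
Proof.
move=> r0 c e; apply: rint_ext c _; [lra|lra|].
by move=> w wr wb; apply: e; split.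
Qed.

Lemma sqintD P Q P' Q' z r : 0 <= r -> sqcont P Q z r -> sqcont P' Q' z r ->
  sqint (fun w => P w + P' w) (fun w => Q w + Q' w) z r = sqint P Q z r + sqint P' Q' z r.
Proof. by move=> r0 c c'; apply: rintD c c'; lra. Qed.

Lemma sqint_le P Q z r (M : R) : 0 <= r -> sqcont P Q z r ->
  (forall w, bsquare z r w -> `|P w| <= M /\ `|Q w| <= M) ->
  `|sqint P Q z r| <= 8 * M * r.
Proof.
move=> r0 c PQ.
have -> : 8 * M * r = 2 * M * ((z.1 + r - (z.1 - r)) + (z.2 + r - (z.2 - r))) by ring.
by apply: rint_le c _; [lra|lra|move=> w wr wb; apply: PQ; split].
Qed.

End SquareBoundary.

Lemma sqint_lin (R : realType) (E E' : completeNormedModType R) (L : E -> E') C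
    (P Q : R * R -> E) z r :
  linear L -> (forall v, `|L v| <= C * `|v|) -> 0 <= r -> sqcont P Q z r ->
  sqint (fun w => L (P w)) (fun w => L (Q w)) z r = L (sqint P Q z r).
Proof. by move=> Ll LC r0 c; apply: rint_lin Ll LC _ _ c; lra. Qed.

Section CauchyFormula.
Variables (R : realType) (V : completeNormedModType R) (n : nat).
Local Notation E := (cliff n (bop V)).
Variable i : E.
Hypothesis ii : i * i = -1.
Implicit Types (g S : R * R -> E) (z w : R * R).

Let kap : R := `|1 : E| + `|i|.
Let kap_ge0 : 0 <= kap. Proof. by rewrite addr_ge0. Qed.

Lemma small_le0 (y C e0 : R) : 0 < e0 -> (forall e, 0 < e -> e < e0 -> y <= C * e) -> y <= 0.
Proof.
move=> e00 H; rewrite leNgt; apply/negP => y0.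
have C1 : 0 < `|C| + 1 by rewrite ltr_wpDl.
pose e := Num.min (e0 / 2) (y / (2 * (`|C| + 1))).
have e_gt0 : 0 < e by rewrite lt_min !divr_gt0// mulr_gt0.
have ee0 : e < e0 by rewrite gt_min gtr_pMr// invf_lt1// ltr1n.
have := H e e_gt0 ee0; apply/negP; rewrite -ltNge.
apply: (@le_lt_trans _ _ ((`|C| + 1) * e)).
  by rewrite ler_wpM2r ?(ltW e_gt0)// (le_trans (ler_norm C))// lerDl.
apply: (@le_lt_trans _ _ ((`|C| + 1) * (y / (2 * (`|C| + 1))))).
  by rewrite ler_wpM2l ?(ltW C1)// ge_min lexx orbT.
have -> : (`|C| + 1) * (y / (2 * (`|C| + 1))) = y / 2 by field; rewrite gt_eqF.
by rewrite gtr_pMr// invf_lt1// ltr1n.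
Qed.

Lemma lholo_cst (v : E) z : lholo i (fun=> v) z.
Proof. by exists 0, 0; split; [exact: diffat_cst | rewrite mulr0 addr0]. Qed.

Lemma lholoB g g' z : lholo i g z -> lholo i g' z -> lholo i (fun w => g w - g' w) z.
Proof.
move=> [A [B [D e]]] [A' [B' [D' e']]]; exists (A - A'), (B - B'); split.
  exact: (diffatD D (diffatN D')).
by rewrite mulrBr addrACA e add0r -opprD e' oppr0.
Qed.

(** The real and imaginary parts of the Cauchy kernel are the coefficients of the
    angular form. *)
Lemma cinv_arg z w : cinv i (w - z) = argQ z w *: (1 : E) + argP z w *: i.
Proof. by rewrite /cinv /cpx /argP /argQ /= ![invsq _ * _]mulrC. Qed.

(** The imaginary part of dz/z is the angular form, and the real part, the
    differential of log |z|, integrates to 0 by the symmetry of the square. *)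
Lemma sqint_cauchy_kernel z (e : R) (v : E) : 0 < e ->
  sqint (fun w => cinv i (w - z) * v) (fun w => cinv i (w - z) * i * v) z e
  = (2 * pi) *: (i * v).
Proof.
move=> e0; have e0' := ltW e0.
have clA w : bsquare z e w -> closedat (argP z) (argQ z) w.
  move=> /(bsquare_norm e0') wz; apply: closedat_arg.
  by rewrite -subr_eq0 -normr_gt0 wz.
have cA : sqcont (argP z) (argQ z) z e by exact: sqcont_bsquare.
have [u1 u2 u3 u4] := cA.
have uN f x0 x1 : @ucont R R^o f x0 x1 -> @ucont R R^o (fun t => - f t) x0 x1.
  by apply: (@ucont_lin R R^o R^o (fun v => - v) 1) => [k u u'|u];
    rewrite ?opprD ?scalerN// normrN mul1r.
have argPb t : argP z (t, z.2 - e) = - argP z (t, z.2 + e).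
  rewrite /argP /invsq /sqnorm /= !(addrAC _ _ (- z.2)) subrr !add0r mulrNN.
  by rewrite !mulNr.
have argQb t : argQ z (t, z.2 - e) = argQ z (t, z.2 + e).
  by rewrite /argQ /invsq /sqnorm /= !(addrAC _ _ (- z.2)) subrr !add0r mulrNN.
have argPl t : argP z (z.1 - e, t) = argP z (z.1 + e, t).
  by rewrite /argP /invsq /sqnorm /= !(addrAC _ _ (- z.1)) subrr !add0r mulrNN.
have uQ : forall y, (y = z.2 - e \/ y = z.2 + e) ->
    ucont (fun t => argQ z (t, y)) (z.1 - e) (z.1 + e).
  move=> y yy; apply: ucont_horizontal => t tt; apply: closedat_contQ; apply: clA.
  split; first by split => //=; case: yy => ->; apply/andP; split; lra.
  by case: yy => -> /=; rewrite eqxx ?orbT.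
have uP : forall x, (x = z.1 - e \/ x = z.1 + e) ->
    ucont (fun t => argP z (x, t)) (z.2 - e) (z.2 + e).
  move=> x xe; apply: ucont_vertical => t tt; apply: closedat_contP; apply: clA.
  split; first by split => //=; case: xe => ->; apply/andP; split; lra.
  by case: xe => -> /=; rewrite eqxx ?orbT.
have cB : sqcont (argQ z) (fun w => - argP z w) z e.
  by split; [apply: uQ; left|apply: uQ; right|apply: uN; apply: uP; left|
             apply: uN; apply: uP; right].
have zeroB : sqint (argQ z) (fun w => - argP z w) z e = 0.
  rewrite /sqint /rint /hint /vint.
  have -> : (fun t => argQ z (t, z.2 - e)) = (fun t => argQ z (t, z.2 + e)).
    by apply/funext => t.
  have -> : (fun t => - argP z (z.1 - e, t)) = (fun t => - argP z (z.1 + e, t)).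
    by apply/funext => t; rewrite argPl.
  zmodule.
have -> : (fun w => cinv i (w - z) * v) = (fun w => argP z w *: (i * v) + argQ z w *: v).
  apply/funext => w; rewrite cinv_arg mulrDl -!cliff_scalerAl mul1r addrC.
  by [].
have -> : (fun w => cinv i (w - z) * i * v) =
          (fun w => argQ z w *: (i * v) + (- argP z w) *: v).
  apply/funext => w; rewrite cinv_arg 2!mulrDl -!cliff_scalerAl mul1r ii mulN1r.
  by move: (argP z w) (argQ z w) => p q; rewrite scalerN scaleNr.
have lin u := @sqint_lin R R^o E (fun k => k *: u) `|u| _ _ z e (linear_scalev u) (norm_scalev_le u) e0'.
have cl (u : E) (P Q : R * R -> R^o) : sqcont P Q z e ->
    sqcont (fun w => P w *: u) (fun w => Q w *: u) z e.
  by move=> [c1 c2 c3 c4]; split;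
    apply: (@ucont_lin R E R^o (fun k => k *: u) `|u| _ _ _ (linear_scalev u) (norm_scalev_le u)).
rewrite sqintD// ?lin//; try exact: cl.
by rewrite zeroB scale0r addr0 /sqint rint_arg_square.
Qed.

Section OnSquare.
Variables (z0 : R * R) (r : R) (g : R * R -> E).
Hypothesis r0 : 0 < r.
Hypothesis g_holo : forall w, cball z0 r w -> lholo i g w.

(** The square is shrunk to z, where g is constant up to a Lipschitz error. *)
Lemma cauchy_square z : `|z - z0| < r ->
  sqint (fun w => cinv i (w - z) * g w) (fun w => cinv i (w - z) * i * g w) z0 r
  = (2 * pi) *: (i * g z).
Proof.
move=> zr; set X := sqint _ _ _ _.
have zc : cball z0 r z by exact: ltW.
have [A [B [D _]]] := g_holo zc; have [d d0 dP] := diffat_lip D.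
set a := `|A| + `|B| + 1 in dP; have a0 : 0 <= a by rewrite !addr_ge0.
have m0 : 0 < Num.min d (r - `|z - z0|) by rewrite lt_min d0 subr_gt0.
apply/eqP; rewrite -subr_eq0 -normr_le0.
apply: (@small_le0 _ (8 * (kap * a * (1 + `|i|))) _ m0) => e e0.
rewrite lt_min => /andP[ed er]; have e0' := ltW e0.
have inr w : cball z e w -> cball z0 r w.
  move=> we; rewrite /cball /= (le_trans (ler_distD z _ _))//.
  have := we; rewrite /cball /=; lra.
have cK h : (forall w, cball z0 r w -> lholo i h w) -> forall w, cball z0 r w -> w != z ->
    closedat (fun w => cinv i (w - z) * h w) (fun w => cinv i (w - z) * i * h w) w.
  move=> hh w wc wz; apply: closedat_product; [exact: ii| |exact: hh].
  by apply: rholo_shift; apply: rholo_cinv => //; rewrite subr_eq0.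
have XE : X = sqint (fun w => cinv i (w - z) * g w) (fun w => cinv i (w - z) * i * g w) z e.
  have := @inr (z.1 - e, z.2 - e); have := @inr (z.1 + e, z.2 + e).
  rewrite !cballE /= !lexx; have ee (x : R) : x - e <= x + e by lra.
  rewrite !ee => /(_ isT)/andP[/andP[_ b1] /andP[_ b2]] /(_ isT)/andP[/andP[b3 _] /andP[b4 _]].
  apply: rint_shrink => // w [w1 w2]; apply: cK => //.
  by rewrite cballE w1.
have bz w : bsquare z e w -> cball z0 r w /\ w != z.
  move=> wb; split; first by apply: inr; exact: bsquare_cball.
  by rewrite -subr_eq0 -normr_gt0 (bsquare_norm e0' wb).
have hB w : cball z0 r w -> lholo i (fun w => g w - g z) w.
  by move=> wc; apply: lholoB; [exact: g_holo | exact: lholo_cst].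
have c1 : sqcont (fun w => cinv i (w - z) * (g w - g z))
    (fun w => cinv i (w - z) * i * (g w - g z)) z e.
  by apply: sqcont_bsquare => // w /bz[wc wz]; exact: (cK _ hB w wc wz).
have c2 : sqcont (fun w => cinv i (w - z) * g z) (fun w => cinv i (w - z) * i * g z) z e.
  apply: sqcont_bsquare => // w /bz[wc wz].
  exact: (cK (fun=> g z) (fun w' _ => lholo_cst (g z) w') w wc wz).
have -> : X = sqint (fun w => cinv i (w - z) * (g w - g z))
    (fun w => cinv i (w - z) * i * (g w - g z)) z e + (2 * pi) *: (i * g z).
  have e1 : (fun w => cinv i (w - z) * g w) =
      (fun w => cinv i (w - z) * (g w - g z) + cinv i (w - z) * g z).
    by apply/funext => w; rewrite -mulrDr subrK.
  have e2 : (fun w => cinv i (w - z) * i * g w) =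
      (fun w => cinv i (w - z) * i * (g w - g z) + cinv i (w - z) * i * g z).
    by apply/funext => w; rewrite -mulrDr subrK.
  by rewrite XE e1 e2 (sqintD e0' c1 c2) sqint_cauchy_kernel.
rewrite addrK; apply: sqint_le => // w wb; have [_ wz] := bz w wb.
have wze := bsquare_norm e0' wb.
have k1 : `|cinv i (w - z)| <= kap / e by rewrite -wze; apply: cinv_le => //; rewrite subr_eq0.
have k2 : `|g w - g z| <= a * e by rewrite -wze; apply: dP; rewrite wze.
have ka : kap / e * (a * e) = kap * a by field; rewrite gt_eqF.
have kA : 0 <= kap * a by rewrite mulr_ge0.
have ke : 0 <= kap / e by rewrite divr_ge0.
split.
  rewrite (le_trans (cliff_normM _ _))// (le_trans (ler_pM _ _ k1 k2))// ka.
  by rewrite ler_peMr// lerDl.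
rewrite (le_trans (cliff_normM _ _))//.
apply: (@le_trans _ _ (kap / e * `|i| * (a * e))).
  apply: ler_pM => //; rewrite (le_trans (cliff_normM _ _))//.
  by rewrite ler_wpM2r.
rewrite mulrAC ka; apply: ler_wpM2l => //.
by rewrite lerDr.
Qed.

End OnSquare.

End CauchyFormula.

(** * Unique continuation *)

(** With a and b inverse to al and be: b = a + (al - be) a b. *)
Lemma resolvent_step (A : pzRingType) (p a b al be : A) :
  al * p = p * al -> be * p = p * be -> be * a = a * be -> al * a = 1 -> be * b = 1 ->
  p * b = p * a + (al - be) * (p * a * b).
Proof.
move=> alp bep bea ala beb.
have e1 : al * (p * a * b) = p * b by rewrite !mulrA alp -(mulrA p) ala mulr1.
have e2 : be * (p * a * b) = p * a.
  by rewrite !mulrA bep -(mulrA p) bea mulrA -mulrA beb mulr1.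
by rewrite mulrBl e1 e2 addrC subrK.
Qed.

Lemma comm_shift (A : pzRingType) (a i p v : A) :
  i * a = a * i -> a * (i * (p * v)) = i * (a * p * v).
Proof. by move=> h; rewrite mulrA -h -!mulrA. Qed.

Section UniqueContinuation.
Variables (R : realType) (V : completeNormedModType R) (n : nat).
Local Notation E := (cliff n (bop V)).
Variable i : E.
Hypothesis ii : i * i = -1.
Implicit Types (g S : R * R -> E) (z w : R * R).

Let kap : R := `|1 : E| + `|i|.
Let kap_ge0 : 0 <= kap. Proof. by rewrite addr_ge0. Qed.

Variables (z0 : R * R) (r : R) (g : R * R -> E).
Hypothesis r0 : 0 < r.
Hypothesis g_holo : forall w, cball z0 r w -> lholo i g w.

(** The integral of S dz g along the boundary of the square. *)
Definition kint S := sqint (fun w => S w * g w) (fun w => S w * i * g w) z0 r.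
Definition kernel S := forall w, bsquare z0 r w -> rholo i S w.

Lemma kernel_cont S : kernel S ->
  sqcont (fun w => S w * g w) (fun w => S w * i * g w) z0 r.
Proof.
move=> Sk; apply: sqcont_bsquare; first exact: ltW.
move=> w wb; apply: (closedat_product ii (Sk w wb)).
by apply: g_holo; apply: bsquare_cball wb; exact: ltW.
Qed.

Lemma kintD S S' : kernel S -> kernel S' ->
  kint (fun w => S w + S' w) = kint S + kint S'.
Proof.
move=> h h'; rewrite /kint -(sqintD (ltW r0) (kernel_cont h) (kernel_cont h')).
have -> : (fun w => (S w + S' w) * g w) = (fun w => S w * g w + S' w * g w).
  by apply/funext => w; rewrite mulrDl.
have -> : (fun w => (S w + S' w) * i * g w) = (fun w => S w * i * g w + S' w * i * g w).
  by apply/funext => w; rewrite !mulrDl.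
by [].
Qed.

Lemma kint_lmul (a : E) S : kernel S -> kint (fun w => a * S w) = a * kint S.
Proof.
move=> h; rewrite /kint.
rewrite -(sqint_lin (linear_lmul a) (norm_lmul a) (ltW r0) (kernel_cont h)).
have -> : (fun w => a * S w * g w) = (fun w => a * (S w * g w)).
  by apply/funext => w; rewrite mulrA.
have -> : (fun w => a * S w * i * g w) = (fun w => a * (S w * i * g w)).
  by apply/funext => w; rewrite !mulrA.
by [].
Qed.

Lemma kint_ext S S' : kernel S -> (forall w, bsquare z0 r w -> S w = S' w) ->
  kint S = kint S'.
Proof.
move=> h e; apply: (sqint_ext (ltW r0) (kernel_cont h)) => w wb.
by rewrite (e w wb).
Qed.

Lemma kernel_lmul (a : E) S : kernel S -> kernel (fun w => a * S w).
Proof.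
move=> h w /h[A [B [D e]]]; exists (a * A), (a * B); split.
  exact: (diffat_lin (linear_lmul a) (norm_lmul a) D).
by rewrite -mulrA -mulrDr e mulr0.
Qed.

Definition powk k w := cinv i (w - z0) ^+ k.

Lemma kernel_cinv z : `|z - z0| < r -> kernel (fun w => cinv i (w - z)).
Proof.
move=> zr w wb; apply: rholo_shift; apply: (rholo_cinv ii).
apply: contraTneq zr => /eqP; rewrite subr_eq0 => /eqP <-.
by rewrite (bsquare_norm (ltW r0) wb) ltxx.
Qed.

Lemma kernel_powk k : kernel (powk k).
Proof.
have z0r : `|z0 - z0| < r by rewrite subrr normr0.
move=> w wb; apply: rholo_exp; first exact: (kernel_cinv z0r wb).
exact: (cpx_commi ii).
Qed.

Lemma kernel_pow_cinv k z : `|z - z0| < r -> kernel (fun w => powk k w * cinv i (w - z)).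
Proof.
move=> zr w wb; apply: rholo_mul; [exact: kernel_powk|exact: kernel_cinv|].
exact: (cpx_commi ii).
Qed.

Lemma kernel_step k z w : `|z - z0| < r -> bsquare z0 r w ->
  powk k w * cinv i (w - z) =
  powk k.+1 w + cpx i (z - z0) * (powk k.+1 w * cinv i (w - z)).
Proof.
move=> zr wb; have rle := ltW r0.
have w0 : w - z0 != 0 by rewrite -normr_gt0 (bsquare_norm rle wb).
have wz : w - z != 0.
  by apply: contraTneq zr => /eqP; rewrite subr_eq0 => /eqP <-; rewrite (bsquare_norm rle wb) ltxx.
have d : z - z0 = (w - z0) - (w - z).
  by zmodule.
have cm z1 z2 : cpx i z1 * cinv i z2 = cinv i z2 * cpx i z1 by exact: (cpx_comm ii).
have cmk z1 : cpx i z1 * powk k w = powk k w * cpx i z1.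
  by apply: commrX; exact: cm.
have cc z1 z2 : cinv i z1 * cinv i z2 = cinv i z2 * cinv i z1 by exact: (cpx_comm ii).
rewrite d cpxB /powk exprSr; apply: resolvent_step.
- exact: cmk.
- exact: cmk.
- exact: cm.
- by rewrite cm; exact: (cinvK ii w0).
- by rewrite cm; exact: (cinvK ii wz).
Qed.

(** For x = w - z0 and y = z - z0 the identity of kernels is
    x^-k (x - y)^-1 = x^-(k+1) + y x^-(k+1) (x - y)^-1. *)
Lemma kint_step k z : `|z - z0| < r ->
  kint (fun w => powk k w * cinv i (w - z)) =
  kint (powk k.+1) + cpx i (z - z0) * kint (fun w => powk k.+1 w * cinv i (w - z)).
Proof.
move=> zr; rewrite -kint_lmul; last exact: kernel_pow_cinv.
rewrite -kintD; [|exact: kernel_powk|].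
  by apply: kint_ext => [|w wb]; [exact: kernel_pow_cinv | exact: kernel_step].
by apply: kernel_lmul; exact: kernel_pow_cinv.
Qed.

Lemma kint_bound : exists2 C : R, 0 <= C & forall k z, `|z - z0| <= r / 2 ->
  `|kint (fun w => powk k w * cinv i (w - z))| <= C * (kap / r) ^+ k.
Proof.
have gc w : cball z0 r w -> contat g w by move=> /g_holo /lholo_cont.
have [M M0 MP] := contat_bounded gc.
exists (8 * (kap / (r / 2) * (1 + `|i|) * M) * r).
  have rle := ltW r0; have Mle := ltW M0.
  by rewrite !mulr_ge0 ?invr_ge0 ?mulr_ge0 ?invr_ge0 ?addr_ge0.
move=> k z zr; have rle := ltW r0.
have zr' : `|z - z0| < r by rewrite (le_lt_trans zr)// gtr_pMr// invf_lt1// ltr1n.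
have kr : 0 <= kap / r by rewrite divr_ge0.
have kr2 : 0 <= kap / (r / 2) by rewrite mulr_ge0 ?invr_ge0 ?mulr_ge0 ?invr_ge0.
have K w : bsquare z0 r w -> `|powk k w * cinv i (w - z)| <= (kap / r) ^+ k * (kap / (r / 2)).
  move=> wb; have wn := bsquare_norm rle wb.
  have w0 : w - z0 != 0 by rewrite -normr_gt0 wn.
  have wz : r / 2 <= `|w - z|.
    have := ler_distD z w z0; rewrite wn => h; lra.
  have wz0 : w - z != 0 by rewrite -normr_gt0 (lt_le_trans _ wz)// divr_gt0.
  rewrite (le_trans (cliff_normM _ _))//; apply: ler_pM => //.
    rewrite (le_trans (normX_le _ _))//; apply: lerXn2r; rewrite ?nnegrE//.
    by rewrite -wn; exact: cinv_le.
  rewrite (le_trans (cinv_le i wz0))//; apply: ler_wpM2l => //.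
  by rewrite lef_pV2 ?posrE// ?divr_gt0// (lt_le_trans _ wz)// divr_gt0.
have KM : 0 <= (kap / r) ^+ k * (kap / (r / 2)) by rewrite mulr_ge0// exprn_ge0.
have -> : 8 * (kap / (r / 2) * (1 + `|i|) * M) * r * (kap / r) ^+ k =
  8 * ((kap / r) ^+ k * (kap / (r / 2)) * (1 + `|i|) * M) * r by ring.
apply: sqint_le => //; first exact: (kernel_cont (kernel_pow_cinv k zr')).
move=> w wb; have gM := MP w (bsquare_cball rle wb); split.
  rewrite (le_trans (cliff_normM _ _))//; apply: ler_pM => //.
  by rewrite (le_trans (K w wb))// ler_peMr// lerDl.
rewrite (le_trans (cliff_normM _ _))//; apply: ler_pM => //.
rewrite (le_trans (cliff_normM _ _))//; apply: ler_pM => //; first exact: K.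
by rewrite lerDr.
Qed.

Variable eps : R.
Hypothesis eps0 : 0 < eps.
Hypothesis g_zero : forall t : R, `|t| < eps -> g (z0.1 + t, z0.2) = 0.

(** Because [g] vanishes on a real segment, all its Taylor coefficients at
    [z0], which are the integrals of the powers of the kernel, vanish. *)
Lemma kint_pow k z : z != z0 -> `|z - z0| < r ->
  kint (fun w => powk k w * cinv i (w - z)) =
  (2 * pi) *: (i * (cinv i (z - z0) ^+ k * g z)).
Proof.
have comi a k' : i * cinv i a ^+ k' = cinv i a ^+ k' * i.
  by apply: commrX; apply/esym; exact: (cpx_commi ii).
elim: k z => [|k IH] z zz0 zr.
  rewrite expr0 mul1r -(cauchy_square ii g_holo zr).
  rewrite -[RHS]/(kint (fun w => cinv i (w - z))).
  by congr kint; apply/funext => w; rewrite /powk expr0 mul1r.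
have c0 : kint (powk k.+1) = 0.
  have [C C0 CP] := kint_bound.
  apply/eqP; rewrite -normr_le0.
  have m0 : 0 < Num.min eps (r / 2) by rewrite lt_min eps0 divr_gt0.
  apply: (@small_le0 _ _ (kap * (C * (kap / r) ^+ k.+1)) _ m0) => t t0.
  rewrite lt_min => /andP[te tr].
  pose y := (z0.1 + t, z0.2).
  have yz0 : y - z0 = (t, 0).
    by rewrite /y; congr pair => /=; [rewrite addrAC subrr add0r|rewrite subrr].
  have yn : `|y - z0| = t.
    by rewrite yz0 prod_normE /= normr0 max_l// ger0_norm// ltW.
  have yr : `|y - z0| < r by rewrite yn (lt_trans tr)// gtr_pMr// invf_lt1// ltr1n.
  have yy : y != z0 by rewrite -subr_eq0 -normr_gt0 yn.
  have := kint_step k yr; rewrite (IH y yy yr) {1}/y g_zero ?ger0_norm ?(ltW t0)//.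
  rewrite !mulr0 scaler0 => /esym/eqP; rewrite addr_eq0 => /eqP ->; rewrite normrN.
  rewrite (le_trans (cliff_normM _ _))//.
  have -> : kap * (C * (kap / r) ^+ k.+1) * t = kap * t * (C * (kap / r) ^+ k.+1) by ring.
  apply: ler_pM => //; first by have := cpx_le i (y - z0); rewrite yn.
  by apply: CP; rewrite yn ltW.
have := kint_step k zr; rewrite c0 add0r (IH z zz0 zr).
set N := kint _ => eN.
have d0 : z - z0 != 0 by rewrite subr_eq0.
have -> : N = cinv i (z - z0) * (cpx i (z - z0) * N) by rewrite mulrA (cinvK ii d0) mul1r.
rewrite -eN -cliff_scalerAr; congr (_ *: _).
rewrite exprS; apply: comm_shift.
by have := comi (z - z0) 1%N; rewrite expr1.
Qed.

(** By [kint_pow] and [kint_bound], g (z) is bounded by the k-th power of a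
    multiple of |z - z0| / r, for every k. The norm need not be multiplicative on
    the complex plane of i, whence the factor kap in the radius. *)
Lemma holo_zero_near z : `|z - z0| <= r / (2 * (kap + 1) ^+ 2) -> g z = 0.
Proof.
move=> zr; have kap1 : 0 < kap + 1 by rewrite ltr_wpDl.
have k2 : 1 <= (kap + 1) ^+ 2 by rewrite exprn_ege1// lerDr.
have kp : 0 < (kap + 1) ^+ 2 by rewrite exprn_gt0.
have zr2 : `|z - z0| <= r / 2.
  rewrite (le_trans zr)// ler_wpM2l ?(ltW r0)// lef_pV2 ?posrE ?mulr_gt0//.
  by rewrite ler_peMr.
have zlt : `|z - z0| < r by rewrite (le_lt_trans zr2)// gtr_pMr// invf_lt1// ltr1n.
have [->|zz0] := eqVneq z z0.
  by have := @g_zero 0; rewrite normr0 addr0 -surjective_pairing => ->.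
have [C C0 CP] := kint_bound.
have d0 : z - z0 != 0 by rewrite subr_eq0.
have Ck k : 2 * pi * `|g z| <= `|i| * C * (1 / 2 ^+ k).
  have -> : 2 * pi * `|g z| = `|(2 * pi) *: g z|.
    by rewrite normrZ ger0_norm// mulr_ge0// pi_ge0.
  have cm : GRing.comm (cpx i (z - z0)) (cinv i (z - z0)) by exact: (cpx_comm ii).
  have ci : GRing.comm i (cpx i (z - z0)) by apply/esym; exact: (cpx_commi ii).
  have -> : (2 * pi) *: g z = - (i * (cpx i (z - z0) ^+ k *
      kint (fun w => powk k w * cinv i (w - z)))).
    rewrite (kint_pow k zz0 zlt) -!cliff_scalerAr -scalerN; congr (_ *: _).
    rewrite (mulrA (cpx i _ ^+ k)) -(commrX k ci) -!mulrA (mulrA i i) ii mulN1r opprK.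
    rewrite mulrA -exprMn_comm// cm (cinvK ii d0) expr1n mul1r.
    by [].
  rewrite normrN (le_trans (cliff_normM _ _))// -mulrA ler_wpM2l//.
  rewrite (le_trans (cliff_normM _ _))//.
  apply: (@le_trans _ _ ((kap * `|z - z0|) ^+ k * (C * (kap / r) ^+ k))).
    apply: ler_pM => //; last exact: CP.
    rewrite (le_trans (normX_le _ _))//; apply: lerXn2r; rewrite ?nnegrE ?mulr_ge0//.
    exact: cpx_le.
  rewrite mulrCA -exprMn; apply: ler_wpM2l => //.
  rewrite div1r -exprVn; apply: lerXn2r; rewrite ?nnegrE ?invr_ge0//.
    by rewrite !mulr_ge0 ?invr_ge0 ?(ltW r0).
  apply: (@le_trans _ _ ((kap + 1) * (r / (2 * (kap + 1) ^+ 2)) * ((kap + 1) / r))).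
    apply: ler_pM; [by rewrite mulr_ge0|by rewrite mulr_ge0 ?invr_ge0 ?(ltW r0)| |].
      by apply: ler_pM => //; rewrite lerDl.
    by rewrite ler_wpM2r ?invr_ge0 ?(ltW r0)// lerDl.
  rewrite le_eqVlt; apply/orP; left; apply/eqP; field.
  by rewrite !gt_eqF.
apply/eqP; rewrite -normr_le0.
have pig : 2 * pi * `|g z| <= 0.
  apply: (@small_le0 R _ (`|i| * C) _ (@ltr01 R)) => e e0 _.
  have [k _ kP] := @near_infty_natSinv_expn_lt R (PosNum e0).
  rewrite (le_trans (Ck k))//; apply: ler_wpM2l; first by rewrite mulr_ge0.
  by apply: ltW; exact: kP k (leqnn k).
have p2 : 0 < 2 * pi :> R by rewrite mulr_gt0// pi_gt0.
by rewrite -(pmulr_rle0 _ p2).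
Qed.

End UniqueContinuation.

Section ZeroAlongPath.
Variables (R : realType) (V : completeNormedModType R) (n : nat).
Notation E := (cliff n (bop V)).
Variables (i : E) (g : R * R -> E) (M : set (R * R)) (p : R -> R * R) (eps : R).
Hypothesis ii : i * i = -1.
Hypothesis oM : open M.
Hypothesis g_holo : forall w, M w -> lholo i g w.
Hypothesis p_cont : forall t : R, 0 <= t <= 1 -> forall e : R, 0 < e ->
  exists2 d : R, 0 < d & forall s : R, 0 <= s <= 1 -> `|s - t| < d -> `|p s - p t| < e.
Hypothesis p_in : forall t : R, 0 <= t <= 1 -> M (p t).
Hypothesis eps0 : 0 < eps.
Hypothesis g_zero : forall t : R, `|t| < eps -> g ((p 0).1 + t, (p 0).2) = 0.

(** The zeros propagate along the path by balls of a constant radius, each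
    centred in the previous one. *)
Lemma holo_zero_path : exists2 d : R, 0 < d & forall w, `|w - p 1| <= d -> g w = 0.
Proof.
have [r r0 rP] := curve_tube oM p_cont p_in.
pose k1 : R := 2 * (`|1 : E| + `|i| + 1) ^+ 2; pose rho := r / k1.
have kap1 : 1 <= `|1 : E| + `|i| + 1 by rewrite lerDr addr_ge0.
have k10 : 0 < k1 by rewrite mulr_gt0// exprn_gt0// (lt_le_trans ltr01 kap1).
have rho0 : 0 < rho by rewrite divr_gt0.
have rho2 : 0 < rho / 2 by rewrite divr_gt0.
have [d d0 dP] := curve_ucont p_cont rho2.
have [N Nd] : exists N : nat, (N.+1%:R)^-1 < d.
  exists (Num.truncn d^-1); rewrite -[ltRHS]invrK ltf_pV2 ?posrE ?invr_gt0//.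
  exact: truncnS_gt.
pose t (k : nat) : R := k%:R / N.+1%:R.
have t01 k : (k <= N.+1)%N -> 0 <= t k <= 1.
  by move=> kN; rewrite divr_ge0//= ler_pdivrMr// mul1r ler_nat.
suff H k : (k <= N.+1)%N -> forall w, `|w - p (t k)| <= rho -> g w = 0.
  exists rho => // w wp; apply: (H N.+1) => //.
  by rewrite /t divff// pnatr_eq0.
elim: k => [|k IH] kN w wp.
  apply: (holo_zero_near ii r0 _ eps0 (z0 := p 0)) => //.
    by move=> v vp; apply: g_holo; apply: (rP 0 v) => //; rewrite lexx ler01.
  by move: wp; rewrite /t mul0r.
apply: (holo_zero_near ii r0 _ rho2 (z0 := p (t k.+1))) => //.
  by move=> v vp; apply: g_holo; apply: (rP (t k.+1) v) => //; exact: t01.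
move=> s srho; apply: IH; first exact: ltnW.
rewrite (le_trans (ler_distD (p (t k.+1)) _ _))// [rho]splitr lerD//; last first.
  apply/ltW/dP; [exact: t01 | exact: t01 (ltnW kN) |].
  by rewrite /t -mulrBl -natrB// subSnn mul1r ger0_norm// invr_ge0.
rewrite (_ : _ - _ = (s, 0)); last by case: (p _) => a b; congr (_, _); rewrite /=; ring.
by rewrite prod_norm_le /= normr0 (ltW rho2) (ltW srho).
Qed.

End ZeroAlongPath.

(** * Neumann series and the inverse of the pencil *)

Section Inverses.
Variables (R : realType) (V : completeNormedModType R) (n : nat).
Notation E := (cliff n (bop V)).
Implicit Types P Q H X Y : E.

(** The geometric series. *)
Lemma neumann X : `|X| <= 2^-1 ->
  exists Y, [/\ (1 - X) * Y = 1, Y * (1 - X) = 1 & `|Y| <= 2].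
Proof.
move=> X2; pose u k := \sum_(j < k) X ^+ j; pose q k : R := 2^-1 ^+ k.
have q0 k : 0 <= q k by rewrite exprn_ge0.
have qS k : q k = q k.+1 + q k.+1 by rewrite /q exprS; lra.
have Xq k : `|X ^+ k| <= q k.
  by rewrite (le_trans (normX_le _ _))// lerXn2r// nnegrE.
have qe (e : R) : 0 < e -> exists N, q N < e.
  move=> e0; exists (Num.truncn e^-1).+1; rewrite /q exprVn -[ltRHS]invrK.
  rewrite ltf_pV2 ?posrE ?invr_gt0 ?exprn_gt0// (lt_trans (truncnS_gt _))//.
  by rewrite -natrX ltr_nat ltn_expl.
have uS k : u k.+1 = u k + X ^+ k by rewrite /u big_ord_recr.
have uN N k : `|u (N + k)%N - u N| <= 2 * q N - 2 * q (N + k)%N.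
  elim: k => [|k IH]; first by rewrite addn0 !subrr normr0.
  rewrite addnS uS addrAC (le_trans (ler_normD _ _))//.
  have := Xq (N + k)%N; have := qS (N + k)%N; move: IH.
  by move: `|_| `|_| => a b; lra.
have [e e0|Y Yu] := @cauchy_seq_lim R E u.
  have [N Ne] := qe (e / 2) (divr_gt0 e0 (ltr0n _ 2)); exists N => m Nm.
  rewrite distrC -(subnKC Nm) (le_lt_trans (uN _ _))//.
  by have := q0 (N + (m - N))%N; lra.
have mulu k : (1 - X) * u k = 1 - X ^+ k /\ u k * (1 - X) = 1 - X ^+ k.
  elim: k => [|k [IH1 IH2]]; first by rewrite /u big_ord0 mulr0 mul0r expr0 subrr.
  rewrite uS mulrDr [X in _ /\ X = _]mulrDl IH1 IH2.
  rewrite mulrBl mulrBr mul1r mulr1 -exprS -exprSr.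
  by split; zmodule.
have near (e : R) : 0 < e -> exists k, `|Y - u k| < e /\ `|X ^+ k| < e.
  move=> e0; have [N NP] := Yu e e0; have [M MP] := qe e e0.
  exists (maxn N M); split; first by apply: NP; exact: leq_maxl.
  rewrite (le_lt_trans (Xq _))// (le_lt_trans _ MP)//.
  by rewrite /q ler_wiXn2l ?leq_maxr// invf_le1// ler1n.
have eq0 (v : E) : (forall e : R, 0 < e -> e < 1 -> `|v| <= (`|1 - X| + 1) * e) -> v = 0.
  by move=> /(small_le0 ltr01) v0; apply/eqP; rewrite -normr_le0.
exists Y; split.
- apply/eqP; rewrite -subr_eq0; apply/eqP/eq0 => e e0 _.
  have [k [Yk Xk]] := near e e0.
  rewrite (_ : _ - 1 = (1 - X) * (Y - u k) - X ^+ k); last first.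
    by rewrite mulrBr (mulu k).1; zmodule.
  rewrite (le_trans (ler_normB _ _))// [leRHS]mulrDl mul1r lerD// ?(ltW Xk)//.
  exact: le_trans (cliff_normM _ _) (ler_wpM2l (normr_ge0 _) (ltW Yk)).
- apply/eqP; rewrite -subr_eq0; apply/eqP/eq0 => e e0 _.
  have [k [Yk Xk]] := near e e0.
  rewrite (_ : _ - 1 = (Y - u k) * (1 - X) - X ^+ k); last first.
    by rewrite mulrBl (mulu k).2; zmodule.
  rewrite (le_trans (ler_normB _ _))// [leRHS]mulrDl mul1r lerD// ?(ltW Xk)//.
  rewrite [leRHS]mulrC; exact: le_trans (cliff_normM _ _) (ler_wpM2r (normr_ge0 _) (ltW Yk)).
- rewrite -subr_le0; apply: (@small_le0 R _ 1 1) => // e e0 _.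
  have [k [Yk _]] := near e e0; have := uN 0%N k.
  rewrite add0n (_ : u 0%N = 0) ?subr0 /q ?expr0 ?mulr1 -/(q k) => [uk|]; last by rewrite /u big_ord0.
  have := ler_normD (Y - u k) (u k); rewrite subrK.
  by have := q0 k; move: uk Yk; move: `|_| `|_| `|_| => a b d; lra.
Qed.

Lemma inverse_uniq P Q Q' : inverse_of P Q -> inverse_of P Q' -> Q = Q'.
Proof. by move=> [QP _] [_ PQ']; rewrite -[Q]mulr1 -PQ' mulrA QP mul1r. Qed.

(** P + H = P (1 + Q H), where Q is the inverse of P. *)
Lemma inverse_near P Q H : inverse_of P Q -> `|H| * `|Q| <= 2^-1 ->
  exists2 Q', inverse_of (P + H) Q' & `|Q'| <= 2 * `|Q|.
Proof.
move=> [QP PQ] HQ; have [|Y [Y1 Y2 Yn]] := @neumann (- (Q * H)).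
  by rewrite normrN (le_trans (cliff_normM _ _))// mulrC.
rewrite opprK in Y1 Y2.
have PH : P + H = P * (1 + Q * H) by rewrite mulrDr mulr1 mulrA PQ mul1r.
exists (Y * Q); last first.
  by rewrite (le_trans (cliff_normM _ _))// ler_wpM2r.
split; first by rewrite PH mulrA -(mulrA Y) QP mulr1 Y2.
by rewrite PH -mulrA (mulrA _ Y) Y1 mul1r PQ.
Qed.

End Inverses.

Section Resolvent.
Variables (R : realType) (V : completeNormedModType R) (n : nat).
Notation E := (cliff n (bop V)).
Variable T : E.
Implicit Types (I : 'rV[R]_n).

Lemma euclid_slice I z : unit_sphere I -> euclid_sqr (slice_pt I z) = sqnorm z.
Proof.
move=> I1; rewrite /euclid_sqr big_ord_recl mxE unlift_none /sqnorm expr2.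
congr (_ + _); transitivity (z.2 ^+ 2 * euclid_sqr I); last by rewrite I1 mulr1 expr2.
rewrite /euclid_sqr mulr_sumr; apply: eq_bigr => j _.
by rewrite mxE liftK exprMn.
Qed.

(** The pencil depends on s = u + I v through (u, v) only. *)
Definition plane_pencil (z : R * R) : E := T ^+ 2 - (2 * z.1) *: T + sqnorm z *: (1 : E).
Definition plane_spectrum : set (R * R) := [set z | ~ exists Q, inverse_of (plane_pencil z) Q].
(** The inverse of the pencil, not of T - s. *)
Definition pencil_inv (z : R * R) : E := xget 0 (inverse_of (plane_pencil z)).

Lemma pencil_slice I z : unit_sphere I -> pencil T (slice_pt I z) = plane_pencil z.
Proof. by move=> I1; rewrite /pencil /Re_part mxE unlift_none euclid_slice. Qed.

Lemma pencil_invP z : ~ plane_spectrum z -> inverse_of (plane_pencil z) (pencil_inv z).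
Proof. by move=> /contrapT[Q PQ]; rewrite /pencil_inv; case: xgetP => // /(_ Q). Qed.

Lemma not_spectrum z Q : inverse_of (plane_pencil z) Q -> ~ plane_spectrum z.
Proof. by move=> QP; apply; exists Q. Qed.

Lemma diffat_pencil z : diffat plane_pencil z ((2 * z.1) *: (1 : E) - 2 *: T) ((2 * z.2) *: (1 : E)).
Proof.
have dT : diffat (fun w : R * R => (2 * w.1) *: T) z (2 *: T) 0.
  apply: (diffat_eq (A := (2 : R^o) *: T + (2 * z.1) *: 0) (B := (0 : R^o) *: T + (2 * z.1) *: 0)).
  - apply: (@diffat_scale _ _ _ (fun w => 2 * w.1 : R^o)); last exact: diffat_cst.
    have := diffat_mulr (diffat_cst (2 : R^o) z) (diffat_fst z).
    by move=> /diffat_eq; apply; rewrite /= ?mulr0 ?mul0r ?mulr1 ?addr0 ?add0r.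
  - by rewrite scaler0 addr0.
  - by rewrite scaler0 scale0r addr0.
have dS : diffat (fun w : R * R => sqnorm w *: (1 : E)) z ((2 * z.1) *: (1 : E)) ((2 * z.2) *: (1 : E)).
  apply: (diffat_eq (A := (2 * z.1 : R^o) *: (1 : E) + sqnorm z *: 0)
                    (B := (2 * z.2 : R^o) *: (1 : E) + sqnorm z *: 0)).
  - apply: (@diffat_scale _ _ _ (fun w => sqnorm w : R^o)); last exact: diffat_cst.
    have := diffatD (diffat_mulr (diffat_fst z) (diffat_fst z))
                    (diffat_mulr (diffat_snd z) (diffat_snd z)).
    by move=> /diffat_eq; apply; rewrite /=; ring.
  - by rewrite scaler0 addr0.
  - by rewrite scaler0 addr0.
have := diffatD (diffatD (diffat_cst (T ^+ 2) z) (diffatN dT)) dS.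
by move=> /diffat_eq; apply; rewrite ?oppr0 ?add0r ?addr0 // addrC.
Qed.

Lemma pencil_inv_near z : ~ plane_spectrum z -> exists2 r : R, 0 < r & forall w, `|w - z| < r ->
  [/\ ~ plane_spectrum w, `|plane_pencil w - plane_pencil z| * `|pencil_inv z| <= 2^-1 & `|pencil_inv w| <= 2 * `|pencil_inv z| ].
Proof.
move=> zN; have Q1 : 0 < 2 * (`|pencil_inv z| + 1) by rewrite mulr_gt0// ltr_wpDl.
have [|r r0 rP] := diffat_cont (diffat_pencil z) (e := (2 * (`|pencil_inv z| + 1))^-1).
  by rewrite invr_gt0.
exists r => // w wz; have H := rP w wz.
have HQ : `|plane_pencil w - plane_pencil z| * `|pencil_inv z| <= 2^-1.
  rewrite (le_trans (ler_wpM2r (normr_ge0 _) H))// mulrC ler_pdivrMr//.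
  by rewrite mulrA mulVf ?mul1r ?lerDl// pnatr_eq0.
have [Q' Q'P Q'n] := inverse_near (pencil_invP zN) HQ.
rewrite addrC subrK in Q'P; have wN := not_spectrum Q'P.
by split=> //; rewrite -(inverse_uniq Q'P (pencil_invP wN)).
Qed.

Lemma closed_spectrum : closed plane_spectrum.
Proof.
rewrite -[plane_spectrum]setCK; apply: open_closedC; rewrite openE => z /= zN.
have [r r0 rP] := pencil_inv_near zN; apply/nbhs_ballP; exists r => //= w.
by rewrite -ball_normE /= distrC => /rP[].
Qed.

Lemma spectrum_reflect z : plane_spectrum z -> plane_spectrum (reflect z).
Proof. by rewrite /plane_spectrum /= /plane_pencil /sqnorm /= mulrNN. Qed.

(** For large s the pencil is |s|^2 (1 - X) with X small. *)
Lemma spectrum_bounded z : plane_spectrum z -> `|z| <= 5 * `|T| + 1.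
Proof.
move=> zK; rewrite leNgt; apply/negP => zb; apply: zK.
have T0 := normr_ge0 T; set t := `|T| in zb T0; have := sqnorm_ge z.
set m := `|z| in zb *; set s := sqnorm z => ms.
have m0 : 0 < m by lra.
have s0 : 0 < s by apply: lt_le_trans ms; rewrite exprn_gt0.
pose X : E := s^-1 *: ((2 * z.1) *: T - T ^+ 2).
have [|Y [Y1 Y2 _]] := @neumann _ _ _ X.
  rewrite /X normrZ gtr0_norm ?invr_gt0// mulrC ler_pdivrMr//.
  rewrite (le_trans (ler_normB _ _))// normrZ normrM ger0_norm// -/t.
  have z1 := prod_norm_fst z; rewrite -/m in z1.
  have T2 : `|T ^+ 2| <= t ^+ 2 by exact: normX_le.
  have := ler_wpM2r T0 z1; move: T2 ms zb m0 T0; rewrite !expr2.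
  by move: `|z.1| `|T * T| => a b; nra.
have penE : plane_pencil z = s *: (1 - X).
  by rewrite scalerBr /X scalerA divff ?gt_eqF// scale1r /plane_pencil -/s; zmodule.
exists (s^-1 *: Y); rewrite penE; split.
  by rewrite -cliff_scalerAl -cliff_scalerAr Y2 scalerA mulVf ?gt_eqF// scale1r.
by rewrite -cliff_scalerAl -cliff_scalerAr Y1 scalerA divff ?gt_eqF// scale1r.
Qed.

Lemma compact_spectrum : compact plane_spectrum.
Proof.
pose c : R := 5 * `|T| + 1.
apply: (@subclosed_compact _ _ (`[- c, c] `*` `[- c, c])%classic).
- exact: closed_spectrum.
- by apply: compact_setX; exact: segment_compact.
- move=> z /spectrum_bounded; rewrite -/c prod_norm_le => /andP[z1 z2].
  by split; rewrite /= in_itv /= -ler_norml.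
Qed.

Lemma pencil_commT z : GRing.comm (plane_pencil z) T.
Proof.
rewrite /GRing.comm /plane_pencil !mulrDl !mulrDr mulNr mulrN -!cliff_scalerAl -!cliff_scalerAr.
by rewrite -exprS -exprSr (mul1r T) (mulr1 T).
Qed.

Lemma pencil_inv_commT z : ~ plane_spectrum z -> pencil_inv z * T = T * pencil_inv z.
Proof.
move=> /pencil_invP[QP PQ].
by rewrite -[RHS]mul1r -QP -!mulrA (mulrA (plane_pencil z)) pencil_commT -!mulrA PQ mulr1.
Qed.

(** Inversion is H |-> - Q H Q up to a quadratic error. *)
Lemma diffat_pencil_inv z : ~ plane_spectrum z ->
  diffat pencil_inv z (- (pencil_inv z * ((2 * z.1) *: (1 : E) - 2 *: T) * pencil_inv z))
              (- (pencil_inv z * ((2 * z.2) *: (1 : E)) * pencil_inv z)).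
Proof.
move=> zN; have [r r0 rP] := pencil_inv_near zN; have [QP PQ] := pencil_invP zN.
set Q := pencil_inv z in QP PQ rP *.
apply: (@diffat_quadratic _ _ _ (fun H : E => - (Q * H * Q) : E) (`|Q| * `|Q|)
  (2 * `|Q| ^+ 3) r plane_pencil) (diffat_pencil z) => //.
- move=> k a b; rewrite mulrDr mulrDl opprD.
  by rewrite -cliff_scalerAr -cliff_scalerAl scalerN.
- move=> H; rewrite normrN (le_trans (cliff_normM _ _))// mulrAC.
  by rewrite ler_wpM2r// cliff_normM.
- move=> w /rP[wN _ Rw]; have [QP' PQ'] := pencil_invP wN.
  set H := plane_pencil w - plane_pencil z.
  have dR : pencil_inv w - Q = - (pencil_inv w * H * Q).
    by rewrite /H mulrBr mulrBl QP' mul1r -mulrA PQ mulr1 opprB.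
  have -> : pencil_inv w - Q - - (Q * H * Q) = pencil_inv w * H * Q * H * Q.
    transitivity ((Q - pencil_inv w) * H * Q); first by rewrite dR opprK addrC -!mulrBl.
    by rewrite -opprB dR opprK.
  have N3 (a b c d e : E) : `|a * b * c * d * e| <= `|a| * `|b| * `|c| * `|d| * `|e|.
    by do 4 apply: le_trans (cliff_normM _ _) (ler_wpM2r (normr_ge0 _) _).
  apply: le_trans (N3 _ _ _ _ _) _; move: Rw.
  move: (`|pencil_inv w|) (`|H|) (`|Q|) => a b c ac.
  have -> : a * b * c * b * c = a * (b ^+ 2 * c ^+ 2) by ring.
  have -> : 2 * c ^+ 3 * b ^+ 2 = 2 * c * (b ^+ 2 * c ^+ 2) by ring.
  by rewrite ler_wpM2r// mulr_ge0// sqr_ge0.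
Qed.

End Resolvent.

(** * Slices of the resolvent and of s-monogenic functions *)

Section ScalarOperators.
Variables (R : realType) (V : completeNormedModType R) (n : nat).
Notation E := (cliff n (bop V)).
Notation Rn := (cliff n R).
Notation scal := (@scalar_op R V n).

Lemma scalar_opM (a b : Rn) : scal (a * b) = scal a * scal b.
Proof.
apply/ffunP => C; rewrite ffunE [RHS]cprodE [in LHS]cprodE scaler_suml.
apply: eq_bigr => A _; rewrite !ffunE.
rewrite -scalerMzl; congr (_ *~ _).
by apply: bopP => x /=; rewrite scalerA.
Qed.

Lemma scalar_op_linear : linear (scal : Rn -> E).
Proof. by move=> k a b; apply/ffunP => A; rewrite !ffunE scalerDl scalerA. Qed.

Lemma scalar_opD (a b : Rn) : scal (a + b) = scal a + scal b.
Proof. by have := scalar_op_linear 1 a b; rewrite !scale1r. Qed.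

Lemma scalar_opZ (k : R) (a : Rn) : scal (k *: a) = k *: scal a.
Proof. by apply/ffunP => A; rewrite !ffunE scalerA. Qed.

Lemma scalar_opN (a : Rn) : scal (- a) = - scal a.
Proof. by rewrite -scaleN1r scalar_opZ scaleN1r. Qed.

Lemma scalar_op_real (k : R) : scal (real_embed n k) = k *: (1 : E).
Proof.
apply/ffunP => A; rewrite !ffunE.
by case: eqP => // _; rewrite scale0r scaler0.
Qed.

Lemma cmonoZ (X : lmodType R) (k : R) (x : X) A :
  cmono (k *: x) A = k *: (cmono x A : cliff n X).
Proof. by apply/ffunP => B; rewrite !ffunE; case: eqP => // _; rewrite scaler0. Qed.

Lemma real_embed1 : real_embed n 1 = 1 :> Rn. Proof. by []. Qed.

(** Twice the square is the sum of the anticommutators of the generators. *)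
Lemma vec_embed_sqr (I : 'rV[R]_n) : unit_sphere I ->
  vec_embed I * vec_embed I = -1.
Proof.
move=> I1; pose t j k : Rn := cmono (I 0 j) [set j]%SET * cmono (I 0 k) [set k]%SET.
have tE j k : t j k + t k j = if j == k then (- 2 * I 0 j ^+ 2) *: (1 : Rn) else 0.
  have gE l : cmono (I 0 l) [set l]%SET = I 0 l *: (cmono 1 [set l]%SET : Rn).
    by rewrite -cmonoZ; congr cmono; rewrite /GRing.scale /= mulr1.
  have ZM (a b : R) (x y : Rn) : (a *: x) * (b *: y) = (a * b) *: (x * y).
    apply/ffunP => C; rewrite [LHS]cprodE ffunE [X in _ = _ *: X]cprodE scaler_sumr.
    apply: eq_bigr => A _; rewrite !ffunE -scalerMzr; congr (_ *~ _).
    by rewrite /GRing.scale /=; ring.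
  rewrite /t !gE !ZM (mulrC (I 0 k)) -scalerDr cgenC.
  case: eqVneq => [->|_]; last by rewrite mulr0 oppr0 scaler0.
  rewrite mulr1 (_ : 2 = (2 : R) *: (1 : Rn)); last by rewrite scaler_nat.
  by rewrite scalerN scalerA -scaleNr; congr (_ *: _); ring.
have tt : vec_embed I * vec_embed I = \sum_j \sum_k t j k.
  by rewrite mulr_suml; apply: eq_bigr => j _; rewrite mulr_sumr.
apply: (@scalerI _ _ (2 : R)); first by rewrite pnatr_eq0.
rewrite [LHS]scaler_nat mulr2n {1}tt tt [X in _ + X]exchange_big -big_split /=.
transitivity (\sum_j (- 2 * I 0 j ^+ 2) *: (1 : Rn)).
  apply: eq_bigr => j _; rewrite -big_split /= (bigD1 j)//= tE eqxx big1 ?addr0// => k.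
  by rewrite eq_sym tE => /negPf ->.
by rewrite -scaler_suml -mulr_sumr [X in _ * X]I1 mulr1 scaleNr scalerN.
Qed.

Lemma vec_op_sqr (I : 'rV[R]_n) : unit_sphere I ->
  scal (vec_embed I) * scal (vec_embed I) = -1 :> E.
Proof.
move=> I1; rewrite -scalar_opM vec_embed_sqr// scalar_opN -real_embed1.
by rewrite scalar_op_real scale1r.
Qed.

Lemma slice_re (I : 'rV[R]_n) z : Re_part (slice_pt I z) = z.1.
Proof. by rewrite /Re_part mxE unlift_none. Qed.

Lemma slice_vec (I : 'rV[R]_n) z : vec_embed (vec_part (slice_pt I z)) = z.2 *: vec_embed I.
Proof.
rewrite /vec_embed scaler_sumr; apply: eq_bigr => j _.
by rewrite -cmonoZ !mxE liftK.
Qed.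

Lemma scalar_op_embed (I : 'rV[R]_n) z :
  scal (embed (slice_pt I z)) = cpx (scal (vec_embed I)) z.
Proof. by rewrite /embed scalar_opD slice_re slice_vec scalar_op_real scalar_opZ. Qed.

Lemma scalar_op_conj (I : 'rV[R]_n) z :
  scal (conj_embed (slice_pt I z)) = cpx (scal (vec_embed I)) (reflect z).
Proof.
rewrite /conj_embed scalar_opD slice_re slice_vec scalar_op_real scalar_opN scalar_opZ.
by rewrite /cpx /= scaleNr.
Qed.

Variable T : E.

(** The operator S^-1(u + I v, T), in terms of the image i of I. *)
Definition slice_resolvent (i : E) z : E := - (pencil_inv T z * (T - cpx i (reflect z))).

Lemma S_resolvent_slice (I : 'rV[R]_n) z : unit_sphere I ->
  S_resolvent T (slice_pt I z) = slice_resolvent (scal (vec_embed I)) z.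
Proof. by move=> I1; rewrite /S_resolvent pencil_slice// scalar_op_conj. Qed.

Lemma integrandE f (I : 'rV[R]_n) z h : unit_sphere I ->
  let i : E := scal (vec_embed I) in let F := scal (f (slice_pt I z)) in
  integrand T f I z h =
    h.1 *: - (slice_resolvent i z * i * F) + h.2 *: (slice_resolvent i z * F).
Proof.
move=> I1 i F; rewrite /integrand S_resolvent_slice// scalar_opN scalar_opM scalar_op_embed.
rewrite -/i -/F; move: (slice_resolvent i z) F => S F.
rewrite /cpx mulrDl -!cliff_scalerAl mul1r (vec_op_sqr I1).
rewrite mulrN mulNr mulrDr mulrDl -!cliff_scalerAr -!cliff_scalerAl.
by rewrite mulr1 scaleN1r opprD !scalerN opprK.
Qed.

(** The Cauchy-Riemann equation of S^-1, in a ring where u, v are central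
    scalars but t and i do not commute. With D = t - u + v i the derivatives add
    up to q q ((2 u - 2 t) D + 2 v D i) + 2 q, and the bracket is - 2 p
    with q p = 1. *)
Lemma resolvent_ring (A : pzRingType) (t i q u v : A) :
  i * i = -1 -> q * t = t * q -> GRing.comm u q -> GRing.comm v q ->
  GRing.comm u t -> GRing.comm v t -> GRing.comm u v ->
  q * (t * t - (u + u) * t + (u * u + v * v)) = 1 ->
  - (- (q * ((u + u) - (t + t)) * q) * (t - (u - v * i)) + q * - 1)
  - (- (q * (v + v) * q) * (t - (u - v * i)) + q * i) * i = 0.
Proof.
move=> ii qt uq vq ut vt uv qp.
set p := _ + _ in qp; set D := t - _.
have C1 : q * ((u + u) - (t + t)) * q = q * (q * ((u + u) - (t + t))).
  by rewrite -!mulrA; congr (_ * _); rewrite mulrBl mulrBr !mulrDl !mulrDr uq qt.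
have C2 : q * (v + v) * q = q * (q * (v + v)).
  by rewrite -!mulrA; congr (_ * _); rewrite mulrDl mulrDr vq.
have H : ((u + u) - (t + t)) * D + (v + v) * D * i = - (p + p).
  have e1 : v * (v * i) * i = - (v * v) by rewrite -!mulrA ii mulrN1 mulrN.
  have e2 : u * (v * i) = v * u * i by rewrite mulrA uv.
  have e3 : t * (v * i) = v * t * i by rewrite mulrA vt.
  rewrite /D opprB /p !(mulrDl, mulrDr, mulrBl, mulrBr, mulNr, mulrN) e1 e2 e3 -ut.
  by zmodule.
have q2 : q = q * (q * p) by rewrite qp mulr1.
have -> : - (- (q * ((u + u) - (t + t)) * q) * D + q * - 1)
  - (- (q * (v + v) * q) * D + q * i) * i
  = q * (q * (((u + u) - (t + t)) * D + (v + v) * D * i)) + (q + q).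
  rewrite C1 C2; move: D (_ - _) (v + v) {H} => D a b.
  rewrite !(mulrDr q) !mulrDl !mulNr -!mulrA ii !mulrN mulr1.
  by zmodule.
by rewrite H !mulrN (mulrDr q p p) (mulrDr q (q * p)) -q2 addNr.
Qed.

Lemma cpx_reflect (i : E) z : cpx i (reflect z) = cpx (- i) z.
Proof. by rewrite /cpx /= scalerN scaleNr. Qed.

Lemma rholo_slice_resolvent (i : E) z : i * i = -1 -> ~ plane_spectrum T z -> rholo i (slice_resolvent i) z.
Proof.
move=> ii zN; have [QP _] := pencil_invP zN.
have dD : diffat (fun w => T - cpx i (reflect w)) z (- 1) i.
  rewrite (_ : (fun w => _) = (fun w => T + - cpx (- i) w)); last first.
    by apply/funext => w; rewrite cpx_reflect.
  have := diffatD (diffat_cst T z) (diffatN (diffat_cpx (- i) z)).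
  by move/diffat_eq; apply; rewrite ?opprK add0r.
exists (- (- (pencil_inv T z * ((2 * z.1) *: (1 : E) - 2 *: T) * pencil_inv T z) * (T - cpx i (reflect z))
           + pencil_inv T z * - 1)).
exists (- (- (pencil_inv T z * ((2 * z.2) *: (1 : E)) * pencil_inv T z) * (T - cpx i (reflect z))
           + pencil_inv T z * i)).
split; first exact: diffatN (diffat_mul (diffat_pencil_inv zN) dD).
have comm1 k (a : E) : GRing.comm (k *: (1 : E)) a.
  by rewrite /GRing.comm -cliff_scalerAl -cliff_scalerAr mulr1 mul1r.
have dbl k (a : E) : (2 * k) *: a = k *: a + k *: a by rewrite -scalerDl; congr (_ *: _); ring.
rewrite (dbl z.1) (dbl z.2) (_ : 2 *: T = T + T); last by rewrite scaler_nat.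
have -> : cpx i (reflect z) = z.1 *: (1 : E) - (z.2 *: (1 : E)) * i.
  by rewrite /cpx /= -cliff_scalerAl mul1r scaleNr.
rewrite [X in _ + X]mulNr.
apply: (resolvent_ring ii (pencil_inv_commT zN) (comm1 _ _) (comm1 _ _) (comm1 _ _) (comm1 _ _) (comm1 _ _)).
have penE : plane_pencil T z = T * T - (z.1 *: (1 : E) + z.1 *: (1 : E)) * T
    + (z.1 *: (1 : E) * (z.1 *: (1 : E)) + z.2 *: (1 : E) * (z.2 *: (1 : E))).
  have one k (a : E) : k *: (1 : E) * a = k *: a by rewrite -cliff_scalerAl mul1r.
  by rewrite (mulrDl (z.1 *: (1 : E))) !one !scalerA /plane_pencil /sqnorm expr2 dbl scalerDl.
by rewrite -penE.
Qed.

End ScalarOperators.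

Section SliceRegularity.
Variables (R : realType) (V : completeNormedModType R) (n : nat).
Notation E := (cliff n (bop V)).
Notation Rn := (cliff n R).
Notation scal := (@scalar_op R V n).
Implicit Types (U W : set 'rV[R]_n.+1) (I : 'rV[R]_n).

Lemma slice_ptD I z w : slice_pt I (z + w) = slice_pt I z + slice_pt I w.
Proof.
apply/rowP => k; rewrite !mxE; case: unlift => [j|]//=.
by rewrite mulrDl.
Qed.

Lemma slice_ptZ I k z : slice_pt I (k *: z) = k *: slice_pt I z.
Proof.
apply/rowP => j; rewrite !mxE; case: unlift => [l|]//=.
by rewrite mulrA.
Qed.

Lemma slice_pt_norm I z : `|slice_pt I z| <= (1 + `|I|) * `|z|.
Proof.
rewrite [leLHS]mx_normrE; apply: bigmax_le => [|[i k] _ /=]; first by rewrite mulr_ge0// addr_ge0.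
rewrite mxE; case: unlift => [j|].
  rewrite normrM mulrDl mul1r -[leLHS]add0r lerD// mulrC ler_pM//; last exact: prod_norm_snd.
  by rewrite [leRHS]mx_normrE; apply: (le_bigmax _ (fun p => `|I p.1 p.2|) (0, j)).
rewrite (le_trans (prod_norm_fst _))// -[leLHS]mul1r ler_wpM2r//.
by rewrite lerDl.
Qed.

Lemma slice_ptB I z w : slice_pt I (z - w) = slice_pt I z - slice_pt I w.
Proof. by rewrite -scaleN1r slice_ptD slice_ptZ scaleN1r. Qed.

Lemma slice_near I z (e : R) : 0 < e ->
  exists2 d : R, 0 < d & forall w, `|w - z| < d -> `|slice_pt I w - slice_pt I z| < e.
Proof.
move=> e0; have I1 : 0 < 1 + `|I| by rewrite ltr_pwDl.
exists (e / (1 + `|I|)) => [|w]; first by rewrite divr_gt0.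
rewrite ltr_pdivlMr// -slice_ptB => wz.
by rewrite (le_lt_trans (slice_pt_norm _ _))// mulrC.
Qed.

Lemma open_slice U I : open U -> open (slice U I).
Proof.
move=> oU; rewrite openE => z Uz.
have /nbhs_ballP[e /= e0 eP] : nbhs (slice_pt I z) U by exact: open_nbhs_nbhs (conj oU Uz).
have [d d0 dP] := slice_near I z e0.
apply/nbhs_ballP; exists d => //= w; rewrite -ball_normE /= distrC => /dP wz.
by apply: eP; rewrite -ball_normE /= distrC.
Qed.

Lemma closure_slice U I z : closure (slice U I) z -> closure U (slice_pt I z).
Proof.
move=> cz B /nbhs_ballP[e /= e0 eP]; have [d d0 dP] := slice_near I z e0.
have [|w [Uw wz]] := cz (ball z d); first by apply/nbhs_ballP; exists d.
exists (slice_pt I w); split=> //; apply: eP; rewrite -ball_normE /= distrC.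
by apply: dP; move: wz; rewrite -ball_normE /= distrC.
Qed.

Lemma closure_boundary (X : topologicalType) (U : set X) : closure U `<=` U `|` boundary U.
Proof.
by move=> x Ux; have [|nx] := pselect (U x); [left | right; split=> // /interior_subset].
Qed.

Lemma derive1_eps (g : R -> R) (t a : R) :
  (forall e : R, 0 < e -> exists2 d : R, 0 < d &
     forall h : R, `|h| < d -> `|g (t + h) - g t - h * a| <= e * `|h|) ->
  g^`()%classic t = a.
Proof.
move=> ga; rewrite /derive1; apply/cvg_lim => //; apply/cvgrPdist_le => e e0.
have [d d0 dP] := ga e e0; apply/nbhs_ballP; exists d => //= h.
rewrite -ball_normE /= sub0r normrN => hd h0.
have hn : 0 < `|h| by rewrite normr_gt0.
rewrite -(ler_pM2r hn) distrC -normrM mulrBl.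
rewrite (_ : _ - _ = g (t + h) - g t - h * a); first exact: dP.
by rewrite /GRing.scale /= mulrC mulrA mulfV// mul1r (addrC h) (mulrC a).
Qed.

Lemma diffat_partials (g : R * R -> R^o) z (a b : R^o) : diffat g z a b ->
  (fun t => g (t, z.2))^`()%classic z.1 = a /\ (fun t => g (z.1, t))^`()%classic z.2 = b.
Proof.
move=> gz; split; apply: derive1_eps => e /gz[d d0 dP]; exists d => // h hd.
- have := dP (h, 0); rewrite scale0r addr0 prod_normE /= normr0 (max_l (normr_ge0 _)).
  move=> /(_ hd); rewrite (_ : z + _ = (z.1 + h, z.2)) -?surjective_pairing//.
  by case: (z) => u v; congr (_, _); rewrite /= addr0.
- have := dP (0, h); rewrite scale0r add0r prod_normE /= normr0 (max_r (normr_ge0 _)).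
  move=> /(_ hd); rewrite (_ : z + _ = (z.1, z.2 + h)) -?surjective_pairing//.
  by case: (z) => u v; congr (_, _); rewrite /= addr0.
Qed.

Lemma differentiable_eps (phi : 'rV[R]_n.+1 -> R) x : differentiable phi x ->
  forall e : R, 0 < e -> exists2 d : R, 0 < d &
    forall h, `|h| < d -> `|phi (x + h) - phi x - 'd phi x h| <= e * `|h|.
Proof.
move=> /diff_locally /eqaddoP dphi e e0.
have /nbhs_ballP[d /= d0 dP] := dphi e e0; exists d => // h hd.
have := dP h; rewrite -ball_normE /= sub0r normrN => /(_ hd).
by rewrite -addrA -opprD [x + h]addrC.
Qed.

(** Composition with the linear map z |-> u + I v; the partial derivatives are the
    values of the composed differential on the unit vectors. *)
Lemma diffat_slice (phi : 'rV[R]_n.+1 -> R) I z : differentiable phi (slice_pt I z) ->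
  diffat (fun w => phi (slice_pt I w) : R^o) z
    ((fun t => phi (slice_pt I (t, z.2)))^`()%classic z.1)
    ((fun t => phi (slice_pt I (z.1, t)))^`()%classic z.2).
Proof.
move=> dphi; pose L := 'd phi (slice_pt I z).
have D : diffat (fun w => phi (slice_pt I w) : R^o) z
    (L (slice_pt I (1, 0))) (L (slice_pt I (0, 1))).
  move=> e e0; have I1 : 0 < 1 + `|I| by rewrite ltr_pwDl.
  have [d d0 dP] := differentiable_eps dphi (divr_gt0 e0 I1).
  exists (d / (1 + `|I|)) => [|h]; first by rewrite divr_gt0.
  rewrite ltr_pdivlMr// => hd; have hs := slice_pt_norm I h.
  have -> : h.1 *: L (slice_pt I (1, 0)) + h.2 *: L (slice_pt I (0, 1)) = L (slice_pt I h).
    rewrite -!linearZ -linearD -!slice_ptZ -slice_ptD; congr (L (slice_pt I _)).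
    by case: (h) => u v; congr (_, _); rewrite /= /GRing.scale /=; ring.
  rewrite slice_ptD (le_trans (dP _ _))//; first by rewrite (le_lt_trans hs)// mulrC.
  by rewrite mulrAC ler_pdivrMr// -mulrA ler_pM2l// mulrC.
by have [-> ->] := diffat_partials D.
Qed.

Lemma diffat_sum (E' : completeNormedModType R) (J : Type) (s : seq J)
    (g : J -> R * R -> E') z (A B : J -> E') :
  (forall j, diffat (g j) z (A j) (B j)) ->
  diffat (fun w => \sum_(j <- s) g j w) z (\sum_(j <- s) A j) (\sum_(j <- s) B j).
Proof.
move=> gz; elim: s => [|j s IH].
  rewrite !big_nil (_ : (fun w => _) = (fun=> 0)); first exact: diffat_cst.
  by apply/funext => w; rewrite big_nil.
rewrite !big_cons (_ : (fun w => _) = (fun w => g j w + \sum_(j <- s) g j w)).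
  exact: diffatD.
by apply/funext => w; rewrite big_cons.
Qed.

Lemma scalar_op_sum (a : Rn) : scal a = \sum_A a A *: (cmono (1 : bop V) A : E).
Proof.
apply/ffunP => B; rewrite ffunE sum_ffunE (bigD1 B)//= big1 ?addr0 => [|A /negPf AB].
  by rewrite !ffunE eqxx.
by rewrite !ffunE eq_sym AB scaler0.
Qed.

(** The components of f are assembled into an operator-valued function, with the
    partial derivatives of the definition of s-monogenicity. *)
Lemma s_monogenic_lholo W (f : 'rV[R]_n.+1 -> Rn) I z :
  s_monogenic W f -> unit_sphere I -> slice W I z ->
  lholo (scal (vec_embed I) : E) (fun w => scal (f (slice_pt I w))) z.
Proof.
move=> [_ fd cr] I1 Wz.
exists (scal (partial_u f I z)), (scal (partial_v f I z)); split; last first.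
  rewrite -scalar_opM -scalar_opD; have /eqP := cr I z I1 Wz.
  rewrite scaler_eq0 invr_eq0 pnatr_eq0 /= => /eqP ->.
  by rewrite -(scale0r (1 : Rn)) scalar_opZ scale0r.
rewrite (_ : (fun w => _) =
    (fun w => \sum_A f (slice_pt I w) A *: (cmono (1 : bop V) A : E))); last first.
  by apply/funext => w; rewrite scalar_op_sum.
rewrite !scalar_op_sum; apply: diffat_sum => A; rewrite !ffunE.
have H := diffat_slice (fd _ A Wz).
have := diffat_scale H (diffat_cst (cmono (1 : bop V) A : E) z).
by move/diffat_eq; apply; rewrite scaler0 addr0.
Qed.

End SliceRegularity.

(** * The representation formula near the spectrum *)

Section Representation.
Variables (R : realType) (V : completeNormedModType R) (n : nat).
Notation E := (cliff n (bop V)).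
Notation Rn := (cliff n R).
Notation scal := (@scalar_op R V n).
Variables (T : E) (f : 'rV[R]_n.+1 -> Rn) (W : set 'rV[R]_n.+1).
Hypothesis fW : s_monogenic W f.
Hypothesis circW : circ (S_spectrum T) `<=` W.
Implicit Types (I : 'rV[R]_n).

Lemma diffat_reflect (g : R * R -> E) z A B : diffat g (reflect z) A B ->
  diffat (fun w => g (reflect w)) z A (- B).
Proof.
move=> gz e e0; have [d d0 dP] := gz e e0; exists d; first exact: d0.
move=> h hd; have := dP (reflect h); rewrite prod_normE /= normrN -prod_normE => /(_ hd); rewrite scaleNr -scalerN.
by rewrite (_ : reflect (z + h) = reflect z + reflect h)// /reflect /= opprD.
Qed.

Definition slice_val I z : E := scal (f (slice_pt I z)).

(** The components of f on the slice of [J]: on a neighbourhood of the spectrum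
    f (u + I v) = a (u, v) + I b (u, v) for every unit I. *)
Definition even_part J z : E := 2^-1 *: (slice_val J z + slice_val J (reflect z)).
Definition odd_part J z : E :=
  - (2^-1 *: (scal (vec_embed J) * (slice_val J z - slice_val J (reflect z)))).

Lemma even_partN J z : even_part J (reflect z) = even_part J z.
Proof. by rewrite /even_part reflectK addrC. Qed.

Lemma odd_partN J z : odd_part J (reflect z) = - odd_part J z.
Proof. by rewrite /odd_part reflectK -opprB mulrN scalerN. Qed.

Lemma slice_real I J u : slice_pt I (u, 0) = slice_pt J (u, 0).
Proof. by apply/rowP => j; rewrite !mxE; case: unlift => //= l; rewrite !mul0r. Qed.

Lemma even_part_real I J u : slice_val I (u, 0) = even_part J (u, 0).
Proof.
rewrite /even_part /reflect /= oppr0 /slice_val (slice_real I J); move: (scal _) => v.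
by rewrite scalerDr -scalerDl -[X in X + _]mul1r -[X in _ + X]mul1r -splitr scale1r.
Qed.

Lemma odd_part_real J u : odd_part J (u, 0) = 0.
Proof. by rewrite /odd_part /reflect /= oppr0 subrr mulr0 scaler0 oppr0. Qed.

(** The Cauchy-Riemann equations on the slice of J say a_u = b_v and a_v = - b_u,
    where the unit does not occur any more. *)
Lemma lholo_representation (i : E) J z : i * i = -1 -> unit_sphere J ->
  lholo (scal (vec_embed J) : E) (slice_val J) z ->
  lholo (scal (vec_embed J) : E) (slice_val J) (reflect z) ->
  lholo i (fun w => even_part J w + i * odd_part J w) z.
Proof.
move=> ii J1; have jj := vec_op_sqr V J1; set j : E := scal _ in jj *.
move=> [p [q [dF cr]]] [p' [q' [dF' cr']]].
have dR := diffat_reflect dF'.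
have dA : diffat (even_part J) z (2^-1 *: (p + p')) (2^-1 *: (q - q')).
  apply: (@diffat_lin _ _ _ (fun v : E => 2^-1 *: v) (2^-1)).
  - by move=> k a b; rewrite scalerDr !scalerA mulrC.
  - by move=> v; rewrite normrZ ger0_norm ?invr_ge0.
  - exact: diffatD dF dR.
have dB : diffat (odd_part J) z (- (2^-1 *: (j * (p - p')))) (- (2^-1 *: (j * (q + q')))).
  apply: (@diffat_lin _ _ _ (fun v : E => - (2^-1 *: (j * v))) (2^-1 * `|j|)).
  - by move=> k a b; rewrite mulrDr -cliff_scalerAr scalerDr opprD scalerN !scalerA (mulrC k).
  - move=> v; rewrite normrN normrZ ger0_norm ?invr_ge0// -mulrA.
    by rewrite ler_wpM2l ?invr_ge0// cliff_normM.
  - have := diffatD dF (diffatN dR).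
    by move/diffat_eq; apply; rewrite ?opprK.
have dC := diffat_lin (linear_lmul i) (norm_lmul i) dB.
exists (2^-1 *: (p + p') + i * - (2^-1 *: (j * (p - p')))).
exists (2^-1 *: (q - q') + i * - (2^-1 *: (j * (q + q')))).
split; first exact: diffatD dA dC.
have pE : p = - (j * q) by apply/eqP; rewrite -addr_eq0 cr.
have pE' : p' = - (j * q') by apply/eqP; rewrite -addr_eq0 cr'.
have e1 : j * (p - p') = q - q'.
  by rewrite pE pE' mulrBr !mulrN !mulrA jj !mulN1r !opprK.
have e2 : j * (q + q') = - (p + p') by rewrite mulrDr pE pE' -opprD opprK.
rewrite e1 e2 scalerN opprK mulrDr mulrA ii mulN1r mulrN.
by zmodule.
Qed.

Let K := plane_spectrum T.

Lemma spectrum_slice I z : unit_sphere I -> S_spectrum T (slice_pt I z) = plane_spectrum T z.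
Proof. by move=> I1; rewrite /S_spectrum /= pencil_slice. Qed.

(** The sphere of [circ] through a spectral point u + I v cuts every slice in
    the circle with centre u and radius |v|. *)
Lemma slice_circle I u v (a : R) : unit_sphere I -> K (u, v) ->
  W (slice_pt I (u + v * cos a, v * sin a)).
Proof.
move=> I1 Kuv; apply: circW; exists u, v, I, (slice_pt I (cos a, sin a)); split => //.
- by rewrite spectrum_slice.
- by rewrite /unit_sphere /= euclid_slice// /sqnorm /= -!expr2 cos2Dsin2.
- apply/rowP => j; rewrite !mxE; case: unliftP => [l ->|->] /=.
    by rewrite ?andbF mulr0 add0r mulrA.
  by rewrite ?eqxx mulr1.
Qed.

Let M I J : set (R * R) :=
  [set z | [/\ slice W I z, slice W J z & slice W J (reflect z)]].

Lemma open_regular I J : open (M I J).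
Proof.
have oW : open W by case: fW.
have -> : M I J = slice W I `&` (slice W J `&` (@reflect R @^-1` slice W J)).
  by apply/seteqP; split => [z [? ? ?]|z [? [? ?]]].
apply: openI; first exact: open_slice.
apply: openI; first exact: open_slice.
rewrite openE => z Uz.
have /nbhs_ballP[e /= e0 eP] : nbhs (reflect z) (slice W J).
  exact: open_nbhs_nbhs (conj (@open_slice _ _ W J oW) Uz).
apply/nbhs_ballP; exists e => //= w wz; apply: eP; move: wz.
by rewrite -!ball_normE /= reflect_norm.
Qed.

(** Unique continuation along the quarter of a circle that joins a real point to
    a point of the spectrum. *)
Lemma representation_at I J z0 : unit_sphere I -> unit_sphere J -> K z0 ->
  exists2 d : R, 0 < d & forall w, `|w - z0| <= d -> M I J w /\
    slice_val I w = even_part J w + scal (vec_embed I) * odd_part J w.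
Proof.
move=> I1 J1 Kz0; set i : E := scal _.
pose g w : E := slice_val I w - (even_part J w + i * odd_part J w).
have ii : i * i = -1 by exact: vec_op_sqr.
pose p (t : R) : R * R := (z0.1 + z0.2 * cos (t * (pi / 2)), z0.2 * sin (t * (pi / 2))).
have p1 : p 1 = z0.
  by rewrite /p mul1r cos_pihalf sin_pihalf mulr0 addr0 mulr1 -surjective_pairing.
have ct : continuous (fun t : R => t * (pi / 2)) by exact: mulrr_continuous.
have c1 : continuous (fun t => (p t).1).
  move=> t; apply: cvgD; first exact: cvg_cst.
  apply: cvgM; first exact: cvg_cst.
  by apply: continuous_comp; [exact: ct | exact: continuous_cos].
have c2 : continuous (fun t => (p t).2).
  move=> t; apply: cvgM; first exact: cvg_cst.
  by apply: continuous_comp; [exact: ct | exact: continuous_sin].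
have Kz : K (z0.1, z0.2) by rewrite -surjective_pairing.
have pM t : M I J (p t).
  split; [exact: slice_circle | exact: slice_circle |].
  have := slice_circle (- (t * (pi / 2))) J1 Kz.
  by rewrite cosN sinN mulrN.
have holo w : M I J w -> lholo i g w.
  move=> [wI wJ wJ']; apply: lholoB; first exact: s_monogenic_lholo fW I1 wI.
  by apply: lholo_representation => //; exact: s_monogenic_lholo fW J1 _.
have pc (t : R) : 0 <= t <= 1 -> forall e : R, 0 < e ->
    exists2 d : R, 0 < d & forall s : R, 0 <= s <= 1 -> `|s - t| < d -> `|p s - p t| < e.
  move=> _ e e0; have /cvgrPdist_lt/(_ e e0) n1 := c1 t.
  have /cvgrPdist_lt/(_ e e0) n2 := c2 t.
  have N : \forall s \near t, `|(p t).1 - (p s).1| < e /\ `|(p t).2 - (p s).2| < e.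
    by apply: filterS2 n1 n2 => s.
  have /nbhs_ballP[d /= d0 dP] := N; exists d => // s _ st.
  have [|s1 s2] := dP s; first by rewrite -ball_normE /= distrC.
  by rewrite distrC prod_norm_lt s1 s2.
have [|d d0 dP] := holo_zero_path ii (open_regular (I := I) (J := J)) holo pc (fun t _ => pM t) (@ltr01 R).
  move=> t _; rewrite /p !mul0r sin0 mulr0 /g (even_part_real I J) odd_part_real.
  by rewrite mulr0 addr0 subrr.
have /nbhs_ballP[e /= e0 eP] : nbhs z0 (M I J).
  by rewrite -p1; exact: open_nbhs_nbhs (conj (@open_regular I J) (pM 1)).
exists (Num.min d (e / 2)) => [|w]; first by rewrite lt_min d0 divr_gt0.
rewrite le_min => /andP[wd we]; split.
  apply: eP; rewrite -ball_normE /= distrC (le_lt_trans we)//.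
  by rewrite ltr_pdivrMr// ltr_pMr// ltr1n.
by apply/eqP; rewrite -subr_eq0; apply/eqP/dP; rewrite p1.
Qed.

(** The radius is uniform because the spectrum is compact. *)
Lemma representation_near I J : unit_sphere I -> unit_sphere J ->
  exists2 d : R, 0 < d & forall z w, K z -> `|w - z| <= d -> M I J w /\
    slice_val I w = even_part J w + scal (vec_embed I) * odd_part J w.
Proof.
move=> I1 J1.
pose S (d : R) z := forall w, `|w - z| <= d -> M I J w /\
    slice_val I w = even_part J w + scal (vec_embed I) * odd_part J w.
have [||d d0 dP] := @compact_uniform R (R * R)%type K S (@compact_spectrum _ _ _ T).
- by move=> d d' z _ dd Sd w wz; apply: Sd; exact: le_trans wz dd.
- move=> z Kz; have [d d0 dP] := representation_at I1 J1 Kz.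
  have d2 : 0 < d / 2 by rewrite divr_gt0.
  exists (d / 2) => // y _; rewrite -ball_normE /= distrC => /ltW zy w wy; apply: dP.
  by rewrite (le_trans (ler_distD y _ _))// [d]splitr lerD.
by exists d => // z w Kz; exact: dP.
Qed.

(** The integrand S^-1(s, T) ds_I f(s) is formP du + formQ dv. *)
Definition formP I z : E :=
  - (slice_resolvent T (scal (vec_embed I)) z * scal (vec_embed I) * slice_val I z).
Definition formQ I z : E := slice_resolvent T (scal (vec_embed I)) z * slice_val I z.

Lemma closedat_form I z : unit_sphere I -> slice W I z -> ~ K z ->
  closedat (formP I) (formQ I) z.
Proof.
move=> I1 Wz Kz; have ii := vec_op_sqr V I1; set i : E := scal _ in ii.
have holo : lholo i (fun w => - (i * slice_val I w)) z.
  have [A [B [dF cr]]] := s_monogenic_lholo V fW I1 Wz.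
  exists (- (i * A)), (- (i * B)); split.
    exact: diffatN (diffat_lin (linear_lmul i) (norm_lmul i) dF).
  by rewrite mulrN -opprD -mulrDr cr mulr0 oppr0.
have H := closedat_product ii (rholo_slice_resolvent ii Kz) holo.
have -> : formP I = (fun w => slice_resolvent T i w * - (i * slice_val I w)).
  by apply/funext => w; rewrite /formP mulrN mulrA.
have -> : formQ I = (fun w => slice_resolvent T i w * i * - (i * slice_val I w)); last exact: H.
apply/funext => w; rewrite /formQ; move: (slice_resolvent T _ w) (slice_val I w) => s v.
by rewrite mulrN -mulrA (mulrA i) ii mulN1r mulrN opprK.
Qed.

Lemma form_ring (A : pzRingType) (i al be a b : A) : i * i = -1 ->
  - ((al + be * i) * i * (a + i * b)) + (al - be * i) * i * (a - i * b)
    = al * b + be * a + (al * b + be * a)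
  /\ (al + be * i) * (a + i * b) + (al - be * i) * (a - i * b)
    = al * a - be * b + (al * a - be * b).
Proof.
move=> ii; have iK x : x * i * i = - x by rewrite -mulrA ii mulrN1.
by split; rewrite !(mulrDl, mulrDr, mulrN, mulNr, mulrA) !(iK, mulNr); zmodule.
Qed.

(** The reflected-even parts of the form near the spectrum, in terms of the
    components of f and of S^-1 = al + be i; the unit I has disappeared. *)
Lemma form_even I J z : unit_sphere I ->
  slice_val I z = even_part J z + scal (vec_embed I) * odd_part J z ->
  slice_val I (reflect z) =
    even_part J (reflect z) + scal (vec_embed I) * odd_part J (reflect z) ->
  let al := - (pencil_inv T z * (T - z.1 *: (1 : E))) in let be := - (z.2 *: pencil_inv T z) in
  let a := even_part J z in let b := odd_part J z in
  formP I z - formP I (reflect z) = al * b + be * a + (al * b + be * a) /\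
  formQ I z + formQ I (reflect z) = al * a - be * b + (al * a - be * b).
Proof.
move=> I1 F1 F2 al be a b; have ii := vec_op_sqr V I1.
rewrite even_partN odd_partN mulrN in F2.
have RzN : pencil_inv T (reflect z) = pencil_inv T z by rewrite /pencil_inv /plane_pencil /sqnorm /= mulrNN.
rewrite /formP /formQ F1 F2 -/a -/b; set i : E := scal _ in ii *.
have S1 : slice_resolvent T i z = al + be * i.
  rewrite /slice_resolvent cpx_reflect /cpx scalerN opprD opprK addrA mulrDr opprD.
  by rewrite /be mulNr -cliff_scalerAl -cliff_scalerAr.
have S2 : slice_resolvent T i (reflect z) = al - be * i.
  rewrite /slice_resolvent RzN reflectK /cpx opprD addrA mulrDr opprD.
  by rewrite /be mulrN mulNr -cliff_scalerAl -cliff_scalerAr.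
by rewrite S1 S2 opprK; exact: form_ring.
Qed.

(** The collar of the spectrum lies where f = a + I b, and there the
    reflected-even part of the form does not depend on I. *)
Lemma residue_unit I J : unit_sphere I -> unit_sphere J ->
  exists2 d : R, 0 < d & forall (c h : R) m, 0 < h -> h <= d -> m%:R * h = 2 * c ->
    lattice_residue K (formP I) (formQ I) c h m =
    lattice_residue K (formP J) (formQ J) c h m.
Proof.
move=> I1 J1; have [d d0 dP] := representation_near I1 J1.
have [d' d'0 d'P] := representation_near J1 J1.
exists (Num.min d d') => [|c h m h0]; first by rewrite lt_min d0.
rewrite le_min => /andP[hd hd'] mh.
have near (z : R * R) (r : R) : h <= r -> collar K h z -> 
    exists w w', [/\ K w, `|z - w| <= r, K w' & `|reflect z - w'| <= r].
  move=> hr [[w Kw zw] _]; exists w, (reflect w); rewrite reflect_norm.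
  by split; [| exact: le_trans zw hr | exact: spectrum_reflect | exact: le_trans zw hr].
have cont L : unit_sphere L -> (forall z, collar K h z -> slice W L z) ->
    collar_cont K h (formP L) (formQ L).
  move=> L1 LW z zc; have cl := closedat_form L1 (LW z zc) zc.2.
  by split; [exact: closedat_contP cl | exact: closedat_contQ cl].
apply: (lattice_residue_even h0 (@spectrum_reflect _ _ _ T) mh).
- apply: cont => // z /(near _ _ hd)[w [w' [Kw zw _ _]]].
  by have [[]] := dP w z Kw zw.
- apply: cont => // z /(near _ _ hd')[w [w' [Kw zw _ _]]].
  by have [[]] := d'P w z Kw zw.
- move=> z zc; have [w [w' [Kw zw Kw' zw']]] := near z _ hd zc.
  have [v [v' [Kv zv Kv' zv']]] := near z _ hd' zc.
  have [-> ->] := form_even I1 (dP w z Kw zw).2 (dP w' _ Kw' zw').2.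
  by have [-> ->] := form_even J1 (d'P v z Kv zv).2 (d'P v' _ Kv' zv').2.
Qed.

End Representation.

(** * Independence of the slice and of the open set *)

Section LineIntegralUniqueness.
Variables (R : realType) (E : completeNormedModType R).
Implicit Types (w : R * R -> R * R -> E) (g : R -> R * R).

Lemma fine_partition (d : R) : 0 < d ->
  exists2 s : seq R, itv_partition 0 1 s &
    forall k, (k < size s)%N -> node s k.+1 - node s k < d.
Proof.
move=> d0; pose N := Num.truncn d^-1; pose x (k : nat) : R := k%:R / N.+1%:R.
pose s := mkseq (fun k => x k.+1) N.+1.
have Nd : (N.+1%:R)^-1 < d.
  by rewrite -[ltRHS]invrK ltf_pV2 ?posrE ?invr_gt0//; exact: truncnS_gt.
have nodeE k : (k <= N.+1)%N -> node s k = x k.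
  by case: k => [|k] kN; [rewrite /node /x mul0r | rewrite /node /= nth_mkseq].
exists s => [|k]; last first.
  rewrite size_mkseq => kN; rewrite !nodeE//; last exact: ltnW.
  by rewrite /x -mulrBl -natrB// subSnn mul1r.
split; last first.
  by rewrite (last_nth 1) size_mkseq -/(node s N.+1) nodeE// /x divff// pnatr_eq0.
apply/(pathP 1) => k; rewrite size_mkseq => kN.
rewrite -/(node s k) nodeE; last exact: ltnW.
by rewrite nth_mkseq// /x ltr_pM2r ?invr_gt0// ltr_nat.
Qed.

Lemma line_integral_uniq w g J J' : is_line_integral Num.norm w g J ->
  is_line_integral Num.norm w g J' -> J = J'.
Proof.
move=> gJ gJ'; apply/eqP; rewrite -subr_eq0 -normr_le0.
apply: (@small_le0 R _ 2 1) => // e e0 _.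
have [d d0 dP] := gJ e e0; have [d' d'0 d'P] := gJ' e e0.
have [|s ps sd] := @fine_partition (Num.min d d'); first by rewrite lt_min d0.
have ns k : (k < size s)%N -> node s k <= node s k <= node s k.+1.
  move=> ks; rewrite lexx /=; case: ps => /(pathP 1)/(_ k ks) lt _.
  exact: ltW.
have [m1 m2] : Num.min d d' <= d /\ Num.min d d' <= d' by rewrite !ge_min !lexx orbT.
have := dP s (node s) ps (fun k ks => conj (lt_le_trans (sd k ks) m1) (ns k ks)).
have := d'P s (node s) ps (fun k ks => conj (lt_le_trans (sd k ks) m2) (ns k ks)).
move: (\sum_(k < size s) _) => S SJ' SJ.
rewrite (_ : J - J' = (S - J') - (S - J)); last by zmodule.
by rewrite (le_trans (ler_normB _ _))//; move: SJ SJ'; move: `|_| `|_| => a b; lra.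
Qed.

Lemma cycle_integral_uniq w m (G : 'I_m -> R -> R * R) J J' :
  is_cycle_integral Num.norm w G J -> is_cycle_integral Num.norm w G J' -> J = J'.
Proof.
move=> [K KP ->] [K' KP' ->]; apply: eq_bigr => k _.
exact: line_integral_uniq (KP k) (KP' k).
Qed.

Lemma fine_mesh (c r : R) : 0 < c -> 0 < r ->
  exists h n, [/\ 0 < h, h < r & n%:R * h = 2 * c].
Proof.
move=> c0 r0; have c2 : 0 < 2 * c by rewrite mulr_gt0.
pose N := (Num.truncn (2 * c / r)).+1; exists (2 * c / N%:R), N.
have N0 : 0 < N%:R :> R by rewrite ltr0n.
split; first by rewrite divr_gt0.
- by rewrite ltr_pdivrMr// [ltRHS]mulrC -ltr_pdivrMr//; exact: truncnS_gt.
- by rewrite mulrC divfK// gt_eqF.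
Qed.

End LineIntegralUniqueness.

Section FunctionalIntegral.
Variables (R : realType) (V : completeNormedModType R) (n : nat).
Notation E := (cliff n (bop V)).
Variables (T : E) (f : 'rV[R]_n.+1 -> cliff n R).

(** Convergence in the sum norm is enough. *)
Lemma bnorm_le (S : E) : bnorm S <= `|S|.
Proof.
have S0 : 0 <= `|S| by [].
rewrite /bnorm -[leRHS]ger0_norm// -sqrtr_sqr ler_sqrt ?sqr_ge0//.
rewrite expr2 cnormE mulr_suml; apply: ler_sum => A _.
by rewrite expr2 -cnormE; exact: (ler_wpM2l (opnorm_ge0 _) (le_cnorm S A)).
Qed.

(** The slice of U contains the plane spectrum because U contains the
    circularization, which contains the spectrum itself; off the spectrum the
    form is closed. *)
Lemma cycle_integral_form U I m (G : 'I_m -> R -> R * R) :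
  admissible (S_spectrum T) U -> s_monogenic_on (U `|` boundary U) f ->
  unit_sphere I -> jordan_boundary (slice U I) G -> positively_oriented (slice U I) G ->
  exists c0 : R, forall c, c0 <= c -> exists2 r : R, 0 < r &
    forall h k, 0 < h -> h < r -> k%:R * h = 2 * c ->
    is_cycle_integral (@Num.norm _ E) (fun z v => v.1 *: formP T f I z + v.2 *: formQ T f I z) G
      (lattice_residue (plane_spectrum T) (formP T f I) (formQ T f I) c h k).
Proof.
move=> [oU _ cU] [W UW fW] I1 jG pG.
have oW : open W by case: fW.
apply: (@cycle_integral_lattice _ _ _ _ (slice W I) _ (slice U I)) => //.
- exact: open_slice.
- move=> [u v] Kz; have := slice_circle cU (pi / 2) I1 Kz.
  by rewrite cos_pihalf sin_pihalf mulr0 addr0 mulr1.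
- exact: closed_spectrum.
- by move=> z /closure_slice /closure_boundary /UW.
- exact: open_slice.
- by move=> z Wz Kz; exact: (closedat_form fW I1 Wz Kz).
Qed.

End FunctionalIntegral.

Theorem theorem3p12 (R : realType) (V : completeNormedModType R) (n : nat)
    (T : cliff n (bop V)) (f : 'rV[R]_n.+1 -> cliff n R) :
  paravector_op T ->
  functional_class (S_spectrum T) f ->
  exists J : cliff n (bop V),
    forall (U : set 'rV[R]_n.+1) (I : 'rV[R]_n)
           (m : nat) (G : 'I_m -> R -> R * R),
      admissible (S_spectrum T) U ->
      s_monogenic_on (U `|` boundary U) f ->
      unit_sphere I ->
      jordan_boundary (slice U I) G ->
      positively_oriented (slice U I) G ->
      is_functional_integral T f I G J.
Proof.
move=> _ [W [oW _ cW] fW].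
pose ok U I m (G : 'I_m -> R -> R * R) := [/\ admissible (S_spectrum T) U,
  s_monogenic_on (U `|` boundary U) f, unit_sphere I,
  jordan_boundary (slice U I) G & positively_oriented (slice U I) G].
have [[U0 [I0 [m0 [G0 ok0]]]]|no] :=
    pselect (exists U I m (G : 'I_m -> R -> R * R), ok U I m G); last first.
  by exists 0 => U I m G ? ? ? ? ?; case: no; exists U, I, m, G.
pose res I c h k := lattice_residue (plane_spectrum T) (formP T f I) (formQ T f I) c h k.
have [a0 f0 I01 j0 p0] := ok0.
have [c0 c0P] := cycle_integral_form a0 f0 I01 j0 p0.
have [|r r0 rP] := c0P (Num.max c0 1); first by rewrite le_max lexx.
have [|h [k [h0 hr hk]]] := @fine_mesh R (Num.max c0 1) r _ r0.
  by rewrite lt_max ltr01 orbT.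
have J0 := rP h k h0 hr hk; rewrite -/(res I0 _ h k) in J0.
exists ((2 * pi)^-1 *: res I0 (Num.max c0 1) h k) => U I m G aU fU I1 jG pG.
exists (res I0 (Num.max c0 1) h k) => //.
have [c1 c1P] := cycle_integral_form aU fU I1 jG pG.
pose c := Num.max (Num.max c0 1) c1.
have c_pos : 0 < c by rewrite !lt_max ltr01 orbT.
have [|r' r'0 r'P] := c0P c; first by rewrite !le_max lexx.
have [|r1 r10 r1P] := c1P c; first by rewrite le_max lexx orbT.
have [d d0 dP] := residue_unit fW cW I1 I01.
have [|h' [k' [h'0 h'r kh']]] := @fine_mesh R c (Num.min r' (Num.min r1 d)) c_pos.
  by rewrite !lt_min r'0 r10.
move: h'r; rewrite !lt_min => /and3P[hr' hr1 hd].
have J1 := r'P h' k' h'0 hr' kh'.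
rewrite (cycle_integral_uniq J0 J1) -(dP c h' k' h'0 (ltW hd) kh').
have [K KP ->] := r1P h' k' h'0 hr1 kh'; exists K => // l e e0.
have [d' d'0 d'P] := KP l e e0; exists d' => // s tau ps st.
apply: le_lt_trans (bnorm_le _) _; rewrite (eq_bigr _ (fun j _ => integrandE _ _ _ _ I1)).
exact: d'P.
Qed.
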